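(* Let $\tilde f$ be a polynomial of degree $\mathbf{m}$ with critical gap $\theta_{\tilde f}$ and an irreducible factorization $\tilde\alpha\tilde f_1\tilde f_2\cdots\tilde f_k$. Then $\theta_{\tilde f}>0$ and the following hold. (i) The numerical factorization of $\tilde f$ within any $\epsilon\in(0,\theta_{\tilde f})$ is identical to the exact irreducible factorization of $\tilde f$. (ii) There is a neighborhood $\Omega_{\tilde f}$ of $\tilde f$ in $\mathbb{P}^{\mathbf{m}}$ such that every $f\in\Omega_{\tilde f}$ is associated with a constant $\delta_f\le\|f-\tilde f\|$ such that the numerical factorization $\alpha f_1f_2\cdots f_l$ of $f$ uniquely exists within $\epsilon$ for all $\epsilon\in(\delta_f,\frac12\theta_{\tilde f})$ and is Lipschitz continuous with respect to $f$. (iii) For every $f\in\Omega_{\tilde f}$ and $\epsilon\in(\delta_f,\frac12\theta_{\tilde f})$, the numerical factorization $\alpha f_1f_2\cdots f_l$ of $f$ within $\epsilon$ (with the constant $\alpha$ chosen so that $\|f-\alpha f_1\cdots f_l\|=\min_{\gamma\in\mathbb{C}}\|f-\gamma f_1\cdots f_l\|$) satisfies $$\|f-\alpha f_1f_2\cdots f_l\|\le\|f-\tilde f\|.$$ (iv) For every $f\in\Omega_{\tilde f}$ (as empirical data of $\tilde f$) and $\epsilon\in(\delta_f,\frac12\theta_{\tilde f})$, the numerical factorization $\alpha f_1f_2\cdots f_l$ of $f$ within $\epsilon$ has the identical factorization structure as $\tilde\alpha\tilde f_1\tilde f_2\cdots\tilde f_k$, and $$\mathrm{dist}\big(\alpha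 f_1f_2\cdots f_l,\ \tilde\alpha\tilde f_1\tilde f_2\cdots\tilde f_k\big)\le\eta_{\tilde f}\,\|f-\tilde f\|,$$ where $\eta_{\tilde f}>0$ is a constant depending on $\tilde f$.
   Context: For nonzero $f\in\mathbb{C}[x_1,\ldots,x_\ell]$, $\deg(f)=(\deg_{x_1}f,\ldots,\deg_{x_\ell}f)$. $\mathbb{P}^{\mathbf{n}}$ is the vector space of polynomials of degree $\le\mathbf{n}$ (componentwise), $\langle\mathbf{n}\rangle=\dim\mathbb{P}^{\mathbf{n}}$, $\mathscr{P}^{\mathbf{n}}$ is the set of polynomials of degree exactly $\mathbf{n}$. $[\![f]\!]$ is the coefficient vector of $f$ in the monomial basis and $\|f\|=\|[\![f]\!]\|_2$, giving $\mathbb{P}^{\mathbf{n}}$ its topology. The dot product is $u\cdot v=u^{\mathsf H}v$. Structures and manifolds. If $f$ has degree $\mathbf{m}$ and $f=\alpha f_1^{k_1}\cdots f_r^{k_r}$ with $\alpha\in\mathbb{C}\setminus\{0\}$, $f_j$ irreducible and pairwise coprime, $k_j\ge1$, $\mathbf{m}_j=\deg(f_j)$, then the factorization structure of $f$ is the formal product $\mathfrak{M}=\mathbf{m}_1^{k_1}\cdots\mathbf{m}_r^{k_r}$ (order irrelevant). A factorization structure is one that arises from some polynomial; $\deg(\mathfrak{M})=k_1\mathbf{m}_1+\cdots+k_r\mathbf{m}_r$. $\mathscr{F}^{\mathfrak{M}}$ is the set of all $f\in\mathscr{P}^{\mathbf{m}}$, $\mathbf{m}=\deg(\mathfrak{M})$,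 of the form $\alpha g_1^{k_1}\cdots g_r^{k_r}$ with $\alpha\in\mathbb{C}$ and $g_j\in\mathscr{P}^{\mathbf{m}_j}$ irreducible and pairwise coprime. It is a complex analytic manifold in $\mathbb{P}^{\mathbf{m}}$ with $\mathrm{codim}(\mathscr{F}^{\mathfrak{M}})=\langle\mathbf{m}\rangle-(\langle\mathbf{m}_1\rangle+\cdots+\langle\mathbf{m}_r\rangle+1-r)$. $\mathrm{dist}(f,\mathscr{F}^{\mathfrak{M}})=\inf_{g\in\mathscr{F}^{\mathfrak{M}}}\|f-g\|$. Critical gap. For $\tilde f$ of degree $\mathbf{m}$, $\theta_{\tilde f}=\min\{\mathrm{dist}(\tilde f,\mathscr{F}^{\mathfrak{M}}):\ \mathfrak{M}\text{ a factorization structure of degree }\mathbf{m}\text{ with }\tilde f\notin\overline{\mathscr{F}^{\mathfrak{M}}}\}$ (with the convention $+\infty$ if there is no such $\mathfrak{M}$). Factorizations. A factorization $\alpha f_1\cdots f_k$ is a formal product with $\alpha\in\mathbb{C}\setminus\{0\}$ and nonconstant $f_j$ (the notation also denotes the product polynomial); it is a factorization of $f$ if the product is a nonzero constant multiple of $f$, and irreducible if all $f_j$ are. Two factorizations are equivalent if they have the same number of nonconstant factors and these agree up to order and nonzero constant multiples. Factorizations are identified (uniqueness, identity) up to this equivalence. The distance is $\mathrm{dist}(\alpha f_1\cdots f_k,\gamma g_1\cdots g_m)=1$ if $m\ne k$, and $=\min_\sigma\max_j\sin(f_j,g_{\sigma_j})$ (minimum over permutations $\sigma$ of $\{1,\ldots,k\}$)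 if $m=k$, where for nonzero $p,q$, $\sin(p,q)=\Big\|\frac{p}{\|p\|}-\frac{[\![q]\!]\cdot[\![p]\!]}{\|q\|\|p\|}\frac{q}{\|q\|}\Big\|$. Lipschitz continuity of the numerical factorization (in the local sense) is with respect to this distance and $\|\cdot\|$. Numerical factorization. For a polynomial $f$ and $\epsilon>0$, $\alpha f_1\cdots f_s$ is a numerical (irreducible) factorization of $f$ within $\epsilon$ if $\alpha f_1\cdots f_s\in\mathscr{F}^{\mathfrak{M}}$ is an irreducible factorization and $$\min_{\gamma\in\mathbb{C}}\|f-\gamma f_1\cdots f_s\|=\min_{g\in\mathscr{F}^{\mathfrak{M}}}\|f-g\|=\mathrm{dist}(f,\mathscr{F}^{\mathfrak{M}})<\epsilon,$$ where $\mathfrak{M}$ is the factorization structure of degree $\mathbf{m}=\deg(f)$ such that $\mathrm{codim}(\mathscr{F}^{\mathfrak{M}})=\max\{\mathrm{codim}(\mathscr{F}^{\mathfrak{N}}):\deg(\mathfrak{N})=\mathbf{m},\ \mathrm{dist}(f,\mathscr{F}^{\mathfrak{N}})<\epsilon\}$ in $\mathbb{P}^{\mathbf{m}}$. *)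

(* Defs.v *)
(* multinomials has to be imported before mathcomp-analysis: in the other     *)
(* order the two grammars clash.                                              *)
From HB Require Import structures.
From mathcomp Require Export all_boot all_order all_algebra fingroup perm.
From mathcomp Require Export complex mpoly.
From mathcomp Require Export mathcomp_extra boolp classical_sets reals ereal.

Set Implicit Arguments.
Unset Strict Implicit.
Unset Printing Implicit Defensive.

Import Order.TTheory GRing.Theory Num.Theory.

Local Open Scope classical_set_scope.
Local Open Scope ring_scope.

Notation cpoly R l := {mpoly R[i][l]}.

Definition is_min (d : Order.disp_t) (T : porderType d) (A : set T) (x : T) :=
  A x /\ lbound A x.

Definition is_max (d : Order.disp_t) (T : porderType d) (A : set T) (x : T) :=
  A x /\ ubound A x.

(* Multidegree (deg_{x_1} p, ..., deg_{x_l} p); it is 0 by convention at      *)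
(* p = 0.                                                                     *)
Definition multideg (R : realType) (l : nat) (p : cpoly R l) : 'X_{1..l} :=
  [multinom (\max_(a <- msupp p) a i)%N | i < l].

(* PP n is P^n, and PPexact n is the set of polynomials of degree exactly n.  *)
Definition PP (R : realType) (l : nat) (n : 'X_{1..l}) : set (cpoly R l) :=
  [set p | (multideg p <= n)%MM].

Definition PPexact (R : realType) (l : nat) (n : 'X_{1..l}) :
    set (cpoly R l) :=
  [set p | p != 0 /\ multideg p = n].

(* <n> = dim P^n *)
Definition dimPP (l : nat) (n : 'X_{1..l}) : nat := (\prod_(i < l) (n i).+1)%N.

(* dimPP n is the number of monomials x^a with a <= n, which form the         *)
(* monomial basis of P^n.                                                     *)
Lemma dimPP_card (l : nat) (n : 'X_{1..l}) :
  dimPP n = #|[set a : 'X_{1..l < (mdeg n).+1} | (bmnm a <= n)%MM]%SET|.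
Proof.
pose N := mdeg n.
have le_n (i : 'I_l) : (n i <= N)%N by rewrite /N mdegE (bigD1 i) //= leq_addr.
pose F (i : 'I_l) : pred 'I_N.+1 := [pred x : 'I_N.+1 | (x <= n i)%N].
pose h (a : 'X_{1..l < N.+1}) : {ffun 'I_l -> 'I_N.+1} :=
  [ffun i => inord (bmnm a i)].
have le_aN (a : 'X_{1..l < N.+1}) (i : 'I_l) : (bmnm a i < N.+1)%N.
  apply: leq_ltn_trans (bmdeg a).
  by rewrite [mdeg _]mdegE (bigD1 i) //= leq_addr.
have h_inj : injective h.
  move=> a b /ffunP eq_ab; apply/val_inj/mnmP => i.
  have /(congr1 val) := eq_ab i.
  by rewrite !ffunE /= !inordK.
rewrite -(card_imset _ h_inj).
have -> : #|[set h x | x in [set a : 'X_{1..l < N.+1}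
              | (bmnm a <= n)%MM]%SET]%SET| = #|family F|.
  apply: eq_card => x; apply/imsetP/familyP => [[a]|xF].
    rewrite finset.inE => /mnm_lepP an -> i.
    by rewrite ffunE unfold_in /= inordK.
  have xn : ([multinom (x i : nat) | i < l] <= n)%MM.
    by apply/mnm_lepP => i; rewrite mnmE; exact: xF.
  have xN : (mdeg [multinom (x i : nat) | i < l] < N.+1)%N.
    rewrite ltnS mdegE [leqRHS](mdegE n); apply: leq_sum => i _.
    exact: (mnm_lepP xn).
  exists (BMultinom xN); first by rewrite finset.inE.
  by apply/ffunP => i; rewrite ffunE /= mnmE inord_val.
rewrite card_family foldrE big_map big_enum /=; apply: eq_bigr => i _.
rewrite -[LHS]card_ord -!sum1_card (big_ord_widen N.+1 (fun=> 1%N)) ?ltnS //.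
Qed.

Definition pnorm (R : realType) (l : nat) (p : cpoly R l) : R :=
  Num.sqrt (\sum_(a <- msupp p) (complex.Re p@_a ^+ 2 + complex.Im p@_a ^+ 2)).

(* [[q]] . [[p]] = [[q]]^H [[p]] *)
Definition pdot (R : realType) (l : nat) (q p : cpoly R l) : R[i] :=
  \sum_(a <- msupp q) (conjc q@_a) * p@_a.

(* sine of the angle between the complex lines through p and q *)
Definition psin (R : realType) (l : nat) (p q : cpoly R l) : R :=
  pnorm (((pnorm p)^-1)%:C%C *: p
         - (pdot q p / (pnorm q * pnorm p)%:C%C)
             *: (((pnorm q)^-1)%:C%C *: q)).

Definition pdist (R : realType) (l : nat) (f : cpoly R l)
    (S : set (cpoly R l)) : R :=
  inf [set pnorm (f - g) | g in S].

Definition pclosure (R : realType) (l : nat) (S : set (cpoly R l)) :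
    set (cpoly R l) :=
  [set f | forall e : R, 0 < e -> exists g, S g /\ pnorm (f - g) < e].

(* Omega is a neighborhood of f in the normed space P^n. *)
Definition nbhd_in (R : realType) (l : nat) (n : 'X_{1..l}) (f : cpoly R l)
    (Omega : set (cpoly R l)) : Prop :=
  Omega `<=` PP n /\
  exists r : R, 0 < r /\ forall g, PP n g -> pnorm (g - f) < r -> Omega g.

Definition mirreducible (R : realType) (l : nat) (p : cpoly R l) : Prop :=
  [/\ p != 0, p \isn't a GRing.unit
    & forall q r : cpoly R l, p = q * r ->
        q \is a GRing.unit \/ r \is a GRing.unit].

Definition mcoprime (R : realType) (l : nat) (p q : cpoly R l) : Prop :=
  forall d p' q' : cpoly R l, p = d * p' -> q = d * q' -> d \is a GRing.unit.

(* The formal product m_1^{k_1} ... m_r^{k_r} is encoded as the sequence of   *)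
(* the pairs (m_j, k_j); everything below is invariant under reordering.      *)
Definition fstructure (l : nat) := seq ('X_{1..l} * nat).

Definition fs_base (l : nat) (M : fstructure l) (j : 'I_(size M)) : 'X_{1..l} :=
  (tnth (in_tuple M) j).1.

Definition fs_exp (l : nat) (M : fstructure l) (j : 'I_(size M)) : nat :=
  (tnth (in_tuple M) j).2.

Definition fs_deg (l : nat) (M : fstructure l) : 'X_{1..l} :=
  (\sum_(mk <- M) mk.1 *+ mk.2)%MM.

Definition fs_factors (R : realType) (l : nat) (M : fstructure l)
    (g : 'I_(size M) -> cpoly R l) : Prop :=
  (forall j, PPexact (fs_base j) (g j) /\ mirreducible (g j)) /\
  (forall i j, i != j -> mcoprime (g i) (g j)).

Definition fs_prod (R : realType) (l : nat) (M : fstructure l) (alpha : R[i])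
    (g : 'I_(size M) -> cpoly R l) : cpoly R l :=
  alpha *: \prod_j g j ^+ fs_exp j.

Definition has_structure (R : realType) (l : nat) (f : cpoly R l)
    (M : fstructure l) : Prop :=
  (forall j : 'I_(size M), (0 < fs_exp j)%N) /\
  exists (alpha : R[i]) (g : 'I_(size M) -> cpoly R l),
    [/\ alpha != 0, fs_factors g & f = fs_prod alpha g].

(* By unique factorization the structure of a polynomial is unique up to      *)
(* reordering, so sharing one structure means having the same one.            *)
Definition same_structure (R : realType) (l : nat) (f g : cpoly R l) : Prop :=
  exists M : fstructure l, has_structure f M /\ has_structure g M.

Definition is_structure (R : realType) (l : nat) (M : fstructure l) : Prop :=
  exists f : cpoly R l, has_structure f M.

Definition FM (R : realType) (l : nat) (M : fstructure l) : set (cpoly R l) :=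
  [set f | PPexact (fs_deg M) f /\
     exists (alpha : R[i]) (g : 'I_(size M) -> cpoly R l),
       fs_factors g /\ f = fs_prod alpha g].

(* Codimension of F^M in P^{deg M}, as given by the dimension                 *)
(* <m_1> + ... + <m_r> + 1 - r of the complex analytic manifold F^M.          *)
Definition codim (l : nat) (M : fstructure l) : int :=
  (dimPP (fs_deg M))%:Z
  - (\sum_(mk <- M) (dimPP mk.1)%:Z + 1 - (size M)%:Z).

(* A minimum: there are finitely many structures of a given degree up to      *)
(* reordering. The infimum of the empty set is +oo.                           *)
Definition critical_gap (R : realType) (l : nat) (f : cpoly R l) : \bar R :=
  ereal_inf [set (pdist f (FM M))%:E | M in
    [set M : fstructure l | [/\ is_structure R M, fs_deg M = multideg f
                             & ~ pclosure (FM M) f]]].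

Record factorization (R : realType) (l : nat) := Factorization {
  fcoef : R[i];
  factors : seq (cpoly R l);
  fcoef_neq0 : fcoef != 0;
  factors_nonconstant : all (fun p => 1 < msize p)%N factors }.

Definition fact_prod (R : realType) (l : nat) (phi : factorization R l) :
    cpoly R l :=
  fcoef phi *: \prod_(p <- factors phi) p.

Definition factorization_of (R : realType) (l : nat)
    (phi : factorization R l) (f : cpoly R l) : Prop :=
  exists2 c : R[i], c != 0 & fact_prod phi = c *: f.

Definition irreducible_factorization (R : realType) (l : nat)
    (phi : factorization R l) : Prop :=
  forall p, p \in factors phi -> mirreducible p.

Definition fequiv (R : realType) (l : nat) (phi psi : factorization R l) :
    Prop :=
  size (factors phi) = size (factors psi) /\
  exists s : 'S_(size (factors phi)), forall j : 'I_(size (factors phi)),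
    exists2 c : R[i], c != 0 & (factors phi)`_j = c *: (factors psi)`_(s j).

Definition match_dist (R : realType) (l : nat) (phi psi : factorization R l)
    (s : 'S_(size (factors phi))) : R :=
  \big[Num.max/0]_(j < size (factors phi))
    psin (factors phi)`_j (factors psi)`_(s j).

Arguments match_dist {R l} phi psi s.

(* The minimum over all permutations is folded from its value at the          *)
(* identity permutation.                                                      *)
Definition fdist (R : realType) (l : nat) (phi psi : factorization R l) : R :=
  if size (factors phi) == size (factors psi) then
    \big[Num.min/match_dist phi psi 1%g]_(s : 'S_(size (factors phi)))
      match_dist phi psi s
  else 1.

Definition residuals (R : realType) (l : nat) (f : cpoly R l)
    (phi : factorization R l) : set R :=
  [set pnorm (f - gamma *: \prod_(p <- factors phi) p)
     | gamma in @setT R[i]].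

Definition eps_structures (R : realType) (l : nat) (f : cpoly R l) (eps : R) :
    set (fstructure l) :=
  [set N | [/\ is_structure R N, fs_deg N = multideg f
             & pdist f (FM N) < eps]].

Definition numfact (R : realType) (l : nat) (f : cpoly R l) (eps : R)
    (phi : factorization R l) : Prop :=
  f != 0 /\ exists M : fstructure l,
    [/\ eps_structures f eps M,
        is_max [set codim N | N in eps_structures f eps] (codim M),
        FM M (fact_prod phi) /\ irreducible_factorization phi,
        is_min (residuals f phi) (pdist f (FM M))
      & is_min [set pnorm (f - g) | g in FM M] (pdist f (FM M))].

(* "The numerical factorization of f within eps uniquely exists"; uniqueness  *)
(* is up to equivalence of factorizations.                                    *)
Definition numfact_unique (R : realType) (l : nat) (f : cpoly R l) (eps : R) :
    Prop :=
  exists2 phi, numfact f eps phi &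
    forall psi, numfact f eps psi -> fequiv psi phi.

(* Local Lipschitz continuity on Omega of the map from f to its numerical     *)
(* factorization within any eps in E f, for the pseudometric fdist.           *)
Definition numfact_lipschitz (R : realType) (l : nat)
    (Omega : set (cpoly R l)) (E : cpoly R l -> set R) : Prop :=
  forall f, Omega f -> exists r L : R, 0 < r /\
    forall (g h : cpoly R l) (eps eps' : R) (phi psi : factorization R l),
      Omega g -> Omega h -> pnorm (g - f) < r -> pnorm (h - f) < r ->
      E g eps -> E h eps' -> numfact g eps phi -> numfact h eps' psi ->
      fdist phi psi <= L * pnorm (g - h).

(* Main.v *)
Require Import Defs.
From HB Require Import structures.
From mathcomp Require Import filter topology normedtype sequences realfun.
From mathcomp Require Import ring lra zify ssrcomplements.

(** Why the theorem holds. Write f0 = al * q_1^k_1 ... q_r^k_r with structure M.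

    Which structures matter below the gap. If the manifold of a structure N of
    degree m has f0 in its closure, then normalized factors converge along an
    ultrafilter, and f0 is a product of polynomials G_j with the degrees and
    exponents of N ([FM_limit]). By unique factorization every q_i divides some
    G_j. A factor of degree n carries prod_i (n_i + 1) - 1 parameters up to
    scale, and this weight is superadditive, strictly so when the sum of the
    two degrees is the degree of an irreducible polynomial: such a degree
    involves at least two variables, or is one. Hence N has at least as many
    parameters as M, with equality only if the G_j are the q_i up to order and
    scale ([compare_weights], [closure_codim]). So below the gap the
    codimension is maximal exactly at M, which is (i); the gap is positive
    because there are finitely many structures of degree m.

    The manifold near f0. The same comparison, applied to N = M, shows that the
    polynomials with structure M close to f0 have factors close to the q_i once
    their scales are pinned ([chart_local]); conversely, irreducibility and
    coprimality are open conditions ([chart_open]). So near f0 the manifold is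
    the image of a ball in an affine space of factors under the product map, the
    derivative of which at the q_i is injective since q_i divides no product of
    the other factors ([chart_d1_inj]).

    Nearest points. Minimizing sequences stay in a compact part of the chart, so
    a nearest point exists ([nearest_exists]). If u and v are nearest to f and
    g, the first order conditions along the segment joining them, the
    injectivity of the derivative and the smallness of the residuals give
    |u - v| <= L |f - g| ([nearest_stability]). With f = g this is uniqueness,
    in general it is Lipschitz continuity, and with g = f0 it is the error bound
    (iv). The residual bound (iii) only uses that f0 lies on the manifold.

    Unique factorization in several variables is obtained by induction on the
    number of variables from Gauss's lemma ([irreducible_prime]), and
    compactness is used through limits along an ultrafilter on the naturals,
    which exist for bounded sequences and commute with products. *)

Set Implicit Arguments.
Unset Strict Implicit.
Unset Printing Implicit Defensive.

Import Order.TTheory GRing.Theory Num.Theory.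
Import numFieldNormedType.Exports.

Local Open Scope classical_set_scope.
Local Open Scope ring_scope.

(** * Unique factorization in several variables *)

Section Divisibility.
Variable D : idomainType.
Implicit Types p q a b c : D.

Definition divides a b := exists c, b = a * c.

Definition irreducible p :=
  [/\ p != 0, p \isn't a GRing.unit
    & forall q r, p = q * r -> q \is a GRing.unit \/ r \is a GRing.unit].

Definition prime_elt p :=
  forall a b, divides p (a * b) -> divides p a \/ divides p b.

Definition atomic_elt c :=
  exists (u : D) (s : seq D), [/\ u \is a GRing.unit,
    (forall p, p \in s -> irreducible p) & c = u * \prod_(p <- s) p].

Lemma divides_mulr a b c : divides a b -> divides a (b * c).
Proof. by case=> d ->; exists (d * c); rewrite mulrA. Qed.

Lemma divides_mull a b c : divides a b -> divides a (c * b).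
Proof. by move=> ab; rewrite mulrC; exact: divides_mulr. Qed.

Lemma dividesD a b c : divides a b -> divides a c -> divides a (b + c).
Proof. by case=> d -> [e ->]; exists (d + e); rewrite mulrDr. Qed.

Lemma dividesB a b c : divides a b -> divides a c -> divides a (b - c).
Proof. by case=> d -> [e ->]; exists (d - e); rewrite mulrBr. Qed.

Lemma divides0 a : divides a 0.
Proof. by exists 0; rewrite mulr0. Qed.

Lemma divides_sum (I : eqType) (s : seq I) (F : I -> D) a :
  (forall i, i \in s -> divides a (F i)) -> divides a (\sum_(i <- s) F i).
Proof.
elim: s => [|i s IH] aF; first by rewrite big_nil; exact: divides0.
rewrite big_cons; apply: dividesD; first by apply: aF; rewrite mem_head.
by apply: IH => j js; apply: aF; rewrite in_cons js orbT.
Qed.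

End Divisibility.

Section PolyUFD.
Variable D : idomainType.
Implicit Types (f g p q h : {poly D}) (c : D).

Lemma divides_polyC c f :
  divides c%:P f <-> forall i, divides c f`_i.
Proof.
split=> [[g ->] i|cf]; first by exists g`_i; rewrite coefCM.
have [q qE] := choice cf.
exists (\poly_(i < size f) q i); apply/polyP => i.
rewrite coefCM coef_poly; case: ltnP => [_|fi]; first exact: qE.
by rewrite mulr0 nth_default.
Qed.

(** Gauss's lemma in its elementary form: at the least indices where the
    coefficients of the two factors escape c, the product escapes it too. *)
Lemma prime_polyC c : prime_elt c -> prime_elt c%:P.
Proof.
move=> cP f g; rewrite !divides_polyC => cfg; apply: contrapT => /not_orP[].
move=> /existsNP[i0 ci0] /existsNP[j0 cj0].
have [i /asboolP ci imin] := ex_minnP (ex_intro (fun i => `[< ~ divides c f`_i >]) i0 (asboolT ci0)).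
have [j /asboolP cj jmin] := ex_minnP (ex_intro (fun i => `[< ~ divides c g`_i >]) j0 (asboolT cj0)).
have ltf k : (k < i)%N -> divides c f`_k.
  move=> ki; apply: contrapT => ck; have := imin k (asboolT ck).
  by rewrite leqNgt ki.
have ltg k : (k < j)%N -> divides c g`_k.
  move=> kj; apply: contrapT => ck; have := jmin k (asboolT ck).
  by rewrite leqNgt kj.
have := cfg (i + j)%N; rewrite coefM.
have i_lt : (i < (i + j).+1)%N by rewrite ltnS leq_addr.
rewrite (bigD1 (Ordinal i_lt)) //= addKn => cij.
have : divides c (f`_i * g`_j).
  rewrite -[X in divides c X](addrK (\sum_(k < (i + j).+1 | k != Ordinal i_lt) f`_k * g`_(i + j - k))).
  apply: dividesB => //; rewrite big_mkcond /=; apply: divides_sum => k _.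
  case: ifP => [ki|_]; last exact: divides0.
  have [lt_ki|lt_ik|ki'] := ltngtP (k : nat) i.
  - exact/divides_mulr/ltf.
  - by apply/divides_mull/ltg; have := ltn_ord k; lia.
  - by case/eqP: ki; exact: val_inj.
by case/cP.
Qed.

Hypothesis D_atomic : forall c, c != 0 -> atomic_elt c.
Hypothesis D_prime : forall c, irreducible c -> prime_elt c.

Lemma polyC_unit_irr c : irreducible c -> c%:P \isn't a GRing.unit.
Proof. by case=> _ cU _; rewrite poly_unitE coefC /= (negPf cU) andbF. Qed.

(** A prime factor of the constant c divides p or q, but not p, which is
    irreducible of positive degree; so all of c cancels from q. *)
Lemma irreducible_cancel_content c p q g :
  irreducible p -> (1 < size p)%N -> c != 0 -> c *: g = p * q -> divides p g.
Proof.
move=> [p0 pU pirr] p1 /D_atomic[u [s [uU sirr ->]]].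
elim: s q sirr => [|x s IH] q sirr.
  rewrite big_nil mulr1 => E; exists (u^-1 *: q).
  by rewrite -scalerAr -E scalerA mulVr ?scale1r.
rewrite big_cons mulrCA -scalerA => E.
have xirr : irreducible x by apply: sirr; rewrite mem_head.
have : divides x%:P (p * q) by rewrite -E -mul_polyC; eexists.
case/(prime_polyC (D_prime xirr)) => [[p' pE]|[q' qE]].
  case: (pirr _ _ pE) => U; first by move: (polyC_unit_irr xirr); rewrite U.
  move: p1; rewrite pE mul_polyC size_scale; last by case: xirr.
  by move: U; rewrite poly_unitE => /andP[/eqP->].
apply: (IH q').
  by move=> y ys; apply: sirr; rewrite in_cons ys orbT.
have x0 : x%:P != 0 by rewrite polyC_eq0; case: xirr.
by apply: (mulfI x0); rewrite mul_polyC E qE mulrCA.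
Qed.

(** Each prime factor of the constant divides one of the two polynomials, from
    which it can be removed without changing the size. *)
Lemma scaled_factorization c p q h : c != 0 -> c *: p = q * h ->
  exists q' h', [/\ p = q' * h', size q' = size q & size h' = size h].
Proof.
move=> /D_atomic[u [s [uU sirr ->]]].
elim: s q h sirr => [|x s IH] q h sirr.
  rewrite big_nil mulr1 => E; exists (u^-1 *: q), h; split=> //.
    by rewrite -scalerAl -E scalerA mulVr ?scale1r.
  by rewrite size_scale // invr_eq0; apply: contraTneq uU => ->; rewrite unitr0.
rewrite big_cons mulrCA -scalerA => E.
have xirr : irreducible x by apply: sirr; rewrite mem_head.
have x0 : x != 0 by case: xirr.
have x0P : x%:P != 0 by rewrite polyC_eq0.
have sirr' y : y \in s -> irreducible y.
  by move=> ys; apply: sirr; rewrite in_cons ys orbT.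
have : divides x%:P (q * h) by rewrite -E -mul_polyC; eexists.
case/(prime_polyC (D_prime xirr)) => [[q' qE]|[h' hE]].
  have [|q1 [h1 [-> sq <-]]] := IH q' h sirr'.
    by apply: (mulfI x0P); rewrite mul_polyC E qE mulrA.
  by exists q1, h1; split=> //; rewrite sq qE mul_polyC size_scale.
have [|q1 [h1 [-> <- sh]]] := IH q h' sirr'.
  by apply: (mulfI x0P); rewrite mul_polyC E hE mulrCA.
by exists q1, h1; split=> //; rewrite sh hE mul_polyC size_scale.
Qed.

Import Pdiv.Idomain.

(** Pseudo-division decides divisibility over the field of fractions. There an
    irreducible p of positive degree stays irreducible, by
    [scaled_factorization], so p divides f or is coprime to it; the constants
    are then cleared by [irreducible_cancel_content]. *)
Lemma irreducible_prime_poly p : irreducible p -> prime_elt p.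
Proof.
move=> pI; have [p0 pU pirr] := pI.
have [p1|p1] := leqP (size p) 1.
  rewrite (size1_polyC p1) in pI *; set c := p`_0 in pI *.
  apply/prime_polyC/D_prime; case: pI => c0 cU cirr; split.
  - by rewrite -polyC_eq0.
  - by apply: contra cU => U; rewrite poly_unitE size_polyC coefC U -polyC_eq0 c0.
  move=> q r cE; have [|U|U] := cirr q%:P r%:P; first by rewrite cE polyCM.
    by left; move: U; rewrite poly_unitE coefC => /andP[].
  by right; move: U; rewrite poly_unitE coefC => /andP[].
have dvd_div g : p %| g -> divides p g.
  case/dvdpP => -[c q] /= c0 E; apply: (irreducible_cancel_content pI p1 c0).
  by rewrite mulrC; exact: E.
have irrp g : size g != 1%N -> g %| p -> g %= p.
  move=> g1 gp; have g0 : g != 0 by apply: contraTneq gp => ->; rewrite dvd0p.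
  rewrite -dvdp_size_eqp //.
  case/dvdpP: gp => -[c q] /= c0 E.
  have [q' [g' [pE sq sg]]] := scaled_factorization c0 E.
  case: (pirr _ _ pE) => U; last first.
    by case/negP: g1; rewrite -sg; move: U; rewrite poly_unitE => /andP[].
  have s1 : size q' = 1%N by move: U; rewrite poly_unitE => /andP[/eqP].
  rewrite (size1_polyC (eq_leq s1)) mul_polyC in pE.
  rewrite pE size_scale ?sg //; apply: contraNneq p0 => q0.
  by rewrite pE q0 scale0r.
move=> f g [q E].
have [pf|npf] := boolP (p %| f); first by left; exact: dvd_div.
right; apply: dvd_div; rewrite -(@Gauss_dvdpr _ g f p).
  by apply/dvdpP; exists (1, q); rewrite ?oner_neq0 //= scale1r E mulrC.
rewrite coprimep_def; apply: contraNT npf => /irrp/(_ (dvdp_gcdl p f))/eqp_dvdl <-.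
by rewrite dvdp_gcdr.
Qed.

End PolyUFD.

Section TransportPrime.
Variables (D D' : idomainType) (phi : {rmorphism D -> D'}) (psi : {rmorphism D' -> D}).
Hypotheses (phiK : cancel phi psi) (psiK : cancel psi phi).

Lemma transport_unit p : (phi p \is a GRing.unit) = (p \is a GRing.unit).
Proof.
by apply/idP/idP => [/(rmorph_unit psi)|/(rmorph_unit phi)//]; rewrite phiK.
Qed.

Lemma transport_irreducible p : irreducible p -> irreducible (phi p).
Proof.
case=> p0 pU pirr; split; rewrite ?transport_unit //.
  by rewrite -(inj_eq (can_inj psiK)) phiK rmorph0 in p0 *.
move=> q r E; have [] := pirr (psi q) (psi r).
- by rewrite -rmorphM -E phiK.
- by rewrite -transport_unit psiK; left.
- by rewrite -transport_unit psiK; right.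
Qed.

Lemma transport_prime p : prime_elt (phi p) -> prime_elt p.
Proof.
move=> pP a b [c E].
have [|[d F]|[d F]] := pP (phi a) (phi b).
- by exists (phi c); rewrite -!rmorphM E.
- by left; exists (psi d); rewrite -[a]phiK F rmorphM phiK.
- by right; exists (psi d); rewrite -[b]phiK F rmorphM phiK.
Qed.

End TransportPrime.

Section MpolyUFD.
Variable F : fieldType.

Lemma mpoly_unitE l (p : {mpoly F[l]}) :
  (p \is a GRing.unit) = (msize p == 1%N).
Proof.
apply/idP/idP => [/andP[/eqP pE]|/msize_poly1P[c c0 ->]].
  move=> U; have {U} : p@_0 \is a GRing.unit := U.
  by rewrite unitfE => p0; rewrite pE msizeC p0.
apply/unitrP; exists (c^-1)%:MP.
by rewrite -!mpolyCM mulVf ?mulfV ?mpolyC1.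
Qed.

Lemma mpoly_atomic l (p : {mpoly F[l]}) : p != 0 -> atomic_elt p.
Proof.
move: {2}(msize p) (leqnn (msize p)) => n; elim: n p => [|n IH] p.
  by rewrite leqn0 msize_poly_eq0 => ->.
move=> pn p0; have [pU|pU] := boolP (p \is a GRing.unit).
  by exists p, [::]; split=> //; rewrite big_nil mulr1.
have [pirr|] := pselect (irreducible p).
  exists 1, [:: p]; split; rewrite ?unitr1 //; last by rewrite big_seq1 mul1r.
  by move=> q; rewrite inE => /eqP->.
move=> npirr; have [q [r [pE qU rU]]] : exists q r : {mpoly F[l]}, [/\ p = q * r,
    q \isn't a GRing.unit & r \isn't a GRing.unit].
  apply: contrapT => H; apply: npirr; split=> // q r pE.
  have [|qU] := boolP (q \is a GRing.unit); first by left.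
  have [|rU] := boolP (r \is a GRing.unit); first by right.
  by case: H; exists q, r.
have q0 : q != 0 by apply: contraNneq p0 => q0; rewrite pE q0 mul0r.
have r0 : r != 0 by apply: contraNneq p0 => r0; rewrite pE r0 mulr0.
move: pn; rewrite pE msizeM // => pn.
rewrite mpoly_unitE in qU; rewrite mpoly_unitE in rU.
have [qn rn] : (msize q <= n)%N /\ (msize r <= n)%N.
  have := r0; have := q0; rewrite -!msize_poly_eq0.
  move: (msize q) (msize r) qU rU pn => a b /eqP qU /eqP rU pn /eqP a0 /eqP b0.
  by split; lia.
have [u [s [uU sirr qE]]] := IH q qn q0.
have [v [t [vU tirr rE]]] := IH r rn r0.
exists (u * v), (s ++ t); split; first by rewrite unitrM uU.
- by move=> x; rewrite mem_cat => /orP[/sirr|/tirr].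
- by rewrite big_cat qE rE mulrACA.
Qed.

Definition unmuni l (q : {poly {mpoly F[l]}}) : {mpoly F[l.+1]} :=
  horner_eval 'X_ord_max (map_poly (@mwiden l F) q).

HB.instance Definition _ l := GRing.RMorphism.copy (@unmuni l)
  (horner_eval ('X_ord_max : {mpoly F[l.+1]}) \o map_poly (@mwiden l F)).

Lemma muniK l : cancel (@muni l F) (@unmuni l).
Proof.
move=> p; rewrite muniE rmorph_sum /= [RHS]mpolyE.
apply: eq_bigr => m _.
rewrite /unmuni -mul_polyC rmorphM /= map_polyC map_polyXn.
rewrite /horner_eval hornerM hornerC hornerXn /= mwidenZ -scalerAl mwidenX.
rewrite mpolyXn -mpolyXD; congr (_ *: 'X_[_]); apply/mnmP => i.
rewrite mnmDE mulmnE mnmE.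
rewrite [ord_max == i]eq_sym; have [->|i_max] := eqVneq i ord_max.
  by rewrite mnmwiden_ordmax mul1n.
have il : (i < l)%N.
  by have := ltn_ord i; rewrite ltnS leq_eqVlt => /orP[/eqP il|//]; case/eqP: i_max; exact: val_inj.
have -> : i = widen_ord (leqnSn l) (Ordinal il) by exact: val_inj.
by rewrite mnmwiden_widen mnmE addn0.
Qed.

Lemma muni_mwiden l (c : {mpoly F[l]}) : muni (mwiden c) = c%:P.
Proof.
rewrite [X in mwiden X](mpolyE c) [in RHS](mpolyE c).
rewrite (big_morph _ (@mwidenD l F) (@mwiden0 l F)).
rewrite (big_morph _ (@muniD l F) (@muni0 l F)) (big_morph _ (@polyCD _) (@polyC0 _)).
apply: eq_bigr => m _; rewrite mwidenZ mwidenX muniZ muniE msuppX big_seq1.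
rewrite mcoeffX eqxx scale1r mnmwiden_ordmax expr0.
rewrite -[in RHS]mul_mpolyC rmorphM -!mul_polyC mulr1; congr (_ * _).
by congr ('X_[_])%:P; apply/mnmP => i; rewrite mnmE mnmwiden_widen.
Qed.

Lemma unmuniK l : cancel (@unmuni l) (@muni l F).
Proof.
elim/poly_ind => [|q c IH]; first by rewrite !rmorph0.
rewrite !rmorphD !rmorphM /= IH; congr (_ * _ + _).
  rewrite /unmuni map_polyX /horner_eval hornerX muniE msuppX big_seq1.
  rewrite mcoeffX eqxx scale1r mnmE eqxx expr1 -[RHS]scale1r; congr (_ *: _).
  rewrite -[RHS]mpolyX0; congr 'X_[_]; apply/mnmP => i; rewrite !mnmE.
  by apply/eqP; rewrite eqb0 neq_ltn /= ltn_ord orbT.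
by rewrite /unmuni map_polyC /horner_eval hornerC muni_mwiden.
Qed.

(** Polynomial rings over a field are factorial, by induction on the number
    of variables. *)
Theorem irreducible_prime l (p : {mpoly F[l]}) : irreducible p -> prime_elt p.
Proof.
elim: l p => [|l IH] p pI.
  case: (pI) => p0 /negP[]; rewrite mpoly_unitE.
  rewrite eqn_leq lt0n msize_poly_eq0 p0 andbT.
  by rewrite msizeE; apply/bigmax_leqP_seq => m _ _; rewrite mdegE big_ord0.
apply: (transport_prime (@muniK l)); apply: irreducible_prime_poly => //.
  exact: mpoly_atomic.
exact: (transport_irreducible (@muniK l) (@unmuniK l)).
Qed.

End MpolyUFD.

(** * Factorizations up to order and scale *)

Section UniqueFactorization.
Variables (F : fieldType) (l : nat).
Local Notation P := {mpoly F[l]}.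
Implicit Types (p q r : P) (s t : seq P).

Definition assoc p q := exists2 c : F, c != 0 & p = c *: q.

Lemma assoc_refl p : assoc p p.
Proof. by exists 1; rewrite ?oner_neq0 ?scale1r. Qed.

Lemma assoc_sym p q : assoc p q -> assoc q p.
Proof.
by case=> c c0 ->; exists c^-1; rewrite ?invr_eq0 // scalerA mulVf ?scale1r.
Qed.

Lemma assoc_trans q p r : assoc p q -> assoc q r -> assoc p r.
Proof.
by move=> [c c0 ->] [d d0 ->]; exists (c * d); rewrite ?mulf_neq0 ?scalerA.
Qed.

Lemma mpoly_unitP p : p \is a GRing.unit -> exists2 c : F, c != 0 & p = c%:MP.
Proof. by rewrite mpoly_unitE => /msize_poly1P. Qed.

Lemma mpolyC_unit (c : F) : c != 0 -> (c%:MP : P) \is a GRing.unit.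
Proof. by move=> c0; rewrite mpoly_unitE msizeC c0. Qed.

Lemma unit_divides u p : u \is a GRing.unit -> divides p u -> p \is a GRing.unit.
Proof. by move=> uU [c uE]; move: uU; rewrite uE unitrM => /andP[]. Qed.

Lemma divides_scale p (c : F) q : c != 0 -> divides p (c *: q) -> divides p q.
Proof.
move=> c0 [r E]; exists (c^-1 *: r).
by rewrite -scalerAr -E scalerA mulVf ?scale1r.
Qed.

Lemma assoc_divides p q : assoc p q -> divides p q.
Proof.
by case=> c c0 ->; exists (c^-1)%:MP; rewrite mulrC mul_mpolyC scalerA mulVf ?scale1r.
Qed.

Lemma irreducible_divides_assoc p q :
  irreducible p -> irreducible q -> divides p q -> assoc p q.
Proof.
move=> [_ pU _] [_ _ qirr] [r qE].
case: (qirr _ _ qE) => [U|/mpoly_unitP[c c0 rE]]; first by rewrite U in pU.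
by apply: assoc_sym; exists c => //; rewrite qE rE mulrC mul_mpolyC.
Qed.

Lemma prime_divides_prod p (I : eqType) (r : seq I) (G : I -> P) :
  prime_elt p -> p \isn't a GRing.unit -> divides p (\prod_(i <- r) G i) ->
  exists2 i, i \in r & divides p (G i).
Proof.
move=> pP pU; elim: r => [|i r IH].
  by rewrite big_nil => /(unit_divides (unitr1 _)) U; rewrite U in pU.
rewrite big_cons => /pP[pi|/IH[j jr pj]]; first by exists i; rewrite ?mem_head.
by exists j; rewrite ?in_cons ?jr ?orbT.
Qed.

Lemma prime_divides_exp p q k :
  prime_elt p -> p \isn't a GRing.unit -> divides p (q ^+ k) -> divides p q.
Proof.
move=> pP pU; elim: k => [|k IH].
  by rewrite expr0 => /(unit_divides (unitr1 _)) U; rewrite U in pU.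
by rewrite exprS => /pP[|/IH].
Qed.

(** The common length is a parameter, so that matchings compose without casts
    between symmetric groups. *)
Definition lmatch (n : nat) (Q : P -> P -> Prop) s t :=
  [/\ size s = n, size t = n & exists sg : 'S_n, forall i : 'I_n, Q s`_i t`_(sg i)].

Lemma lmatch_trans n (Q1 Q2 Q3 : P -> P -> Prop) s t u :
  (forall p q r, Q1 p q -> Q2 q r -> Q3 p r) ->
  lmatch n Q1 s t -> lmatch n Q2 t u -> lmatch n Q3 s u.
Proof.
move=> Q123 [sn tn [sg sgQ]] [_ un [ta taQ]]; split=> //.
by exists (sg * ta)%g => i; rewrite permM; apply: Q123 (sgQ i) (taQ _).
Qed.

Lemma lmatch_sym n (Q1 Q2 : P -> P -> Prop) s t :
  (forall p q, Q1 p q -> Q2 q p) -> lmatch n Q1 s t -> lmatch n Q2 t s.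
Proof.
move=> Q12 [sn tn [sg sgQ]]; split=> //.
by exists sg^-1%g => i; apply: Q12; rewrite -{2}(permKV sg i); apply: sgQ.
Qed.

Lemma lmatch_id n (Q : P -> P -> Prop) s t : size s = n -> size t = n ->
  (forall i, (i < n)%N -> Q s`_i t`_i) -> lmatch n Q s t.
Proof. by move=> sn tn Qst; split=> //; exists 1%g => i; rewrite perm1; apply: Qst. Qed.

Lemma lmatch_perm n s t : size s = n -> perm_eq s t -> lmatch n eq s t.
Proof.
move=> sn st; have tn : size t = n by rewrite -(perm_size st).
split=> //; move: st; rewrite -[s]/(val (Tuple (introT eqP sn))).
rewrite -[t]/(val (Tuple (introT eqP tn))) => /tuple_permP[sg sE].
exists sg => i; rewrite {1}sE.
by rewrite -(tnth_nth 0 [tuple tnth _ (sg j)| j < n]) tnth_mktuple (tnth_nth 0).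
Qed.

(** The entries of the first list are prime: one after the other, each divides,
    hence is associate to, a remaining entry of the second list. *)
Theorem unique_factorization s t (c d : F) : c != 0 -> d != 0 ->
  (forall p, p \in s -> irreducible p) -> (forall p, p \in t -> irreducible p) ->
  c *: \prod_(p <- s) p = d *: \prod_(p <- t) p ->
  lmatch (size s) assoc s t.
Proof.
move=> c0 d0 sirr tirr E.
have [t' t't [st' asst']] : exists2 t', perm_eq t' t &
    size t' = size s /\ forall i, (i < size s)%N -> assoc s`_i t'`_i.
  elim: s t c d c0 d0 sirr tirr E => [|x s IH] t c d c0 d0 sirr tirr E.
    exists [::] => //; case: t tirr E => // y t tirr.
    rewrite big_nil big_cons => E.
    have [_ yU _] : irreducible y by apply: tirr; rewrite mem_head.
    have U : (c *: 1 : P) \is a GRing.unit.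
      by rewrite -mul_mpolyC mulr1 mpolyC_unit.
    case/negP: yU; apply: (unit_divides U); rewrite E scalerAl.
    by exists (d *: \prod_(p <- t) p); rewrite -scalerAl -scalerAr.
  have xirr : irreducible x by apply: sirr; rewrite mem_head.
  have [x0 xU _] := xirr.
  have : divides x (\prod_(p <- t) p).
    apply: (divides_scale d0); rewrite -E big_cons.
    by exists (c *: \prod_(p <- s) p); rewrite scalerAr.
  case/(prime_divides_prod (irreducible_prime xirr) xU) => y yt xy.
  have [k k0 yE] := assoc_sym (irreducible_divides_assoc xirr (tirr _ yt) xy).
  have [||||t' t't [st' asst']] := IH (rem y t) c (d * k) c0.
  - by rewrite mulf_neq0.
  - by move=> p ps; apply: sirr; rewrite in_cons ps orbT.
  - by move=> p /mem_rem; apply: tirr.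
  - move: E; rewrite big_cons (perm_big _ (perm_to_rem yt)) /= => E.
    apply: (mulfI x0); rewrite -scalerAr E.
    by rewrite big_cons yE -scalerAl scalerA -scalerAr.
  exists (y :: t'); first by rewrite perm_sym (perm_trans (perm_to_rem yt)) // perm_cons perm_sym.
  split; first by rewrite /= st'.
  case=> [|i] /= is'; last exact: asst'.
  by apply: assoc_sym; exists k.
apply: (@lmatch_trans _ assoc eq _ _ t'); first by move=> ? ? ? + <-.
  exact: lmatch_id.
exact: lmatch_perm.
Qed.

Section Exponents.
Variables (I : finType) (q : I -> P).
Hypothesis q_irr : forall i, irreducible (q i).
Hypothesis q_nassoc : forall i j, i != j -> ~ assoc (q i) (q j).

Lemma divides_irreducible_prod i (e : I -> nat) :
  divides (q i) (\prod_(j | j != i) q j ^+ e j) -> False.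
Proof.
have [_ qU _] := q_irr i; have qP := irreducible_prime (q_irr i).
rewrite -big_filter => /(prime_divides_prod qP qU)[j].
rewrite mem_filter => /andP[ji _] /(prime_divides_exp qP qU).
move=> /(irreducible_divides_assoc (q_irr i) (q_irr j)).
by apply: q_nassoc; rewrite eq_sym.
Qed.

(** Otherwise, after cancellation, q i would divide a product of powers of the
    other q j. *)
Lemma exponents_le (c d : F) (e f : I -> nat) : c != 0 -> d != 0 ->
  c *: \prod_i q i ^+ e i = d *: \prod_i q i ^+ f i -> forall i, (f i <= e i)%N.
Proof.
move=> c0 d0 E i; rewrite leqNgt; apply/negP => ei.
apply: (@divides_irreducible_prod i e).
exists ((d / c) *: (q i ^+ (f i - e i).-1 * \prod_(j | j != i) q j ^+ f j)).
have q0 : q i ^+ e i != 0 by rewrite expf_neq0 //; case: (q_irr i).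
move: E; rewrite (bigD1 i) //= [in RHS](bigD1 i) //= => E.
apply: (mulfI q0); apply: (scalerI c0); rewrite E -!scalerAr scalerA.
rewrite [c * _]mulrC divfK // !mulrA -exprSr -exprD; congr (_ *: (_ ^+ _ * _)).
by move: ei; lia.
Qed.

Lemma exponents_inj (c d : F) (e f : I -> nat) : c != 0 -> d != 0 ->
  c *: \prod_i q i ^+ e i = d *: \prod_i q i ^+ f i -> e =1 f.
Proof.
move=> c0 d0 E i; apply/eqP; rewrite eqn_leq.
by rewrite (exponents_le c0 d0 E) (exponents_le d0 c0 (esym E)).
Qed.

(** The irreducible factors of a divisor are prime, so they are associate to
    some of the q i. *)
Lemma divisor_exponents (G : P) (k : I -> nat) :
  divides G (\prod_i q i ^+ k i) ->
  exists c (e : I -> nat), c != 0 /\ G = c *: \prod_i q i ^+ e i.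
Proof.
move=> [H E].
have G0 : G != 0.
  apply/negP => /eqP G0; move/eqP: E; rewrite G0 mul0r; apply/negP.
  by apply/prodf_neq0 => i _; rewrite expf_neq0 //; case: (q_irr i).
have [u [s [/mpoly_unitP[c c0 ->] sirr GE]]] := mpoly_atomic G0.
have sq p : p \in s -> exists i, assoc p (q i).
  move=> ps; have pI := sirr _ ps; have [_ pU _] := pI.
  have pP := irreducible_prime pI.
  have : divides p (\prod_i q i ^+ k i).
    rewrite E GE (big_rem p ps) /=; apply/divides_mulr/divides_mull.
    exact/divides_mulr/assoc_divides/assoc_refl.
  case/(prime_divides_prod pP pU) => i _ /(prime_divides_exp pP pU) pq.
  by exists i; exact: irreducible_divides_assoc.
have [d [e [d0 dE]]] : exists (d : F) (e : I -> nat),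
    d != 0 /\ \prod_(p <- s) p = d *: \prod_i q i ^+ e i.
  elim: s sq {sirr GE} => [|p s IH] sq.
    by exists 1, (fun=> 0%N); rewrite oner_neq0 big_nil scale1r big1.
  have [x xs|d [e [d0 dE]]] := IH.
    by apply: sq; rewrite in_cons xs orbT.
  have [i [a a0 pE]] := sq p (mem_head _ _).
  exists (a * d), (fun j => (j == i) + e j)%N; split; first exact: mulf_neq0.
  rewrite big_cons dE pE -scalerAl -scalerAr scalerA; congr (_ *: _).
  rewrite (bigD1 i) //= [in RHS](bigD1 i) //= eqxx exprS -mulrA.
  by congr (_ * (_ * _)); apply: eq_bigr => j /negPf->.
exists (c * d), e; split; first exact: mulf_neq0.
by rewrite GE dE mul_mpolyC scalerA.
Qed.

End Exponents.

(** By induction: a new factor raises the exponent of an associate that is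
    already present, or opens a new index. *)
Lemma group_factors s (c : F) : c != 0 -> (forall p, p \in s -> irreducible p) ->
  exists (r : nat) (q : 'I_r -> P) (k : 'I_r -> nat) (a : F),
  [/\ a != 0, forall j, (0 < k j)%N, forall j, irreducible (q j),
      forall i j, i != j -> ~ assoc (q i) (q j)
    & c *: \prod_(p <- s) p = a *: \prod_j q j ^+ k j].
Proof.
move=> c0; elim: s => [|p s IH] sirr.
  exists 0, (fun=> 0), (fun=> 0%N), c; split=> //; try by case.
  by rewrite big_nil big_ord0.
have [x xs|r [q [k [a [a0 k0 qirr qn E]]]]] := IH.
  by apply: sirr; rewrite in_cons xs orbT.
have pI : irreducible p by apply: sirr; rewrite mem_head.
rewrite big_cons scalerAr E.
have [[i [b b0 pE]]|npq] := pselect (exists i, assoc p (q i)).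
  exists r, q, (fun j => (j == i) + k j)%N, (a * b); split=> //.
  - exact: mulf_neq0.
  - by move=> j; rewrite addn_gt0 k0 orbT.
  rewrite pE -scalerAl -scalerAr scalerA mulrC; congr (_ *: _).
  rewrite (bigD1 i) //= [in RHS](bigD1 i) //= eqxx exprS -mulrA.
  by congr (_ * (_ * _)); apply: eq_bigr => j /negPf->.
pose q' (i : 'I_r.+1) := if unlift ord0 i is Some j then q j else p.
pose k' (i : 'I_r.+1) := if unlift ord0 i is Some j then k j else 1%N.
exists r.+1, q', k', a; split=> //.
- by move=> j; rewrite /k'; case: unliftP.
- by move=> j; rewrite /q'; case: unliftP.
- move=> i j; rewrite /q'; case: unliftP => [i' ->|->]; case: unliftP => [j' ->|->] //.
  + by rewrite (inj_eq lift_inj); exact: qn.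
  + by move=> _ /assoc_sym ?; apply: npq; exists i'.
  + by move=> _ ?; apply: npq; exists j'.
rewrite big_ord_recl /q' /k' unlift_none expr1 scalerAr.
by congr (_ * (_ *: _)); apply: eq_bigr => j _; rewrite liftK.
Qed.

End UniqueFactorization.

(** * Multidegrees *)

Section Multidegree.
Variables (R : realType) (l : nat).
Local Notation P := (cpoly R l).
Implicit Types (p q : P) (a b n : 'X_{1..l}).

Lemma PP_msupp n p : PP n p <-> forall a, a \in msupp p -> (a <= n)%MM.
Proof.
split=> [/mnm_lepP pn a ap|pn].
  apply/mnm_lepP => i; apply: leq_trans (pn i).
  by rewrite mnmE; exact: (@leq_bigmax_seq _ (msupp p) xpredT (fun a : 'X_{1..l} => a i) a ap).
apply/mnm_lepP => i; rewrite mnmE; apply/bigmax_leqP_seq => a ap _.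
by move/mnm_lepP: (pn a ap).
Qed.

Lemma PP_coef n p : PP n p <-> forall a, ~~ (a <= n)%MM -> p@_a = 0.
Proof.
rewrite PP_msupp; split=> [pn a an|pn a].
  by apply/eqP; rewrite mcoeff_eq0; apply: contra an => /pn.
by rewrite mcoeff_msupp; apply: contraNT => /pn ->.
Qed.

Lemma PP_multideg p : PP (multideg p) p.
Proof. by rewrite /PP /=; apply/mnm_lepP. Qed.

Lemma multideg_attained p i : p != 0 ->
  exists2 a, a \in msupp p & multideg p i = a i.
Proof.
rewrite -msupp_eq0 mnmE; elim: (msupp p) => // a s IH _; rewrite big_cons.
have [->|/IH[b bs ->]] := eqVneq s [::].
  by exists a; rewrite ?mem_head // big_nil maxn0.
rewrite maxnE; case: (leqP (a i) (b i)) => ab.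
  by exists b; rewrite ?in_cons ?bs ?orbT // subnKC.
by exists a; rewrite ?mem_head // (eqP (ltnW ab)) addn0.
Qed.

(** Tags the i-th variable with a dummy variable T, so that the degree in x_i
    becomes the degree in T of a univariate polynomial. *)
Definition tag_var (i : 'I_l) (p : P) : {poly P} :=
  mmap (polyC \o @mpolyC l R[i]) (fun j => ('X_j)%:P * 'X ^+ (j == i)) p.

HB.instance Definition _ i := GRing.RMorphism.copy (tag_var i)
  (mmap (polyC \o @mpolyC l R[i]) (fun j => ('X_j)%:P * 'X ^+ (j == i))).

Lemma tag_varE i p : tag_var i p =
  \sum_(a <- msupp p) (p@_a *: 'X_[a]) *: 'X^(a i).
Proof.
apply: eq_bigr => a _; rewrite /mmap1 /=.
under eq_bigr do rewrite exprMn -rmorphXn -exprM /=.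
rewrite big_split /= -rmorph_prod /= -mpolyXE_id -mul_polyC mulrA -rmorphM /=.
rewrite mul_mpolyC; congr (_ * _); rewrite (bigD1 i) //= eqxx mul1n big1 ?mulr1 //.
by move=> j /negPf->; rewrite mul0n expr0.
Qed.

Lemma coef_tag_var i p a : ((tag_var i p)`_(a i))@_a = p@_a.
Proof.
rewrite tag_varE coef_sum raddf_sum /=.
have E b : (((p@_b *: 'X_[b] : P) *: 'X^(b i))`_(a i))@_a = p@_b * (b == a)%:R.
  rewrite coefZ coefXn; have [<-|ab] := eqVneq b a.
    by rewrite eqxx mulr1 mcoeffZ mcoeffX eqxx.
  case: eqP => _; last by rewrite mulr0 mcoeff0 mulr0.
  by rewrite mulr1 mcoeffZ mcoeffX (negPf ab).
under eq_bigr do rewrite E.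
have [ap|ap] := boolP (a \in msupp p).
  rewrite (big_rem a ap) /= eqxx mulr1 big_seq big1 ?addr0 // => b.
  by rewrite mem_rem_uniq ?msupp_uniq // inE => /andP[/negPf-> _]; rewrite mulr0.
move: (ap); rewrite -mcoeff_eq0 => /eqP->.
rewrite big_seq big1 // => b bp; case: eqP => [ab|_]; last by rewrite mulr0.
by rewrite ab (negPf ap) in bp.
Qed.

Lemma size_tag_var i p : p != 0 -> size (tag_var i p) = (multideg p i).+1.
Proof.
move=> p0; apply/eqP; rewrite eqn_leq; apply/andP; split.
  rewrite tag_varE; apply/leq_sizeP => k ki.
  rewrite coef_sum big_seq big1 // => a ap; rewrite coefZ coefXn.
  case: eqP => [ka|_]; last by rewrite mulr0.
  have /PP_msupp/(_ a ap)/mnm_lepP/(_ i) := PP_multideg p.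
  by rewrite -ka leqNgt ki.
have [a ap ->] := multideg_attained i p0.
rewrite ltnNge; apply/negP => /leq_sizeP/(_ _ (leqnn _)) E.
by move: ap; rewrite mcoeff_msupp -(coef_tag_var i) E mcoeff0 eqxx.
Qed.

(** Sizes of univariate polynomials over a domain add up; apply this to the
    images under [tag_var]. *)
Lemma multidegM p q : p != 0 -> q != 0 ->
  multideg (p * q) = (multideg p + multideg q)%MM.
Proof.
move=> p0 q0; apply/mnmP => i; rewrite mnmDE.
have sp := size_tag_var i p0; have sq := size_tag_var i q0.
have tp : tag_var i p != 0 by rewrite -size_poly_eq0 sp.
have tq : tag_var i q != 0 by rewrite -size_poly_eq0 sq.
have sM (x y : {poly P}) : x != 0 -> y != 0 -> size (x * y) = (size x + size y).-1.
  by move=> x0 y0; rewrite size_mul.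
have E : tag_var i (p * q) = tag_var i p * tag_var i q := rmorphM (tag_var i) p q.
have := etrans (sM _ _ tp tq) (congr1 predn (f_equal2 addn sp sq)).
move/(etrans (congr1 (fun x : {poly P} => size x) E)).
move/(etrans (esym (size_tag_var i (mulf_neq0 p0 q0)))).
by rewrite addSn addnS => -[].
Qed.

Lemma multidegC (c : R[i]) : multideg (c%:MP : P) = 0%MM.
Proof.
apply/mnmP => i; rewrite mnmE msuppC mnm0E.
by case: ifP => _; rewrite ?big_nil ?big_seq1 ?mnm0E.
Qed.

Lemma multidegZ (c : R[i]) p : c != 0 -> multideg (c *: p) = multideg p.
Proof.
move=> c0; have [->|p0] := eqVneq p 0; first by rewrite scaler0.
by rewrite -mul_mpolyC multidegM ?mpolyC_eq0 // multidegC add0m.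
Qed.

Lemma multideg_prod (I : eqType) (r : seq I) (G : I -> P) :
  (forall i, i \in r -> G i != 0) ->
  multideg (\prod_(i <- r) G i) = (\sum_(i <- r) multideg (G i))%MM.
Proof.
elim: r => [|i r IH] G0; first by rewrite !big_nil -mpolyC1 multidegC.
rewrite !big_cons multidegM ?IH ?G0 ?mem_head //.
- by move=> j jr; apply: G0; rewrite in_cons jr orbT.
- rewrite prodf_seq_neq0; apply/allP => j jr; apply/implyP => _.
  by apply: G0; rewrite in_cons jr orbT.
Qed.

Lemma multidegX p k : p != 0 -> multideg (p ^+ k) = (multideg p *+ k)%MM.
Proof.
move=> p0; elim: k => [|k IH]; first by rewrite expr0 mulm0n -mpolyC1 multidegC.
by rewrite exprS multidegM ?expf_neq0 // IH mulmS.
Qed.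

Lemma multideg_eq0 p : (multideg p == 0%MM) = (msize p <= 1)%N.
Proof.
apply/eqP/idP => [p0|/msize1_polyC ->]; last exact: multidegC.
rewrite msizeE; apply/bigmax_leqP_seq => a ap _.
have /PP_msupp/(_ a ap) := PP_multideg p; rewrite p0 => /mnm_lepP a0.
by rewrite ltnS leqn0 mdeg_eq0; apply/eqP/mnmP => i; move: (a0 i); rewrite !mnm0E leqn0 => /eqP.
Qed.

Lemma irreducible_multideg p : irreducible p -> multideg p != 0%MM.
Proof.
case=> p0 pU _; rewrite multideg_eq0 -ltnNge ltn_neqAle eq_sym lt0n msize_poly_eq0.
by rewrite p0 andbT -mpoly_unitE.
Qed.

Lemma irreducible_msize p : irreducible p -> (1 < msize p)%N.
Proof. by move/irreducible_multideg; rewrite multideg_eq0 -ltnNge. Qed.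

(** A polynomial in a single variable splits into linear factors over the
    complex numbers. *)
Lemma irreducible_univariate p (i : 'I_l) : irreducible p ->
  (forall j, j != i -> multideg p j = 0%N) -> multideg p i = 1%N.
Proof.
move=> pI pi; have [p0 pU pirr] := pI.
pose h : {rmorphism {poly R[i]} -> P} := horner_eval ('X_i : P) \o map_poly (@mpolyC l R[i]).
pose u : {poly R[i]} := \sum_(a <- msupp p) p@_a *: 'X^(a i).
have hX : h 'X = 'X_i by rewrite /h /= map_polyX /horner_eval hornerX.
have hC c : h c%:P = c%:MP by rewrite /h /= map_polyC /horner_eval hornerC.
have hu : h u = p.
  rewrite /u rmorph_sum [RHS]mpolyE; apply: eq_big_seq => a ap.
  rewrite -mul_polyC rmorphM rmorphXn hC hX mul_mpolyC; congr (_ *: _).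
  rewrite mpolyXn; congr 'X_[_]; apply/mnmP => j; rewrite mulmnE mnm1E eq_sym.
  have [->|ji] := eqVneq j i; first by rewrite mul1n.
  rewrite mul0n; apply/esym/eqP; rewrite -leqn0 -(pi j ji).
  by have /PP_msupp/(_ a ap)/mnm_lepP := PP_multideg p.
have u1 : size u != 1%N.
  apply/negP => /size_poly1P[c c0 uE]; move: pU; rewrite -hu uE hC.
  by rewrite mpolyC_unit.
have [z /factor_theorem[v uE]] := closed_rootP u u1.
have : p = h v * ('X_i - z%:MP) by rewrite -hu uE rmorphM rmorphB hX hC.
have X0 : 'X_i - z%:MP != 0 :> P.
  apply/eqP => /mpolyP/(_ U_(i)%MM)/eqP; rewrite mcoeffB mcoeffX eqxx mcoeffC mcoeff0.
  by rewrite mnm1_eq0 mulr0 subr0 oner_eq0.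
have degX : multideg ('X_i - z%:MP : P) i = 1%N.
  apply/eqP; rewrite eqn_leq; apply/andP; split.
    rewrite mnmE; apply/bigmax_leqP_seq => a /msuppB_le.
    rewrite mem_cat msuppX msuppC inE => /orP[/eqP->|]; first by rewrite mnm1E eqxx.
    by case: ifP => // _; rewrite inE => /eqP->; rewrite mnm0E.
  have : U_(i)%MM \in msupp ('X_i - z%:MP : P).
    by rewrite mcoeff_msupp mcoeffB mcoeffX eqxx mcoeffC mnm1_eq0 mulr0 subr0 oner_eq0.
  by have /PP_msupp H := PP_multideg ('X_i - z%:MP : P); move/H/mnm_lepP/(_ i); rewrite mnm1E eqxx.
move=> pE; case: (pirr _ _ pE) => [/mpoly_unitP[c c0 cE]|].
  by rewrite pE cE mul_mpolyC multidegZ.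
rewrite mpoly_unitE => /eqP s1; have := multideg_eq0 ('X_i - z%:MP : P).
by rewrite s1 => /eqP E; rewrite E mnm0E in degX.
Qed.

End Multidegree.

(** * Counting parameters of factors *)

Section Weights.
Variables (R : realType) (l : nat).
Local Notation P := (cpoly R l).
Implicit Types (p q : P) (a b n : 'X_{1..l}).

(** The dimension of the projective space of polynomials of multidegree at most
    n: the number of parameters of a factor up to scale. *)
Definition weight n : nat := (dimPP n).-1.

Lemma dimPP_gt0 n : (0 < dimPP n)%N.
Proof. by rewrite /dimPP prodn_gt0. Qed.

Lemma prodS_superadd (s : seq 'I_l) (a b : 'I_l -> nat) :
  (\prod_(i <- s) (a i).+1 + \prod_(i <- s) (b i).+1
    <= (\prod_(i <- s) (a i + b i).+1).+1)%N.
Proof.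
elim: s => [|i s IH]; first by rewrite !big_nil.
rewrite !big_cons.
have : (0 < \prod_(i <- s) (a i).+1)%N by rewrite prodn_gt0.
have : (0 < \prod_(i <- s) (b i).+1)%N by rewrite prodn_gt0.
move: IH; move: (\prod_(i <- s) (a i).+1)%N (\prod_(i <- s) (b i).+1)%N.
by move: (\prod_(i <- s) _)%N => X A B; nia.
Qed.

Lemma weight_superadd a b : (weight a + weight b <= weight (a + b)%MM)%N.
Proof.
have := prodS_superadd (index_enum 'I_l) a b.
rewrite -/(dimPP a) -/(dimPP b).
have -> : (\prod_(i <- index_enum 'I_l) (a i + b i).+1)%N = dimPP (a + b)%MM.
  by apply: eq_bigr => i _; rewrite mnmDE.
by rewrite /weight; have := dimPP_gt0 a; have := dimPP_gt0 b; lia.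
Qed.

(** The cross term a_i b_j of the expanded product is what is gained. *)
Lemma weight_superadd_lt a b i j : i != j -> (0 < a i)%N -> (0 < b j)%N ->
  (weight a + weight b < weight (a + b)%MM)%N.
Proof.
move=> ij ai bj; rewrite /weight /dimPP.
under [X in (_ < X.-1)%N]eq_bigr do rewrite mnmDE.
have D1 (F : 'I_l -> nat) : (\prod_j F j = F i * \prod_(j | j != i) F j)%N.
  by rewrite (bigD1 i).
rewrite (D1 (fun j => (a j).+1)) (D1 (fun j => (b j).+1)).
rewrite (D1 (fun j => (a j + b j).+1)) -!(big_filter _ (fun j => j != i)).
set s := [seq k <- _ | _]; have := prodS_superadd s a b.
have : (0 < \prod_(i <- s) (a i).+1)%N by rewrite prodn_gt0.
have : (1 < \prod_(i <- s) (b i).+1)%N.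
  rewrite big_filter (bigD1 j) 1?eq_sym //=.
  apply: (@leq_trans (b j).+1) => //.
  by rewrite -{1}[(b j).+1]muln1 leq_mul2l prodn_gt0.
move: (\prod_(i <- s) (a i).+1)%N (\prod_(i <- s) (b i).+1)%N.
move: (\prod_(i <- s) _)%N => X A B B1 A1 XAB.
have : ((a i + b i).+1 * X + 1 > (a i).+1 * A + (b i).+1 * B)%N by nia.
by nia.
Qed.

Lemma weight0 : weight 0%MM = 0%N.
Proof. by rewrite /weight /dimPP big1 // => i _; rewrite mnm0E. Qed.

Lemma mnm_neq0P n : n != 0%MM -> exists i, (0 < n i)%N.
Proof.
move=> n0; apply: contrapT => /forallNP H; case/eqP: n0; apply/mnmP => i.
by rewrite mnm0E; apply/eqP; rewrite -leqn0 leqNgt; apply/negP.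
Qed.

Lemma weight_gt0 n : n != 0%MM -> (0 < weight n)%N.
Proof.
case/mnm_neq0P => i ni; rewrite /weight /dimPP (bigD1 i) //=.
have : (0 < \prod_(j < l | j != i) (n j).+1)%N by rewrite prodn_gt0.
by move: (\prod_(j < l | j != i) _)%N => X; nia.
Qed.

(** The degree of an irreducible polynomial involves two variables, which gives
    a cross term, or it is one, which is not a sum of two nonzero degrees. *)
Lemma weight_irreducible_lt p a b : irreducible p -> multideg p = (a + b)%MM ->
  a != 0%MM -> b != 0%MM -> (weight a + weight b < weight (a + b)%MM)%N.
Proof.
move=> pI pE /mnm_neq0P[i ai] /mnm_neq0P[j bj].
have [ij|ij] := eqVneq i j; last exact: weight_superadd_lt ij _ _.
have : exists2 k, k != i & (0 < (a + b)%MM k)%N.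
  apply: contrapT => H; have := irreducible_univariate (i := i) pI.
  rewrite pE => E; suff : (a + b)%MM i = 1%N by move: bj; rewrite -ij mnmDE; lia.
  apply: E => k ki; apply/eqP; rewrite -leqn0 leqNgt; apply/negP => abk.
  by apply: H; exists k.
case=> k ki; rewrite mnmDE addn_gt0 => /orP[ak|bk].
  by apply: (@weight_superadd_lt _ _ k j); rewrite // -ij.
by apply: (@weight_superadd_lt _ _ i k); rewrite // eq_sym.
Qed.

Lemma weight_sum (I : Type) (s : seq I) (e : I -> nat) (n : I -> 'X_{1..l}) :
  (\sum_(i <- s) e i * weight (n i) <= weight (\sum_(i <- s) n i *+ e i)%MM)%N.
Proof.
elim: s => [|i s IH]; first by rewrite !big_nil weight0.
rewrite !big_cons; apply: leq_trans (weight_superadd _ _).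
apply: leq_add IH; elim: (e i) => [|k IHk]; first by rewrite mul0n.
by rewrite mulSn mulmS; apply: leq_trans (weight_superadd _ _); rewrite leq_add2l.
Qed.

Lemma sum_mnm_eq0 (I : eqType) (s : seq I) (F : I -> 'X_{1..l}) i :
  i \in s -> (\sum_(j <- s) F j)%MM = 0%MM -> F i = 0%MM.
Proof.
move=> si /mnmP H; apply/mnmP => k; move: (H k).
rewrite mnm_sumE (big_rem i si) /= !mnm0E => /eqP.
by rewrite addn_eq0 => /andP[/eqP].
Qed.

Section Compare.
Variables (I J : finType) (q : I -> P) (k : I -> nat) (G : J -> P) (e : J -> nat).
Variables (al be : R[i]).
Hypothesis k_gt0 : forall i, (0 < k i)%N.
Hypothesis e_gt0 : forall j, (0 < e j)%N.
Hypothesis q_irr : forall i, irreducible (q i).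
Hypothesis q_nassoc : forall i j, i != j -> ~ assoc (q i) (q j).
Hypothesis al0 : al != 0.
Hypothesis be0 : be != 0.
Hypothesis qG : al *: \prod_i q i ^+ k i = be *: \prod_j G j ^+ e j.
Hypothesis G_irr_deg : forall j, exists2 p : P, irreducible p & multideg p = multideg (G j).

(** Comparing exponents in the two factorizations shows that the multiplicities
    x j i of q i in G j add up, with weights e j, to k i. *)
Lemma factor_exponents : exists (c : J -> R[i]) (x : J -> I -> nat),
  [/\ forall j, c j != 0, forall j, G j = c j *: \prod_i q i ^+ x j i
    & forall i, (\sum_j x j i * e j)%N = k i].
Proof.
have H j : exists y : R[i] * (I -> nat),
    y.1 != 0 /\ G j = y.1 *: \prod_i q i ^+ y.2 i.
  have [|c [x [c0 GE]]] := @divisor_exponents _ _ _ q q_irr (G j) k; last by exists (c, x).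
  apply: (divides_scale al0); rewrite qG; exists (be *: (G j ^+ (e j).-1 * \prod_(j' | j' != j) G j' ^+ e j')).
  by rewrite -scalerAr mulrA -exprS prednK // (bigD1 j).
have {H} [y yE] := choice H.
exists (fun j => (y j).1), (fun j => (y j).2); split=> [j|j|i].
- by case: (yE j).
- by case: (yE j).
apply: (@exponents_inj _ _ _ _ q_irr q_nassoc (be * \prod_j (y j).1 ^+ e j) al
  (fun i => \sum_j (y j).2 i * e j)%N k) => //.
  rewrite mulf_neq0 //; apply/prodf_neq0 => j _.
  by rewrite expf_neq0 //; case: (yE j).
rewrite qG -scalerA; congr (_ *: _).
under [RHS]eq_bigr do rewrite (yE _).2 exprZn.
rewrite scaler_prod; congr (_ *: _).
under [RHS]eq_bigr do rewrite -prodrXl.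
rewrite exchange_big /=; apply: eq_bigr => i' _.
by rewrite expr_sum; apply: eq_bigr => j _; rewrite exprM.
Qed.

(** Every factor q i divides some factor G j, so by superadditivity the G j
    have at least as many parameters as the q i. Equality leaves no room for a
    G j to have two factors. *)
Lemma compare_weights :
  (\sum_i weight (multideg (q i)) <= \sum_j weight (multideg (G j)))%N /\
  ((\sum_i weight (multideg (q i)) = \sum_j weight (multideg (G j)))%N ->
   exists pi : J -> I, bijective pi /\
     forall j, assoc (G j) (q (pi j)) /\ e j = k (pi j)).
Proof.
have [c [x [c0 GE xk]]] := factor_exponents.
have q0 i : q i != 0 by case: (q_irr i).
have qX0 j i : q i ^+ x j i != 0 by rewrite expf_neq0.
have degG j : multideg (G j) = (\sum_i multideg (q i) *+ x j i)%MM.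
  rewrite GE multidegZ // (multideg_prod (fun i _ => qX0 j i)).
  by apply: eq_bigr => i _; rewrite multidegX.
have wq i : (0 < weight (multideg (q i)))%N.
  exact/weight_gt0/irreducible_multideg.
have wG j : (\sum_i x j i * weight (multideg (q i)) <= weight (multideg (G j)))%N.
  by rewrite degG; exact: weight_sum.
have x_ex i : exists j, (0 < x j i)%N.
  apply: contrapT => /forallNP H; have := k_gt0 i; rewrite -xk big1 // => j _.
  by apply/eqP; rewrite muln_eq0 -leqn0 leqNgt (introF idP (H j)).
have x_sum i : (1 <= \sum_j x j i)%N.
  by have [j xji] := x_ex i; rewrite (bigD1 j) //=; lia.
have w_sum : (\sum_i weight (multideg (q i))
   <= \sum_i \sum_j x j i * weight (multideg (q i)))%N.
  apply: leq_sum => i _; rewrite -big_distrl /=.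
  by rewrite -{1}[weight _]mul1n leq_mul2r x_sum orbT.
have w_sum2 : (\sum_i \sum_j x j i * weight (multideg (q i))
    <= \sum_j weight (multideg (G j)))%N.
  by rewrite exchange_big /=; apply: leq_sum => j _; exact: wG.
split; first exact: leq_trans w_sum w_sum2.
move=> wE.
have x_sum1 i : (\sum_j x j i)%N = 1%N.
  apply/eqP; rewrite eqn_leq x_sum andbT leqNgt; apply/negP => x2.
  suff : (\sum_i weight (multideg (q i))
    < \sum_i \sum_j x j i * weight (multideg (q i)))%N by rewrite ltnNge wE w_sum2.
  rewrite (bigD1 i) //= [ltnRHS](bigD1 i) //= -addSn leq_add //.
    by rewrite -big_distrl /=; have := wq i; nia.
  apply: leq_sum => i' _; rewrite -big_distrl /=.
  by rewrite -{1}[weight _]mul1n leq_mul2r x_sum orbT.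
have wGE j : (\sum_i x j i * weight (multideg (q i)))%N = weight (multideg (G j)).
  apply/eqP; rewrite eqn_leq wG leqNgt; apply/negP => lt_w.
  suff : (\sum_i \sum_j x j i * weight (multideg (q i))
    < \sum_j weight (multideg (G j)))%N by rewrite ltnNge -wE w_sum.
  rewrite exchange_big /= (bigD1 j) //= [ltnRHS](bigD1 j) //= -addSn leq_add //.
  by apply: leq_sum => j' _; exact: wG.
have x_le1 i j : (x j i <= 1)%N by rewrite -(x_sum1 i) (bigD1 j) //= leq_addr.
have x_pi j : exists i, forall i', x j i' = (i' == i).
  have Gn0 : multideg (G j) != 0%MM.
    by have [p pI <-] := G_irr_deg j; exact: irreducible_multideg.
  have [i xi] : exists i, (0 < x j i)%N.
    apply: contrapT => /forallNP H; case/eqP: Gn0; rewrite degG big1 // => i _.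
    by rewrite (_ : x j i = 0)%N ?mulm0n //; apply/eqP; rewrite -leqn0 leqNgt; apply/negP.
  have xi1 : x j i = 1%N by apply/eqP; rewrite eqn_leq xi x_le1.
  exists i => i'; have [->//|ii'] := eqVneq i' i.
  apply/eqP; rewrite -leqn0 leqNgt; apply/negP => xi'.
  have degE : multideg (G j) = (multideg (q i) + \sum_(i1 | i1 != i) multideg (q i1) *+ x j i1)%MM.
    by rewrite degG (bigD1 i) //= xi1 mulm1n.
  have [p pI pE] := G_irr_deg j; rewrite -pE in degE.
  have := weight_irreducible_lt pI degE (irreducible_multideg (q_irr i)).
  rewrite -degE pE -wGE => H.
  have : (\sum_(i1 | i1 != i) multideg (q i1) *+ x j i1)%MM != 0%MM.
    apply/eqP; rewrite -(big_filter _ (fun j => j != i)) => /(sum_mnm_eq0 (i := i')).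
    rewrite mem_filter ii' mem_index_enum => /(_ isT).
    have -> : x j i' = 1%N by apply/eqP; rewrite eqn_leq x_le1.
    by rewrite mulm1n; apply/eqP/irreducible_multideg.
  move/H; rewrite [ltnRHS](bigD1 i) //= xi1 mul1n ltn_add2l.
  by rewrite -!(big_filter _ (fun j => j != i)) ltnNge weight_sum.
have [pi piE] := choice x_pi.
exists pi; split; last first.
  move=> j; split.
    exists (c j) => //; rewrite GE (bigD1 (pi j)) //= piE eqxx expr1 big1 ?mulr1 // => i ij.
    by rewrite piE (negPf ij) expr0.
  rewrite -xk (bigD1 j) //= piE eqxx mul1n big1 ?addn0 // => j' jj'.
  have := x_sum1 (pi j); rewrite (bigD1 j) //= piE eqxx => /eqP; rewrite eqSS.
  by rewrite sum_nat_eq0 => /forall_inP/(_ _ jj')/eqP->.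
have [rho rhoE] := choice x_ex.
exists rho => [j|i].
  apply: contrapT => /eqP rj; have := x_sum1 (pi j).
  rewrite (bigD1 j) //= piE eqxx (bigD1 (rho (pi j))) //=.
  by have := rhoE (pi j); lia.
by have := rhoE i; rewrite piE; case: eqP.
Qed.

End Compare.
End Weights.

(** * Factorization structures *)

Section Structures.
Variables (R : realType) (l : nat).
Local Notation P := (cpoly R l).
Implicit Types (p q f : P) (n : 'X_{1..l}) (M N : fstructure l).

Lemma irreducible_not_coprime p q :
  irreducible p -> irreducible q -> ~ mcoprime p q -> assoc p q.
Proof.
move=> pI qI /existsNP[d /existsNP[p' /existsNP[q' /not_implyP[pE /not_implyP[qE dU]]]]].
case: (pI) => _ _ pirr; case: (qI) => _ _ qirr.
have [U|/mpoly_unitP[a a0 p'E]] := pirr _ _ pE; first by case: dU.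
have [U|/mpoly_unitP[b b0 q'E]] := qirr _ _ qE; first by case: dU.
have pd : assoc p d by exists a => //; rewrite pE p'E mulrC mul_mpolyC.
have qd : assoc q d by exists b => //; rewrite qE q'E mulrC mul_mpolyC.
exact: assoc_trans pd (assoc_sym qd).
Qed.

Lemma coprime_not_assoc p q : irreducible q -> mcoprime p q -> ~ assoc p q.
Proof.
move=> [_ qU _] pq [c c0 pE]; case/negP: qU; apply: (pq q c%:MP 1).
  by rewrite mulrC mul_mpolyC.
by rewrite mulr1.
Qed.

Definition fs_iso N M := exists pi : 'I_(size N) -> 'I_(size M),
  bijective pi /\ forall j, tnth (in_tuple N) j = tnth (in_tuple M) (pi j).

Lemma fs_iso_sym N M : fs_iso N M -> fs_iso M N.
Proof.
case=> pi [[rho piK rhoK] E]; exists rho; split; first by exists pi.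
by move=> i; rewrite E rhoK.
Qed.

Lemma fs_degE M : fs_deg M = (\sum_(j < size M) fs_base j *+ fs_exp j)%MM.
Proof. by rewrite /fs_deg (big_tnth _ _ M). Qed.

Lemma fs_deg_iso N M : fs_iso N M -> fs_deg N = fs_deg M.
Proof.
move=> [pi [pibij E]]; rewrite !fs_degE (reindex pi) /=; last exact: onW_bij.
by apply: eq_bigr => j _; rewrite /fs_base /fs_exp E.
Qed.

Lemma codimE M : codim M =
  (dimPP (fs_deg M))%:Z - 1 - (\sum_(j < size M) weight (fs_base j))%N%:Z.
Proof.
rewrite /codim (big_tnth _ _ M) /=.
have -> : \sum_(j < size M) (dimPP (tnth (in_tuple M) j).1)%:Z
    = (\sum_(j < size M) weight (fs_base j))%N%:Z + (size M)%:Z.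
  rewrite -[in (size M)%:Z](card_ord (size M)) -sum1_card.
  rewrite !(big_morph Posz PoszD (erefl (Posz 0))) -big_split /=.
  apply: eq_bigr => j _; rewrite -PoszD addn1 /weight prednK //.
  exact: dimPP_gt0.
ring.
Qed.

Lemma fs_factors_irreducible M (g : 'I_(size M) -> P) j :
  fs_factors g -> irreducible (g j).
Proof. by case=> /(_ j)[_ gI] _; exact: gI. Qed.

Lemma fs_factors_multideg M (g : 'I_(size M) -> P) j :
  fs_factors g -> multideg (g j) = fs_base j.
Proof. by case=> /(_ j)[[]]. Qed.

Lemma fs_factors_nassoc M (g : 'I_(size M) -> P) i j :
  fs_factors g -> i != j -> ~ assoc (g i) (g j).
Proof.
move=> gM ij; apply: coprime_not_assoc (fs_factors_irreducible j gM) _.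
by case: gM => _; exact.
Qed.

Lemma fs_prod_multideg M (g : 'I_(size M) -> P) (c : R[i]) : c != 0 ->
  (forall j, g j != 0) ->
  multideg (fs_prod c g) = (\sum_j multideg (g j) *+ fs_exp j)%MM.
Proof.
move=> c0 g0; rewrite multidegZ // multideg_prod.
  by apply: eq_bigr => j _; rewrite multidegX.
by move=> j _; rewrite expf_neq0.
Qed.

Lemma fs_prod_neq0 M (g : 'I_(size M) -> P) (c : R[i]) : c != 0 ->
  (forall j, g j != 0) -> fs_prod c g != 0.
Proof.
move=> c0 g0; rewrite /fs_prod -mul_mpolyC mulf_neq0 ?mpolyC_eq0 //.
by apply/prodf_neq0 => j _; rewrite expf_neq0.
Qed.

Lemma has_structure_FM M f :
  has_structure f M <-> (forall j : 'I_(size M), (0 < fs_exp j)%N) /\ FM M f.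
Proof.
split=> [[M0 [c [g [c0 gM fE]]]]|[M0 [[f0 _] [c [g [gM fE]]]]]].
  split=> //; split; last by exists c, g.
  have g0 j : g j != 0 by case: (fs_factors_irreducible j gM).
  split; rewrite fE; first exact: fs_prod_neq0.
  rewrite fs_prod_multideg // fs_degE; apply: eq_bigr => j _.
  by rewrite (fs_factors_multideg _ gM).
split=> //; exists c, g; split=> //.
by apply: contraNneq f0 => c0; rewrite fE /fs_prod c0 scale0r.
Qed.

Lemma structure_exp_gt0 M : is_structure R M -> forall j : 'I_(size M), (0 < fs_exp j)%N.
Proof. by case=> f []. Qed.

Lemma structure_base_irreducible M : is_structure R M -> forall j : 'I_(size M),
  exists2 p : P, irreducible p & multideg p = fs_base j.
Proof.
case=> f [_ [c [g [_ gM _]]]] j; exists (g j).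
  exact: fs_factors_irreducible.
exact: fs_factors_multideg.
Qed.

Lemma FM_scale M f (c : R[i]) : c != 0 -> FM M f -> FM M (c *: f).
Proof.
move=> c0 [[f0 fd] [a [g [gM fE]]]]; split.
  by split; rewrite ?multidegZ // -mul_mpolyC mulf_neq0 ?mpolyC_eq0.
by exists (c * a), g; split=> //; rewrite fE /fs_prod scalerA.
Qed.

Lemma FM_iso N M f : fs_iso N M -> FM N f -> FM M f.
Proof.
move=> NM [[f0 fd] [c [g [gN fE]]]]; split.
  by split=> //; rewrite -(fs_deg_iso NM).
have [pi [[rho piK rhoK] E]] := NM; exists c, (g \o rho); split.
  split=> [j|i j ij]; last first.
    by case: gN => _; apply; rewrite (inj_eq (can_inj rhoK)).
  case: gN => /(_ (rho j)) [gd gI] _; split=> //.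
  by move: gd; rewrite /fs_base E rhoK.
rewrite fE /fs_prod; congr (_ *: _); rewrite [RHS](reindex pi) /=; last first.
  by apply: onW_bij; exists rho.
by apply: eq_bigr => j _; rewrite piK /fs_exp E.
Qed.

Lemma make_structure (r : nat) (q : 'I_r -> P) (k : 'I_r -> nat) (a : R[i]) :
  a != 0 -> (forall j, 0 < k j)%N -> (forall j, irreducible (q j)) ->
  (forall i j, i != j -> ~ assoc (q i) (q j)) ->
  exists M, has_structure (a *: \prod_j q j ^+ k j) M.
Proof.
move=> a0 k0 qI qn.
pose T : r.-tuple _ := [tuple (multideg (q j), k j) | j < r].
have sT : size T = r by rewrite size_tuple.
exists (val T); pose c := cast_ord sT.
have E (j : 'I_(size T)) : tnth (in_tuple T) j = (multideg (q (c j)), k (c j)).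
  rewrite -(tnth_mktuple (fun j => (multideg (q j), k j)) (c j)) -/T.
  by rewrite !(tnth_nth (0%MM, 0%N)).
split=> [j|]; first by rewrite /fs_exp E; exact: k0.
exists a, (q \o c); split=> //.
  split=> [j|i j ij] /=.
    split; last exact: qI.
    by split; [case: (qI (c j))|rewrite /fs_base E].
  apply: contrapT => /(irreducible_not_coprime (qI _) (qI _)).
  by apply: qn; rewrite (inj_eq (can_inj (cast_ordK _))).
rewrite /fs_prod; congr (_ *: _).
rewrite (reindex c) /=; last first.
  by apply: onW_bij; exists (cast_ord (esym sT)); [exact: cast_ordK|exact: cast_ordKV].
by apply: eq_bigr => j _; rewrite /fs_exp E.
Qed.

Lemma has_structure_prod (s : seq P) (c : R[i]) : c != 0 ->
  (forall p, p \in s -> irreducible p) ->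
  exists M, has_structure (c *: \prod_(p <- s) p) M.
Proof.
move=> c0 /(group_factors c0)[r [q [k [a [a0 k0 qI qn ->]]]]].
exact: make_structure.
Qed.

(** The factors G j only have the degrees of irreducible polynomials: this is
    the form of a limit of polynomials with structure N. *)
Lemma compare_structures M N f (al be : R[i]) (q : 'I_(size M) -> P)
    (G : 'I_(size N) -> P) :
  (forall j : 'I_(size M), (0 < fs_exp j)%N) -> fs_factors q -> f != 0 ->
  f = fs_prod al q -> is_structure R N -> f = fs_prod be G ->
  (forall j, multideg (G j) = fs_base j) ->
  codim N <= codim M /\
  (codim N = codim M -> exists pi : 'I_(size N) -> 'I_(size M),
     [/\ bijective pi, forall j, tnth (in_tuple N) j = tnth (in_tuple M) (pi j)
       & forall j, assoc (G j) (q (pi j))]).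
Proof.
move=> M0 qM f0 fq Nstr fG Gdeg.
have al0 : al != 0 by apply: contraNneq f0 => a0; rewrite fq /fs_prod a0 scale0r.
have be0 : be != 0 by apply: contraNneq f0 => a0; rewrite fG /fs_prod a0 scale0r.
have qI j := fs_factors_irreducible j qM.
have q0 j : q j != 0 by case: (qI j).
have Gd j : exists2 p : P, irreducible p & multideg p = multideg (G j).
  by rewrite Gdeg; exact: structure_base_irreducible.
have G0 j : G j != 0.
  have [p pI pE] := Gd j; apply: contraTneq (irreducible_multideg pI) => Gj0.
  by rewrite negbK pE Gj0 -mpolyC0 multidegC.
have degE : fs_deg N = fs_deg M.
  rewrite !fs_degE.
  transitivity (multideg f); [rewrite fG|rewrite fq]; rewrite fs_prod_multideg //;
    apply: eq_bigr => j _; rewrite ?Gdeg //.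
  by rewrite (fs_factors_multideg _ qM).
have [w_le w_eq] := compare_weights M0 (structure_exp_gt0 Nstr) qI
  (fun i j => fs_factors_nassoc qM) al0 be0 (etrans (esym fq) fG) Gd.
have ME : (\sum_i weight (multideg (q i)) = \sum_(i < size M) weight (fs_base i))%N.
  by apply: eq_bigr => j _; rewrite (fs_factors_multideg _ qM).
have NE : (\sum_j weight (multideg (G j)) = \sum_(j < size N) weight (fs_base j))%N.
  by apply: eq_bigr => j _; rewrite Gdeg.
rewrite !codimE degE -ME -NE; split; first by move: w_le; lia.
move=> wE; have [|pi [pibij piE]] := w_eq; first by move: wE; lia.
exists pi; split=> // j; last by case: (piE j).
have [[c c0 GE] ej] := piE j.
rewrite [LHS]surjective_pairing [RHS]surjective_pairing.
rewrite -/(fs_base j) -/(fs_exp j) -/(fs_base (pi j)) -/(fs_exp (pi j)) ej.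
by rewrite -Gdeg GE multidegZ // (fs_factors_multideg _ qM).
Qed.

(** Powers become plain products over this list, on which expansions and limits
    are proved by induction. *)
Definition fs_indices M : seq 'I_(size M) :=
  flatten [seq nseq (fs_exp j) j | j <- enum 'I_(size M)].

Lemma fs_indices_prod M (g : 'I_(size M) -> P) :
  \prod_(j <- fs_indices M) g j = \prod_j g j ^+ fs_exp j.
Proof.
rewrite /fs_indices big_flatten /= big_map enumT; apply: eq_bigr => j _.
by rewrite big_nseq iter_mulr_1.
Qed.

Lemma mem_fs_indices M j : (0 < fs_exp j)%N -> j \in fs_indices M.
Proof.
move=> j0; apply/flattenP; exists (nseq (fs_exp j) j).
  by apply: map_f; rewrite mem_enum.
by rewrite mem_nseq j0 eqxx.
Qed.

(** Exponents are positive and multidegrees nonzero, so there are finitely many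
    structures of a given degree. *)
Lemma finite_structures n : exists L : seq (fstructure l),
  forall M, is_structure R M -> fs_deg M = n -> M \in L.
Proof.
pose d := mdeg n.
pose E (x : 'X_{1..l < d.+1} * 'I_d.+1) := (bmnm x.1, val x.2).
exists (flatten [seq [seq map E (val t) | t : k.-tuple ('X_{1..l < d.+1} * 'I_d.+1)%type]
          | k <- iota 0 d.+1]).
move=> M Mstr Mn.
have mE : d = (\sum_(j < size M) mdeg (fs_base j) * fs_exp j)%N.
  by rewrite /d -Mn fs_degE mdeg_sum; apply: eq_bigr => j _; rewrite mdegMn.
have e0 := structure_exp_gt0 Mstr.
have b0 (j : 'I_(size M)) : (0 < mdeg (fs_base j))%N.
  have [p pI <-] := structure_base_irreducible Mstr j.
  by rewrite lt0n mdeg_eq0 irreducible_multideg.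
have bd (j : 'I_(size M)) : (mdeg (fs_base j) < d.+1)%N.
  rewrite ltnS mE (bigD1 j) //= (leq_trans _ (leq_addr _ _)) //.
  by have := e0 j; nia.
have ed (j : 'I_(size M)) : (fs_exp j < d.+1)%N.
  rewrite ltnS mE (bigD1 j) //= (leq_trans _ (leq_addr _ _)) //.
  by have := b0 j; nia.
have sd : (size M < d.+1)%N.
  rewrite ltnS mE -[leqLHS]card_ord -sum1_card; apply: leq_sum => j _.
  by have := b0 j; have := e0 j; nia.
apply/flatten_mapP; exists (size M); first by rewrite mem_iota.
apply/mapP; exists [tuple (BMultinom (bd j), Ordinal (ed j)) | j < size M].
  by rewrite mem_enum.
apply: (@eq_from_nth _ (0%MM, 0%N)); first by rewrite size_map size_tuple.
move=> i iM; rewrite -[LHS](tnth_nth _ (in_tuple M) (Ordinal iM)) -map_comp.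
rewrite (nth_map (Ordinal iM)) ?size_enum_ord //.
rewrite (_ : nth _ _ _ = Ordinal iM); last by apply: val_inj; rewrite /= nth_enum_ord.
by rewrite /E /= /fs_base /fs_exp -surjective_pairing.
Qed.

End Structures.

(** * The coefficient norm and the sine *)

Section Norms.
Variables (R : realType) (l : nat).
Local Notation P := (cpoly R l).
Local Notation C := R[i].
Implicit Types (p q r : P) (c : C) (t : R).

Lemma pdot_box k p q : (msize p <= k)%N ->
  pdot p q = \sum_(a : 'X_{1..l < k}) conjc p@_a * q@_a.
Proof.
move=> pk; pose I : subFinType _ := 'X_{1..l < k}.
rewrite /pdot (big_mksub I) /=; first last.
- by move=> a ap; apply: leq_trans pk; exact: msize_mdeg_lt.
- exact: msupp_uniq.
by rewrite big_rmcond //= => a /memN_msupp_eq0 ->; rewrite rmorph0 mul0r.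
Qed.

Lemma pdotDr p q r : pdot p (q + r) = pdot p q + pdot p r.
Proof. by rewrite /pdot -big_split; apply: eq_bigr => a _; rewrite mcoeffD mulrDr. Qed.

Lemma pdotZr p c q : pdot p (c *: q) = c * pdot p q.
Proof. by rewrite /pdot big_distrr; apply: eq_bigr => a _; rewrite mcoeffZ mulrCA. Qed.

Lemma pdotC p q : pdot q p = conjc (pdot p q).
Proof.
pose k := maxn (msize p) (msize q).
rewrite (@pdot_box k q) ?leq_maxr // (@pdot_box k p) ?leq_maxl // rmorph_sum.
by apply: eq_bigr => a _; rewrite rmorphM /= conjcK mulrC.
Qed.

(** The Euclidean inner product of the underlying real space. *)
Definition rdot p q : R := complex.Re (pdot p q).

Lemma rdotC p q : rdot q p = rdot p q.
Proof. by rewrite /rdot pdotC; case: (pdot p q). Qed.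

Lemma rdotDr p q r : rdot p (q + r) = rdot p q + rdot p r.
Proof. by rewrite /rdot pdotDr raddfD. Qed.

Lemma rdotDl p q r : rdot (q + r) p = rdot q p + rdot r p.
Proof. by rewrite rdotC rdotDr !(rdotC p). Qed.

Lemma rdotZr p t q : rdot p (t%:C%C *: q) = t * rdot p q.
Proof. by rewrite /rdot pdotZr; case: (pdot p q) => a b /=; rewrite mul0r subr0. Qed.

Lemma rdotZl p t q : rdot (t%:C%C *: q) p = t * rdot q p.
Proof. by rewrite rdotC rdotZr rdotC. Qed.

Lemma rdotNr p q : rdot p (- q) = - rdot p q.
Proof.
have -> : - q = (- 1)%:C%C *: q by rewrite rmorphN1 scaleN1r.
by rewrite rdotZr mulN1r.
Qed.

Lemma rdotNl p q : rdot (- q) p = - rdot q p.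
Proof. by rewrite rdotC rdotNr rdotC. Qed.

Lemma rdotBr p q r : rdot p (q - r) = rdot p q - rdot p r.
Proof. by rewrite rdotDr rdotNr. Qed.

Lemma rdotBl p q r : rdot (q - r) p = rdot q p - rdot r p.
Proof. by rewrite rdotDl rdotNl. Qed.

Lemma rdot_sq p : rdot p p =
  \sum_(a <- msupp p) (complex.Re p@_a ^+ 2 + complex.Im p@_a ^+ 2).
Proof.
rewrite /rdot /pdot raddf_sum; apply: eq_bigr => a _ /=.
by case: (p@_a) => x y /=; ring.
Qed.

Lemma pnormE p : pnorm p = Num.sqrt (rdot p p).
Proof. by rewrite rdot_sq. Qed.

Lemma rdot_ge0 p : 0 <= rdot p p.
Proof. by rewrite rdot_sq; apply: sumr_ge0 => a _; rewrite addr_ge0 ?sqr_ge0. Qed.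

Lemma pnorm_ge0 p : 0 <= pnorm p.
Proof. exact: sqrtr_ge0. Qed.

Lemma sqr_pnorm p : pnorm p ^+ 2 = rdot p p.
Proof. by rewrite pnormE sqr_sqrtr ?rdot_ge0. Qed.

Lemma coef_le_pnorm p a :
  `|complex.Re p@_a| <= pnorm p /\ `|complex.Im p@_a| <= pnorm p.
Proof.
suff H : complex.Re p@_a ^+ 2 + complex.Im p@_a ^+ 2 <= rdot p p.
  have Re2 := sqr_ge0 (complex.Re p@_a); have Im2 := sqr_ge0 (complex.Im p@_a).
  by split; rewrite -sqrtr_sqr pnormE ler_wsqrtr //; apply: le_trans H; lra.
rewrite rdot_sq; have [ap|ap] := boolP (a \in msupp p).
  rewrite (big_rem a ap) /= lerDl; apply: sumr_ge0 => b _.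
  by rewrite addr_ge0 ?sqr_ge0.
move: ap; rewrite -mcoeff_eq0 => /eqP-> /=; rewrite expr0n addr0.
by apply: sumr_ge0 => b _; rewrite addr_ge0 ?sqr_ge0.
Qed.

Lemma pnorm_eq0 p : (pnorm p == 0) = (p == 0).
Proof.
apply/eqP/eqP => [p0|->]; last by rewrite /pnorm msupp0 big_nil sqrtr0.
apply/mpolyP => a; rewrite mcoeff0.
have [] := coef_le_pnorm p a; rewrite p0 !normr_le0 => /eqP Re0 /eqP Im0.
by apply/eqP; rewrite eq_complex Re0 Im0 !eqxx.
Qed.

Lemma pnorm0 : pnorm (0 : P) = 0.
Proof. by apply/eqP; rewrite pnorm_eq0. Qed.

Lemma pnorm_gt0 p : (0 < pnorm p) = (p != 0).
Proof. by rewrite lt_neqAle pnorm_ge0 andbT eq_sym pnorm_eq0. Qed.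

(** Expand the square of the norm of |q| p - |p| q. *)
Lemma cauchy_schwarz p q : rdot p q <= pnorm p * pnorm q.
Proof.
have [->|q0] := eqVneq q 0.
  by rewrite pnorm0 mulr0 rdotC /rdot /pdot msupp0 big_nil.
have [->|p0] := eqVneq p 0.
  by rewrite pnorm0 mul0r /rdot /pdot msupp0 big_nil.
have := rdot_ge0 ((pnorm q)%:C%C *: p - (pnorm p)%:C%C *: q).
rewrite rdotBl !rdotBr !rdotZl !rdotZr -!sqr_pnorm (rdotC p q) => H.
have pq : 0 < pnorm p * pnorm q by rewrite mulr_gt0 ?pnorm_gt0.
rewrite -(ler_pM2l pq); nra.
Qed.

Lemma pnormD p q : pnorm (p + q) <= pnorm p + pnorm q.
Proof.
rewrite -(@ler_pXn2r _ 2) ?nnegrE ?addr_ge0 ?pnorm_ge0 //.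
rewrite sqrrD !sqr_pnorm rdotDl !rdotDr (rdotC p q) mulr2n.
by have := cauchy_schwarz p q; lra.
Qed.

Lemma pnormN p : pnorm (- p) = pnorm p.
Proof. by rewrite !pnormE rdotNl rdotNr opprK. Qed.

Lemma pnormB p q : pnorm (p - q) = pnorm (q - p).
Proof. by rewrite -pnormN opprB. Qed.

Lemma pnorm_triangle q p r : pnorm (p - r) <= pnorm (p - q) + pnorm (q - r).
Proof. by apply: le_trans (pnormD _ _); rewrite addrA subrK. Qed.

Definition cmod c : R := Num.sqrt (complex.Re c ^+ 2 + complex.Im c ^+ 2).

Lemma pnormZ c p : pnorm (c *: p) = cmod c * pnorm p.
Proof.
rewrite !pnormE /cmod -sqrtrM ?addr_ge0 ?sqr_ge0 //; congr Num.sqrt.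
rewrite /rdot pdotZr pdotC pdotZr pdotC rmorphM /= conjcK.
have : complex.Im (pdot p p) = 0.
  by have := pdotC p p; case: (pdot p p) => x y /= [] H; apply/eqP; lra.
by case: (pdot p p) => x y /= ->; case: c => u v /=; ring.
Qed.

Lemma pnormZr t p : 0 <= t -> pnorm (t%:C%C *: p) = t * pnorm p.
Proof. by move=> t0; rewrite pnormZ /cmod /= expr0n addr0 sqrtr_sqr ger0_norm. Qed.

Lemma cmod_gt0 c : c != 0 -> 0 < cmod c.
Proof.
case: c => x y; rewrite eq_complex /= negb_and /cmod /= sqrtr_gt0 => /orP[x0|y0].
  by rewrite ltr_wpDr ?sqr_ge0 // exprn_even_gt0.
by rewrite ltr_wpDl ?sqr_ge0 // exprn_even_gt0.
Qed.

Lemma pnormalize p : p != 0 -> pnorm (((pnorm p)^-1)%:C%C *: p) = 1.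
Proof.
by move=> p0; rewrite pnormZr ?invr_ge0 ?pnorm_ge0 // mulVf ?pnorm_eq0.
Qed.

(** The vector defining the sine is the residual of an orthogonal projection. *)
Lemma psin_min p q c : q != 0 ->
  psin p q <= pnorm (((pnorm p)^-1)%:C%C *: p - c *: q).
Proof.
move=> q0; rewrite /psin; set e := _ *: p; set w := pdot q p / _.
set r := e - _; have nq : pnorm q != 0 by rewrite pnorm_eq0.
have qq : pdot q q = (pnorm q ^+ 2)%:C%C.
  rewrite sqr_pnorm; have := pdotC q q; rewrite /rdot.
  by case: (pdot q q) => x y /= [] H; congr (_ +i* _)%C; lra.
have rq : pdot q r = 0.
  rewrite /r -[- _]scaleN1r pdotDr !pdotZr qq /w rmorphM invfM.
  rewrite !fmorphV rmorphXn /=; have : (pnorm q)%:C%C != 0 by rewrite fmorph_eq0.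
  move: (pnorm q)%:C%C (_^-1) (pdot q p) => A b D A0; rewrite expr2 mulKf //.
  have -> : D * (A^-1 * b) * A = b * D * (A^-1 * A) by ring.
  by rewrite mulVf // mulr1 mulN1r subrr.
pose z := w * ((pnorm q)^-1)%:C%C - c.
have -> : e - c *: q = r + z *: q.
  by rewrite /r /z scalerBl scalerA addrA subrK.
have rz : rdot r (z *: q) = 0.
  by rewrite -rdotC /rdot pdotC pdotZr pdotC rq conjc0 mulr0 conjc0.
move: r rz {rq} => r rz.
rewrite -(@ler_pXn2r _ 2) ?nnegrE ?pnorm_ge0 // !sqr_pnorm rdotDl !rdotDr rz.
by rewrite (rdotC r) rz addr0 add0r lerDl rdot_ge0.
Qed.

(** The sine only depends on the complex lines, so it is computed on u and v. *)
Lemma psin_le p q u v (e : R) : assoc p u -> assoc q v -> u != 0 -> v != 0 ->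
  pnorm (u - v) <= e * pnorm u -> psin p q <= e.
Proof.
move=> [c c0 ->] [d d0 ->] u0 v0 uv.
have dv0 : d *: v != 0 by rewrite -mul_mpolyC mulf_neq0 ?mpolyC_eq0.
pose z := (pnorm (c *: u))^-1.
apply: le_trans (@psin_min _ _ (z%:C%C * c / d) dv0) _.
rewrite !scalerA divfK // -scalerBr -scalerA -/z pnormZr; last first.
  by rewrite invr_ge0 pnorm_ge0.
rewrite /z !pnormZ ler_pdivrMl ?mulr_gt0 ?cmod_gt0 ?pnorm_gt0 //.
by rewrite -mulrA ler_pM2l ?cmod_gt0 // mulrC.
Qed.

End Norms.

(** * Coefficientwise limits *)

Section Convergence.
Variables (R : realType) (l : nat) (U : set_system nat).
Context {FU : ProperFilter U}.
Local Notation P := (cpoly R l).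
Local Notation C := R[i].
Implicit Types (u v : nat -> P) (p q : P) (z w : nat -> C) (c : C).

(** Stated with real and imaginary parts, so that the limit theorems for real
    functions apply along any filter. *)
Definition ccvg z c :=
  ((fun n => complex.Re (z n)) @ U --> complex.Re c) /\
  ((fun n => complex.Im (z n)) @ U --> complex.Im c).

(** Convergence of each coefficient. As a coefficient of a product is a finite
    sum, products converge without any bound on the degrees; such a bound is
    only needed to pass to norms. *)
Definition pcvg u p := forall a, ccvg (fun n => (u n)@_a) p@_a.

Lemma ccvg_cst c : ccvg (fun=> c) c.
Proof. by split; exact: cvg_cst. Qed.

Lemma ccvgD z w c d : ccvg z c -> ccvg w d -> ccvg (fun n => z n + w n) (c + d).
Proof.
move=> [zr zi] [wr wi]; split; rewrite raddfD.
  by under eq_fun do rewrite raddfD; exact: cvgD.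
by under eq_fun do rewrite raddfD; exact: cvgD.
Qed.

Lemma ReM c d : complex.Re (c * d) =
  complex.Re c * complex.Re d - complex.Im c * complex.Im d.
Proof. by case: c => ? ?; case: d. Qed.

Lemma ImM c d : complex.Im (c * d) =
  complex.Re c * complex.Im d + complex.Im c * complex.Re d.
Proof. by case: c => ? ?; case: d. Qed.

Lemma ccvgM z w c d : ccvg z c -> ccvg w d -> ccvg (fun n => z n * w n) (c * d).
Proof.
move=> [zr zi] [wr wi]; split; rewrite ?ReM ?ImM.
  by under eq_fun do rewrite ReM; apply: cvgB; exact: cvgM.
by under eq_fun do rewrite ImM; apply: cvgD; exact: cvgM.
Qed.

Lemma ccvg_sum (I : Type) (r : seq I) (A : pred I) (z : I -> nat -> C) (c : I -> C) :
  (forall i, ccvg (z i) (c i)) ->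
  ccvg (fun n => \sum_(i <- r | A i) z i n) (\sum_(i <- r | A i) c i).
Proof.
move=> zc; elim: r => [|i r IH].
  by rewrite big_nil; under eq_fun do rewrite big_nil; exact: ccvg_cst.
rewrite big_cons; under eq_fun do rewrite big_cons.
by case: (A i) => //; exact: ccvgD.
Qed.

Lemma ccvgV z c : c != 0 -> ccvg z c -> ccvg (fun n => (z n)^-1) c^-1.
Proof.
move=> c0 [zr zi].
have m0 : complex.Re c ^+ 2 + complex.Im c ^+ 2 != 0.
  have := cmod_gt0 c0; rewrite /cmod sqrtr_gt0.
  by move/gt_eqF => ->.
have m_cvg : (fun n => complex.Re (z n) ^+ 2 + complex.Im (z n) ^+ 2) @ U
    --> complex.Re c ^+ 2 + complex.Im c ^+ 2.
  by apply: cvgD; exact: cvgM.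
have ReV (d : C) : complex.Re d^-1 = complex.Re d / (complex.Re d ^+ 2 + complex.Im d ^+ 2).
  by case: d.
have ImV (d : C) : complex.Im d^-1 = - complex.Im d / (complex.Re d ^+ 2 + complex.Im d ^+ 2).
  by case: d => x y /=; rewrite mulNr.
split.
  rewrite ReV; under eq_fun do rewrite ReV.
  by apply: cvgM => //; exact: cvgV.
rewrite ImV; under eq_fun do rewrite ImV.
by apply: cvgM; [exact: cvgN|exact: cvgV].
Qed.

Lemma ccvg_unique z c d : ccvg z c -> ccvg z d -> c = d.
Proof.
move=> [zr zi] [zr' zi']; apply/eqP; rewrite eq_complex.
by rewrite (cvg_unique _ zr zr') // (cvg_unique _ zi zi') // !eqxx.
Qed.

Lemma ccvg_neq0 z c : c != 0 -> ccvg z c -> \forall n \near U, z n != 0.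
Proof.
move=> c0 [zr zi].
have m_cvg : (fun n => complex.Re (z n) ^+ 2 + complex.Im (z n) ^+ 2) @ U
    --> complex.Re c ^+ 2 + complex.Im c ^+ 2.
  by apply: cvgD; exact: cvgM.
have m0 : 0 < complex.Re c ^+ 2 + complex.Im c ^+ 2.
  by have := cmod_gt0 c0; rewrite /cmod sqrtr_gt0.
apply: filterS (cvgr_gt _ m_cvg _ m0) => n.
by apply: contraTneq => ->; rewrite /= expr0n addr0 ltxx.
Qed.

Lemma ccvg_real (t : nat -> R) (s : R) : t @ U --> s -> ccvg (fun n => (t n)%:C%C) s%:C%C.
Proof. by move=> ts; split => //=; exact: cvg_cst. Qed.

Lemma pcvg_cst p : pcvg (fun=> p) p.
Proof. by move=> a; exact: ccvg_cst. Qed.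

Lemma pcvgD u v p q : pcvg u p -> pcvg v q -> pcvg (fun n => u n + v n) (p + q).
Proof.
move=> up vq a; rewrite mcoeffD; under eq_fun do rewrite mcoeffD.
by apply: ccvgD; [exact: up|exact: vq].
Qed.

Lemma pcvgM u v p q : pcvg u p -> pcvg v q -> pcvg (fun n => u n * v n) (p * q).
Proof.
move=> up vq a; rewrite mcoeffM; under eq_fun do rewrite mcoeffM.
by apply: ccvg_sum => k; apply: ccvgM; [exact: up|exact: vq].
Qed.

Lemma pcvgZ z u c p : ccvg z c -> pcvg u p -> pcvg (fun n => z n *: u n) (c *: p).
Proof.
move=> zc up a; rewrite mcoeffZ; under eq_fun do rewrite mcoeffZ.
by apply: ccvgM; [|exact: up].
Qed.

Lemma pcvgN u p : pcvg u p -> pcvg (fun n => - u n) (- p).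
Proof.
move=> up; rewrite -scaleN1r; under eq_fun do rewrite -scaleN1r.
by apply: pcvgZ up; exact: ccvg_cst.
Qed.

Lemma pcvgB u v p q : pcvg u p -> pcvg v q -> pcvg (fun n => u n - v n) (p - q).
Proof. by move=> up /pcvgN; exact: pcvgD. Qed.

Lemma pcvgC z c : ccvg z c -> pcvg (fun n => (z n)%:MP) c%:MP.
Proof.
move=> zc; rewrite -[c%:MP]mulr1 mul_mpolyC.
under eq_fun do rewrite -[(z _)%:MP]mulr1 mul_mpolyC.
exact: pcvgZ zc (pcvg_cst _).
Qed.

Lemma pcvg_prod (I : Type) (r : seq I) (u : I -> nat -> P) (p : I -> P) :
  (forall i, pcvg (u i) (p i)) ->
  pcvg (fun n => \prod_(i <- r) u i n) (\prod_(i <- r) p i).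
Proof.
move=> up; elim: r => [|i r IH].
  by rewrite big_nil; under eq_fun do rewrite big_nil; exact: pcvg_cst.
by rewrite big_cons; under eq_fun do rewrite big_cons; exact: pcvgM.
Qed.

Lemma pcvg_unique u p q : pcvg u p -> pcvg u q -> p = q.
Proof. by move=> up uq; apply/mpolyP => a; exact: ccvg_unique (up a) (uq a). Qed.

Lemma mpoly_neq0P p : p != 0 -> exists a, p@_a != 0.
Proof.
move=> p0; apply: contrapT => /forallNP H; case/eqP: p0; apply/mpolyP => a.
by rewrite mcoeff0; apply/eqP; apply: contrapT => /negP; exact: H.
Qed.

Lemma pcvg_neq0 u p : p != 0 -> pcvg u p -> \forall n \near U, u n != 0.
Proof.
case/mpoly_neq0P => a pa up; apply: filterS (ccvg_neq0 pa (up a)) => n.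
by apply: contraNneq => ->; rewrite mcoeff0.
Qed.

Lemma ccvg_near z w c : (\forall n \near U, z n = w n) -> ccvg z c -> ccvg w c.
Proof.
move=> zw [zr zi]; split.
  by apply: cvg_trans zr; apply: near_eq_cvg; apply: filterS zw => n ->.
by apply: cvg_trans zi; apply: near_eq_cvg; apply: filterS zw => n ->.
Qed.

(** The scalars are read off at a nonzero coefficient of the limit p. *)
Lemma pcvg_scalars z u p q : pcvg u p -> p != 0 -> pcvg (fun n => z n *: u n) q ->
  exists2 c, ccvg z c & q = c *: p.
Proof.
move=> up /mpoly_neq0P[a pa] zq.
have zc : ccvg z (q@_a / p@_a).
  apply: ccvg_near (ccvgM (zq a) (ccvgV pa (up a))).
  apply: filterS (ccvg_neq0 pa (up a)) => n un.
  by rewrite mcoeffZ mulfK.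
by exists (q@_a / p@_a) => //; apply: (pcvg_unique zq); exact: pcvgZ.
Qed.

Lemma PP_msize d p : PP d p -> (msize p <= (mdeg d).+1)%N.
Proof.
move=> /PP_msupp dp; rewrite msizeE; apply/bigmax_leqP_seq => a /dp/mnm_lepP ad _.
by rewrite ltnS (mdegE a) (mdegE d); apply: leq_sum => i _; exact: ad.
Qed.

Lemma PP_closed d u p : (forall n, PP d (u n)) -> pcvg u p -> PP d p.
Proof.
move=> du up; apply/PP_coef => a ad; apply: (ccvg_unique (up a)).
under eq_fun => n do have /PP_coef/(_ a ad) -> := du n.
exact: ccvg_cst.
Qed.

Lemma cvg_big_sum (I : Type) (r : seq I) (f : I -> nat -> R) (g : I -> R) :
  (forall i, f i n @[n --> U] --> g i) ->
  \sum_(i <- r) f i n @[n --> U] --> \sum_(i <- r) g i.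
Proof.
move=> fg; elim: r => [|i r IH].
  by rewrite big_nil; under eq_fun do rewrite big_nil; exact: cvg_cst.
by rewrite big_cons; under eq_fun do rewrite big_cons; exact: cvgD.
Qed.

Lemma rdot_cvg d u v p q : (forall n, PP d (u n)) -> pcvg u p -> pcvg v q ->
  (fun n => rdot (u n) (v n)) @ U --> rdot p q.
Proof.
move=> du up vq; have dp := PP_closed du up.
have E (x y : P) : PP d x -> rdot x y = \sum_(a : 'X_{1..l < (mdeg d).+1})
    (complex.Re x@_a * complex.Re y@_a + complex.Im x@_a * complex.Im y@_a).
  move=> Px; have dx := PP_msize Px; rewrite /rdot (pdot_box _ dx) raddf_sum.
  apply: eq_bigr => a _; rewrite /= ReM; case: (x@_a) => r i /=; ring.
rewrite E //; under eq_fun => n do rewrite (E _ _ (du n)).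
apply: cvg_big_sum => a.
by apply: cvgD; apply: cvgM; [case: (up a)|case: (vq a)|case: (up a)|case: (vq a)].
Qed.

Lemma pnorm_cvg d u p : (forall n, PP d (u n)) -> pcvg u p ->
  (fun n => pnorm (u n)) @ U --> pnorm p.
Proof.
move=> du up; rewrite pnormE; under eq_fun do rewrite pnormE.
by apply: continuous_cvg; [exact: sqrt_continuous|exact: (rdot_cvg du up up)].
Qed.

Lemma pnorm_pcvg u p : (fun n => pnorm (u n - p)) @ U --> 0 -> pcvg u p.
Proof.
move=> up a.
have H (f : C -> R) : {morph f : x y / x - y} ->
    (forall q, `|f q@_a| <= pnorm q) -> (fun n => f (u n)@_a) @ U --> f p@_a.
  move=> fB fle.
  have N : (fun n => `|f (u n)@_a - f p@_a|) @ U --> (0 : R).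
    apply: (squeeze_cvgr _ (cvg_cst 0) up); apply: nearW => n.
    by rewrite normr_ge0 -fB -mcoeffB fle.
  exact: (proj1 (subr_cvg0 _ _) (norm_cvg0 N)).
by split; apply: H; [exact: raddfB|move=> q; case: (coef_le_pnorm q a)
  |exact: raddfB|move=> q; case: (coef_le_pnorm q a)].
Qed.

End Convergence.

Section Ultralimits.
Variables (R : realType) (l : nat) (U : set_system nat).
Context {FU : UltraFilter U}.
Local Notation P := (cpoly R l).

(** Bounded sequences converge along an ultrafilter: this replaces the
    extraction of subsequences. *)
Lemma ultralimit_real (x : nat -> R) (B : R) : (forall n, `|x n| <= B) ->
  exists y : R, x @ U --> y.
Proof.
move=> xB; have [|y [_ y_cluster]] := @segment_compact R (- B) B (x @ U) _.
  by apply: nearW => n /=; rewrite in_itv /= -ler_norml.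
exists y => V yV; case: (in_ultra_setVsetC (x @^-1` V) FU) => // UV.
by have [t [nVt Vt]] := y_cluster (~` V) V UV yV.
Qed.

Lemma ultralimit d (u : nat -> P) B : (forall n, PP d (u n)) ->
  (forall n, pnorm (u n) <= B) -> exists2 p, PP d p & pcvg U u p.
Proof.
move=> du uB.
have H a : exists c : R[i], ccvg U (fun n => (u n)@_a) c.
  have [x xE] : exists x : R, (fun n => complex.Re (u n)@_a) @ U --> x.
    by apply: (@ultralimit_real _ B) => n; apply: le_trans (uB n); case: (coef_le_pnorm (u n) a).
  have [y yE] : exists y : R, (fun n => complex.Im (u n)@_a) @ U --> y.
    by apply: (@ultralimit_real _ B) => n; apply: le_trans (uB n); case: (coef_le_pnorm (u n) a).
  by exists (x +i* y)%C.
have [c cE] := choice H.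
pose p : P := \sum_(a : 'X_{1..l < (mdeg d).+1}) c a *: 'X_[a].
have up : pcvg U u p.
  move=> a; have [ad|ad] := ltnP (mdeg a) (mdeg d).+1; first by rewrite mcoeff_mpoly.
  have p0 q : (msize q <= (mdeg d).+1)%N -> q@_a = 0 :> R[i].
    by move=> qd; apply: memN_msupp_eq0; apply: msize_mdeg_ge; exact: leq_trans ad.
  rewrite (p0 p); last first.
    rewrite msizeE; apply/bigmax_leqP_seq => b /msupp_sum_le.
    case/flattenP => _ /mapP[e _ ->]; rewrite /= => be _.
    have := msuppZ_le be; rewrite msuppX inE => /eqP->; exact: bmdeg.
  under eq_fun => n do rewrite (p0 _ (PP_msize (du n))).
  exact: ccvg_cst.
by exists p => //; exact: PP_closed up.
Qed.

End Ultralimits.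

(** * Stability of nearest products *)

Section ProductExpansion.
Variables (R : realType) (l : nat) (T : eqType).
Local Notation P := (cpoly R l).
Implicit Types (u v w : T -> P) (s t : R) (J : seq T).

(** The first order term of the product of the u j over J along the direction w,
    and, below, the remainder divided by the square of the step s. *)
Fixpoint prod_d1 u w J : P :=
  if J is j :: J' then u j * prod_d1 u w J' + w j * \prod_(i <- J') u i else 0.

Fixpoint prod_d2 u w s J : P :=
  if J is j :: J' then
    u j * prod_d2 u w s J' + w j * prod_d1 u w J' + s%:C%C *: (w j * prod_d2 u w s J')
  else 0.

Definition move_along u w s : T -> P := fun j => u j + s%:C%C *: w j.

Lemma prod_expansion u w s J :
  \prod_(j <- J) move_along u w s j =
  \prod_(j <- J) u j + s%:C%C *: (prod_d1 u w J + s%:C%C *: prod_d2 u w s J).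
Proof.
elim: J => [|j J IH] /=; first by rewrite !big_nil !scaler0 addr0 scaler0 addr0.
rewrite !big_cons IH /move_along -!mul_mpolyC; ring.
Qed.

Section ExpansionLimits.
Variables (U : set_system nat) (FU : ProperFilter U).
Variables (un wn : nat -> T -> P) (u w : T -> P) (sn : nat -> R) (s : R).
Hypothesis u_cvg : forall j, pcvg U (fun n => un n j) (u j).
Hypothesis w_cvg : forall j, pcvg U (fun n => wn n j) (w j).
Hypothesis s_cvg : sn @ U --> s.

Lemma prod_d1_cvg J : pcvg U (fun n => prod_d1 (un n) (wn n) J) (prod_d1 u w J).
Proof.
elim: J => [|j J IH] /=; first exact: pcvg_cst.
by apply: pcvgD; apply: pcvgM => //; exact: pcvg_prod.
Qed.

Lemma prod_d2_cvg J :
  pcvg U (fun n => prod_d2 (un n) (wn n) (sn n) J) (prod_d2 u w s J).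
Proof.
elim: J => [|j J IH] /=; first exact: pcvg_cst.
apply: pcvgD; first by apply: pcvgD; apply: pcvgM => //; exact: prod_d1_cvg.
by apply: pcvgZ; [exact: ccvg_real|exact: pcvgM].
Qed.

End ExpansionLimits.
End ProductExpansion.

(** Multiplying by the product of the distinct factors makes the derivative
    divisible by the product itself, which removes the repeated factors. *)
Lemma prod_d1E (R : realType) (l : nat) (T : finType) (u w : T -> cpoly R l)
    (J : seq T) :
  (\prod_k u k) * prod_d1 u w J =
  \prod_(j <- J) u j * \sum_(j <- J) w j * \prod_(k | k != j) u k.
Proof.
elim: J => [|j J IH] /=; first by rewrite !big_nil !mulr0.
by rewrite !big_cons mulrDr mulrCA IH (bigD1 j) //=; ring.
Qed.

(** The second property says that U is free, in the form in which it is used. *)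
Lemma ultra_harmonic (R : realType) : exists U : set_system nat,
  UltraFilter U /\ (@harmonic R) @ U --> (0 : R).
Proof.
have [U [FU subU]] := ultraFilterLemma (eventually_filter : ProperFilter \oo).
exists U; split=> // V V0; apply: subU; exact: (@cvg_harmonic R V V0).
Qed.

Section NearestPoint.
Variables (R : realType) (l : nat).
Local Notation P := (cpoly R l).

Lemma PPZ d (c : R[i]) (p : P) : PP d p -> PP d (c *: p).
Proof. by rewrite !PP_coef => dp a ad; rewrite mcoeffZ dp ?mulr0. Qed.

Lemma PPD d (p q : P) : PP d p -> PP d q -> PP d (p + q).
Proof. by rewrite !PP_coef => dp dq a ad; rewrite mcoeffD dp ?dq ?addr0. Qed.

Lemma PPN d (p : P) : PP d p -> PP d (- p).
Proof. by rewrite -scaleN1r; exact: PPZ. Qed.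

Lemma PPB d (p q : P) : PP d p -> PP d q -> PP d (p - q).
Proof. by move=> dp /PPN; exact: PPD. Qed.

Lemma PPM d e (p q : P) : PP d p -> PP e q -> PP (d + e)%MM (p * q).
Proof.
rewrite !PP_msupp => dp eq a /msuppM_le/allpairsP[[b c] /= [/dp/mnm_lepP bd /eq/mnm_lepP ce ->]].
by apply/mnm_lepP => i; rewrite !mnmDE leq_add.
Qed.

Lemma PP_prod (I : Type) (r : seq I) (dg : I -> 'X_{1..l}) (u : I -> P) :
  (forall i, PP (dg i) (u i)) -> PP (\sum_(i <- r) dg i)%MM (\prod_(i <- r) u i).
Proof.
move=> du; elim: r => [|i r IH]; last by rewrite !big_cons; exact: PPM.
by rewrite !big_nil -mpolyC1 /PP /= multidegC; apply/mnm_lepP.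
Qed.

Variables (T : finType) (J : seq T) (dg : T -> 'X_{1..l}).
Let m : 'X_{1..l} := (\sum_(j <- J) dg j)%MM.
Implicit Types (f g : P) (u v w : T -> P).
Local Notation Phi u := (\prod_(j <- J) u j).

Lemma pnorm_le_move (e y : P) (t : R) : 0 < t ->
  pnorm e <= pnorm (e - t%:C%C *: y) -> rdot e y <= t * 2^-1 * rdot y y.
Proof.
move=> t0; rewrite -(@ler_pXn2r _ 2) ?nnegrE ?pnorm_ge0 // !sqr_pnorm.
rewrite rdotBl !rdotBr !rdotZl !rdotZr (rdotC e) => H.
by rewrite -(ler_pM2l t0); nra.
Qed.

(** Compare f with the points at distance s / (n + 1) along w, and divide by this
    step. *)
Lemma first_order f u w (s : R) : 0 < s -> PP m f ->
  (forall j, PP (dg j) (u j)) -> (forall j, PP (dg j) (w j)) ->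
  (forall t, 0 <= t <= s -> pnorm (f - Phi u) <= pnorm (f - Phi (move_along u w t))) ->
  rdot (f - Phi u) (prod_d1 u w J) <= 0.
Proof.
move=> s0 fm um wm fmin; set e := f - Phi u.
have em : PP m e by apply: PPB => //; exact: PP_prod.
pose t n : R := s * harmonic n.
have t0 n : 0 < t n by rewrite mulr_gt0 // /harmonic invr_gt0.
have ts n : 0 <= t n <= s.
  rewrite ltW //= /t -{2}[s]mulr1 ler_pM2l // /harmonic invf_le1 // ler1n //.
have t_cvg : t @ \oo --> (0 : R).
  by rewrite -(mulr0 s); apply: cvgM; [exact: cvg_cst|exact: cvg_harmonic].
pose Y n : P := prod_d1 u w J + (t n)%:C%C *: prod_d2 u w (t n) J.
have Y_cvg : pcvg \oo Y (prod_d1 u w J).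
  rewrite -[prod_d1 u w J]addr0 -(scale0r (prod_d2 u w 0 J)).
  apply: pcvgD; first exact: pcvg_cst.
  apply: pcvgZ; first exact: ccvg_real.
  by apply: prod_d2_cvg => // j; exact: pcvg_cst.
have YE n : Y n = ((t n)^-1)%:C%C *: (Phi (move_along u w (t n)) - Phi u).
  rewrite prod_expansion addrAC subrr add0r scalerA -rmorphM mulVf ?scale1r //.
  by rewrite gt_eqF.
have Ym n : PP m (Y n).
  rewrite YE; apply: PPZ; apply: PPB; apply: PP_prod => // j.
  by apply: PPD => //; exact: PPZ.
have ineq n : rdot e (Y n) <= t n * 2^-1 * rdot (Y n) (Y n).
  have := fmin (t n) (ts n).
  have -> : f - Phi (move_along u w (t n)) = e - (t n)%:C%C *: Y n.
    by rewrite prod_expansion opprD addrA.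
  exact: pnorm_le_move.
apply: (@ler_cvg_to _ \oo _ R (fun n => rdot e (Y n))
  (fun n => t n * 2^-1 * rdot (Y n) (Y n))).
- exact: (@rdot_cvg _ _ _ _ m (fun=> e) Y _ _ (fun=> em) (@pcvg_cst _ _ _ _ e) Y_cvg).
- rewrite -(mul0r (rdot (prod_d1 u w J) (prod_d1 u w J))) -(mul0r (2^-1)).
  apply: cvgM; last exact: (rdot_cvg Ym Y_cvg Y_cvg).
  by apply: cvgM => //; exact: cvg_cst.
- exact: nearW.
Qed.

(** The optimality conditions at u and at v are added: the first order terms
    are nonpositive, and the second order terms are multiplied by the residuals,
    which are small. *)
Lemma second_order f g u w (s : R) (v := move_along u w s) (h := (s^-1)%:C%C *: (f - g))
    (X := prod_d1 u w J + s%:C%C *: prod_d2 u w s J) :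
  0 < s -> PP m f -> PP m g ->
  (forall j, PP (dg j) (u j)) -> (forall j, PP (dg j) (w j)) ->
  (forall t, 0 <= t <= s -> pnorm (f - Phi u) <= pnorm (f - Phi (move_along u w t))) ->
  (forall t, 0 <= t <= s ->
     pnorm (g - Phi v) <= pnorm (g - Phi (move_along v (fun j => - w j) t))) ->
  rdot X X <= rdot (f - Phi u) (prod_d2 u w s J)
    + rdot (g - Phi v) (prod_d2 v (fun j => - w j) s J) - rdot h X.
Proof.
move=> s0 fm gm um wm fmin gmin.
have vm j : PP (dg j) (v j) by apply: PPD => //; exact: PPZ.
have Nwm j : PP (dg j) (- w j) by exact: PPN.
have H1 := first_order s0 fm um wm fmin.
have H2 := first_order s0 gm vm Nwm gmin.
have sX : Phi v - Phi u = s%:C%C *: X by rewrite prod_expansion addrAC subrr add0r.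
pose X' := prod_d1 v (fun j => - w j) J + s%:C%C *: prod_d2 v (fun j => - w j) s J.
have XX' : X' = - X.
  have : Phi u - Phi v = s%:C%C *: X'.
    transitivity (Phi (move_along v (fun j => - w j) s) - Phi v).
      congr (_ - _); apply: eq_bigr => j _.
      by rewrite /v /move_along scalerN addrK.
    by rewrite prod_expansion addrAC subrr add0r.
  rewrite -opprB sX -scalerN => /scalerI -> //.
  by rewrite fmorph_eq0 gt_eqF.
have E1 : rdot (f - Phi u) X <= s * rdot (f - Phi u) (prod_d2 u w s J).
  by rewrite rdotDr rdotZr gerDr.
have E2 : - rdot (g - Phi v) X <= s * rdot (g - Phi v) (prod_d2 v (fun j => - w j) s J).
  by rewrite -rdotNr -XX' rdotDr rdotZr gerDr.
have E3 : s * rdot h X = rdot (f - g) X.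
  by rewrite /h rdotZl mulrA mulfV ?mul1r ?gt_eqF.
have E4 : rdot (f - Phi u) X - rdot (g - Phi v) X = rdot (f - g) X + s * rdot X X.
  rewrite -rdotZl -sX -rdotBl -rdotDl; congr (rdot _ _).
  by rewrite opprB !addrA; ring.
by rewrite -(ler_pM2l s0); lra.
Qed.

Variables (u0 : T -> P) (mk : T -> option 'X_{1..l}).
Local Notation f0 := (Phi u0).

(** Directions of the parameter space: the scale of a factor is pinned by
    freezing one of its coefficients. *)
Definition slice (t : T) (w : P) : Prop :=
  PP (dg t) w /\ (if mk t is Some a then w@_a = 0 else True).

Hypothesis d1_inj : forall w, (forall t, slice t (w t)) ->
  prod_d1 u0 w J = 0 -> forall t, w t = 0.

Definition close_pair (rho : R) f g u v : Prop :=
  [/\ PP m f /\ PP m g, forall t, PP (dg t) (u t), forall t, slice t (v t - u t),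
      pnorm (f - f0) < rho /\ pnorm (g - f0) < rho
    & forall t, pnorm (u t - u0 t) < rho /\ pnorm (v t - u0 t) < rho].

Definition segment_min f u v : Prop := forall x : R, 0 <= x <= 1 ->
  pnorm (f - Phi u) <= pnorm (f - Phi (move_along u (fun t => v t - u t) x)).

Lemma segment_min_scale f u v (s : R) : 0 < s -> segment_min f u v ->
  forall t, 0 <= t <= s -> pnorm (f - Phi u) <=
    pnorm (f - Phi (move_along u (fun j => (s^-1)%:C%C *: (v j - u j)) t)).
Proof.
move=> s0 H t /andP[t0 ts]; have := H (t / s).
rewrite divr_ge0 ?(ltW s0) // ler_pdivrMr // mul1r ts => /(_ isT).
congr (_ <= pnorm (_ - _)); apply: eq_bigr => j _.
by rewrite /move_along scalerA -rmorphM.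
Qed.

(** The factors of nearest points depend in a Lipschitz way on the data. In a
    sequence of counterexamples, the rescaled displacements converge to a unit
    direction w; the first order conditions at both points force the
    derivative of the product at u0 along w to vanish. *)
Theorem nearest_stability : exists rho L : R, [/\ 0 < rho, 0 < L &
  forall f g u v, close_pair rho f g u v -> segment_min f u v -> segment_min g v u ->
    forall t, pnorm (u t - v t) <= L * pnorm (f - g)].
Proof.
apply: contrapT => H.
have {H} /choice[x xP] : forall n, exists x : (P * P) * ((T -> P) * (T -> P)),
    [/\ close_pair (harmonic n) x.1.1 x.1.2 x.2.1 x.2.2,
        segment_min x.1.1 x.2.1 x.2.2, segment_min x.1.2 x.2.2 x.2.1
      & exists t, n.+1%:R * pnorm (x.1.1 - x.1.2) < pnorm (x.2.1 t - x.2.2 t)].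
  move=> n; apply: contrapT => Hn; apply: H; exists (harmonic n), n.+1%:R; split => //.
    by rewrite /harmonic invr_gt0.
  move=> f g u v near minf ming t; rewrite leNgt; apply/negP => lt_n.
  by apply: Hn; exists ((f, g), (u, v)); split=> //; exists t.
pose f n := (x n).1.1; pose g n := (x n).1.2.
pose u n := (x n).2.1; pose v n := (x n).2.2.
have [U [FU U_harm]] := @ultra_harmonic R.
pose s n := \sum_t pnorm (v n t - u n t).
have s_gt n : n.+1%:R * pnorm (f n - g n) < s n.
  have [_ _ _ [t ht]] := xP n; apply: lt_le_trans ht _.
  rewrite /s (bigD1 t) //= pnormB lerDl; apply: sumr_ge0 => *; exact: pnorm_ge0.
have s0 n : 0 < s n.
  by apply: le_lt_trans (s_gt n); rewrite mulr_ge0 ?pnorm_ge0.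
pose w n t := ((s n)^-1)%:C%C *: (v n t - u n t).
have w_sum n : \sum_t pnorm (w n t) = 1.
  under eq_bigr do rewrite pnormZr ?invr_ge0 ?(ltW (s0 n)) //.
  by rewrite -mulr_sumr mulVf // gt_eqF.
have w_slice n t : slice t (w n t).
  have [[_ _ /(_ t)[vu vu0] _ _] _ _ _] := xP n; split; first exact: PPZ.
  by case: (mk t) vu0 => // a vu0; rewrite mcoeffZ vu0 mulr0.
have w_le1 n t : pnorm (w n t) <= 1.
  rewrite -(w_sum n) (bigD1 t) //= lerDl; apply: sumr_ge0 => *; exact: pnorm_ge0.
have /choice[y yP] : forall t, exists y, PP (dg t) y /\ pcvg U (fun n => w n t) y.
  move=> t.
  have [n|n|p ? ?] := @ultralimit _ _ U FU (dg t) (fun n => w n t) 1.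
  - by case: (w_slice n t).
  - exact: w_le1.
  - by exists p.
have y_sum : \sum_t pnorm (y t) = 1.
  have H : (fun n => \sum_t pnorm (w n t)) @ U --> \sum_t pnorm (y t).
    apply: cvg_big_sum => t; apply: (@pnorm_cvg _ _ _ _ (dg t)); last by case: (yP t).
    by move=> n; case: (w_slice n t).
  have E : (fun n => \sum_t pnorm (w n t)) = fun=> 1 by apply/funext.
  have C1 : (fun=> 1 : R) @ U --> (1 : R) by exact: cvg_cst.
  by rewrite E in H; rewrite (cvg_unique _ H C1).
have small (z : nat -> P) p : (forall n, pnorm (z n - p) <= harmonic n) -> pcvg U z p.
  move=> zp; apply: pnorm_pcvg; apply: (squeeze_cvgr _ (cvg_cst 0) U_harm).
  by apply: nearW => n; rewrite pnorm_ge0 zp.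
have uv_cvg t : pcvg U (fun n => u n t) (u0 t) /\ pcvg U (fun n => v n t) (u0 t).
  split; apply: small => n; have [[_ _ _ _ /(_ t)[un vn]] _ _ _] := xP n; exact: ltW.
have f_cvg : pcvg U f f0 /\ pcvg U g f0.
  split; apply: small => n; have [[_ _ _ [fn gn] _] _ _ _] := xP n; exact: ltW.
have s_cvg : s @ U --> (0 : R).
  rewrite (_ : 0 = \sum_(t : T) 0); last by rewrite big1.
  apply: cvg_big_sum => t; rewrite -(@pnorm0 R l).
  apply: (@pnorm_cvg _ _ _ _ (dg t)); first by move=> n; have [[_ _ /(_ t)[]]] := xP n.
  by rewrite -(subrr (u0 t)); case: (uv_cvg t) => *; exact: pcvgB.
have vE n : v n =1 move_along (u n) (w n) (s n).
  move=> t; rewrite /move_along /w scalerA -rmorphM mulfV ?gt_eqF // scale1r.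
  by rewrite addrC subrK.
have PhiE n : Phi (v n) = Phi (move_along (u n) (w n) (s n)).
  by apply: eq_bigr => j _; rewrite vE.
have vfun n : move_along (u n) (w n) (s n) = v n by apply/funext => t; rewrite vE.
have Nw n : (fun t => - w n t) = (fun t => ((s n)^-1)%:C%C *: (u n t - v n t)).
  by apply/funext => t; rewrite -scalerN opprB.
have fg_deg n : PP m (f n) /\ PP m (g n) by have [[]] := xP n.
have u_deg n t : PP (dg t) (u n t) by have [[]] := xP n.
have w_deg n t : PP (dg t) (w n t) by case: (w_slice n t).
have v_deg n t : PP (dg t) (v n t).
  by rewrite -vfun; apply: PPD => //; exact: PPZ.
pose h n := ((s n)^-1)%:C%C *: (f n - g n).
pose X n := prod_d1 (u n) (w n) J + (s n)%:C%C *: prod_d2 (u n) (w n) (s n) J.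
pose e n := f n - Phi (u n); pose e' n := g n - Phi (v n).
pose E n := prod_d2 (u n) (w n) (s n) J.
pose E' n := prod_d2 (v n) (fun t => - w n t) (s n) J.
have ineq n : rdot (X n) (X n) <= rdot (e n) (E n) + rdot (e' n) (E' n) - rdot (h n) (X n).
  have [_ minf ming _] := xP n.
  have minf' := segment_min_scale (s0 n) minf.
  have ming' t : 0 <= t <= s n -> pnorm (g n - Phi (move_along (u n) (w n) (s n))) <=
      pnorm (g n - Phi (move_along (move_along (u n) (w n) (s n)) (fun j => - w n j) t)).
    by rewrite vfun Nw; exact: (segment_min_scale (s0 n) ming).
  have [fm gm] := fg_deg n.
  have := second_order (s0 n) fm gm (u_deg n) (w_deg n) minf' ming'.
  by rewrite vfun.
have [fc gc] := f_cvg.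
have uc t : pcvg U (fun n => u n t) (u0 t) by case: (uv_cvg t).
have vc t : pcvg U (fun n => v n t) (u0 t) by case: (uv_cvg t).
have wc t : pcvg U (fun n => w n t) (y t) by case: (yP t).
have ec : pcvg U e 0 by rewrite -(subrr f0); apply: pcvgB => //; exact: pcvg_prod.
have ec' : pcvg U e' 0 by rewrite -(subrr f0); apply: pcvgB => //; exact: pcvg_prod.
have em n : PP m (e n) by apply: PPB; [case: (fg_deg n)|exact: PP_prod].
have em' n : PP m (e' n) by apply: PPB; [case: (fg_deg n)|exact: PP_prod].
have hm n : PP m (h n) by apply: PPZ; apply: PPB; case: (fg_deg n).
have hc : pcvg U h 0.
  apply: small => n; rewrite subr0 pnormZr ?invr_ge0 ?(ltW (s0 n)) //.
  by rewrite ler_pdivrMl // ler_pdivlMr // mulrC ltW.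
have Xc : pcvg U X (prod_d1 u0 y J).
  rewrite -[prod_d1 u0 y J]addr0 -(scale0r (prod_d2 u0 y 0 J)); apply: pcvgD.
    exact: prod_d1_cvg.
  by apply: pcvgZ; [exact: ccvg_real|exact: prod_d2_cvg].
have Xm n : PP m (X n).
  have -> : X n = ((s n)^-1)%:C%C *: (Phi (v n) - Phi (u n)).
    rewrite PhiE prod_expansion addrAC subrr add0r scalerA -rmorphM mulVf ?scale1r //.
    by rewrite gt_eqF.
  by apply: PPZ; apply: PPB; exact: PP_prod.
have Ec : pcvg U E (prod_d2 u0 y 0 J) by exact: prod_d2_cvg.
have Ec' : pcvg U E' (prod_d2 u0 (fun t => - y t) 0 J).
  by apply: prod_d2_cvg => // t; exact: pcvgN.
have rdot0 p : rdot (0 : P) p = 0 by rewrite /rdot /pdot msupp0 big_nil.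
have D_le0 : rdot (prod_d1 u0 y J) (prod_d1 u0 y J) <= 0.
  apply: (@ler_cvg_to _ U _ R (fun n => rdot (X n) (X n)) (fun n =>
    rdot (e n) (E n) + rdot (e' n) (E' n) - rdot (h n) (X n))).
  - exact: (rdot_cvg Xm Xc Xc).
  - have -> : (0 : R) = rdot 0 (prod_d2 u0 y 0 J) + rdot 0 (prod_d2 u0 (fun t => - y t) 0 J)
        - rdot 0 (prod_d1 u0 y J) by rewrite !rdot0 subr0 addr0.
    apply: cvgB; first by apply: cvgD; [exact: (rdot_cvg em ec Ec)|exact: (rdot_cvg em' ec' Ec')].
    exact: (rdot_cvg hm hc Xc).
  - exact: nearW.
have D0 : prod_d1 u0 y J = 0.
  by apply/eqP; rewrite -pnorm_eq0 -sqrf_eq0 sqr_pnorm eq_le D_le0 rdot_ge0.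
have y_slice t : slice t (y t).
  split; first by case: (yP t).
  have w0 n := proj2 (w_slice n t).
  case: (mk t) w0 => // a w0; apply: (ccvg_unique (wc t a)).
  by under eq_fun do rewrite w0; exact: ccvg_cst.
have /eqP := y_sum; rewrite big1 ?(eq_sym 0) ?oner_eq0 // => t _.
by rewrite (d1_inj y_slice D0) pnorm0.
Qed.

End NearestPoint.

(** * Limits of factors *)

Section LimitsOfFactors.
Variables (R : realType) (l : nat) (U : set_system nat).
Context {FU : UltraFilter U}.
Local Notation P := (cpoly R l).

(** Normalized factors range over unit spheres, which are compact; the scalars
    then converge because the product of the limits is nonzero. *)
Lemma factor_limits (T : eqType) (J : seq T) (dg : T -> 'X_{1..l}) (z : nat -> R[i])
    (u : nat -> T -> P) (f : P) :
  (forall n t, PP (dg t) (u n t)) -> (forall n t, u n t != 0) ->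
  pcvg U (fun n => z n *: \prod_(j <- J) u n j) f ->
  exists (c : nat -> T -> R[i]) (G : T -> P) (be : R[i]),
  [/\ forall n t, c n t != 0, forall t, PP (dg t) (G t), forall t, G t != 0,
      forall t, pcvg U (fun n => c n t *: u n t) (G t)
    & f = be *: \prod_(j <- J) G j].
Proof.
move=> udg u0 fc.
pose c n t := ((pnorm (u n t))^-1)%:C%C.
have c0 n t : c n t != 0 by rewrite fmorph_eq0 invr_eq0 pnorm_eq0.
have cdg n t : PP (dg t) (c n t *: u n t) by exact: PPZ.
have c1 n t : pnorm (c n t *: u n t) = 1 by exact: pnormalize.
have /choice[G GP] : forall t, exists p, PP (dg t) p /\ pcvg U (fun n => c n t *: u n t) p.
  move=> t; have [n|n|p ? ?] := @ultralimit _ _ U FU (dg t) (fun n => c n t *: u n t) 1.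
  - exact: cdg.
  - by rewrite c1.
  - by exists p.
have Gdg t : PP (dg t) (G t) by case: (GP t).
have Gc t : pcvg U (fun n => c n t *: u n t) (G t) by case: (GP t).
have G0 t : G t != 0.
  have H : (fun n => pnorm (c n t *: u n t)) @ U --> pnorm (G t).
    exact: (pnorm_cvg (cdg^~ t) (Gc t)).
  have E : (fun n => pnorm (c n t *: u n t)) = fun=> 1 by apply/funext.
  have C1 : (fun=> 1 : R) @ U --> (1 : R) by exact: cvg_cst.
  have G1 : pnorm (G t) = 1 by rewrite E in H; rewrite (cvg_unique _ H C1).
  by rewrite -pnorm_eq0 G1 oner_eq0.
have PG0 : \prod_(j <- J) G j != 0.
  by rewrite prodf_seq_neq0; apply/allP => j _; rewrite G0.
have zc : pcvg U (fun n => (z n * (\prod_(j <- J) c n j)^-1) *: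
    \prod_(j <- J) (c n j *: u n j)) f.
  have -> : (fun n => (z n * (\prod_(j <- J) c n j)^-1) *: \prod_(j <- J) (c n j *: u n j))
      = fun n => z n *: \prod_(j <- J) u n j; last exact: fc.
  apply/funext => n; rewrite scaler_prod scalerA divfK //.
  by rewrite prodf_seq_neq0; apply/allP => j _; rewrite c0.
have [be _ fE] := pcvg_scalars (pcvg_prod J Gc) PG0 zc.
by exists c, G, be.
Qed.

(** A coefficient where the degree in a variable is attained stays nonzero. *)
Lemma near_multideg (u : nat -> P) q : (forall n, PP (multideg q) (u n)) ->
  pcvg U u q -> \forall n \near U, multideg (u n) = multideg q.
Proof.
move=> uq uc; have [q0|q0] := eqVneq q 0.
  apply: nearW => n; apply/mnmP => i; apply/eqP; have /mnm_lepP/(_ i) := uq n.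
  by rewrite q0 -mpolyC0 multidegC mnm0E leqn0.
suff : \forall n \near U, forall i : 'I_l, (multideg q i <= multideg (u n) i)%N.
  apply: filterS => n H; apply/mnmP => i; apply/eqP; rewrite eqn_leq H andbT.
  by have /mnm_lepP/(_ i) := uq n.
apply: filter_forall => i.
have [a qa ->] := multideg_attained i q0; rewrite mcoeff_msupp in qa.
apply: filterS (ccvg_neq0 qa (uc a)) => n; rewrite -mcoeff_msupp => an.
by have /PP_msupp/(_ a an)/mnm_lepP := PP_multideg (u n).
Qed.


(** A limit of reducible polynomials of a fixed multidegree is reducible, by
    taking limits of normalized factors. *)
Lemma irreducible_open_seq (u : nat -> P) q : irreducible q ->
  (forall n, PP (multideg q) (u n)) -> pcvg U u q ->
  \forall n \near U, irreducible (u n) /\ multideg (u n) = multideg q.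
Proof.
move=> qI uq uc; have [q0 qU qirr] := qI; set d := multideg q in uq *.
have udeg := near_multideg uq uc; rewrite -/d in udeg.
have un0 : \forall n \near U, u n != 0 by exact: pcvg_neq0 uc.
have [//|bad] := in_ultra_setVsetC [set n | irreducible (u n) /\ multideg (u n) = d] FU.
exfalso.
pose B n := [/\ ~ irreducible (u n), multideg (u n) = d & u n != 0].
have UB : \forall n \near U, B n.
  apply: filterS (filterI bad (filterI udeg un0)) => n [/not_andP nI [ud u0]].
  by split=> //; case: nI.
have /choice[x xP] : forall n, exists x : bool -> P,
    [/\ forall b, PP d (x b), forall b, x b != 0
      & B n -> u n = x true * x false /\ forall b, x b \isn't a GRing.unit].
  move=> n; have [[nI ud u0]|nB] := pselect (B n); last first.
    exists (fun=> 1); split=> //; last by move=> b; exact: oner_neq0.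
    by move=> _; rewrite /PP /= -mpolyC1 multidegC; apply/mnm_lepP => i; rewrite mnm0E.
  have [|nUu] := boolP (u n \is a GRing.unit).
    rewrite mpoly_unitE => /eqP s1; have := irreducible_multideg qI.
    by rewrite -/d -ud multideg_eq0 s1.
  have [a [b [uE aU bU]]] : exists a b, [/\ u n = a * b,
      a \isn't a GRing.unit & b \isn't a GRing.unit].
    apply: contrapT => H; apply: nI; split=> // a b uE.
    have [|aU] := boolP (a \is a GRing.unit); first by left.
    have [|bU] := boolP (b \is a GRing.unit); first by right.
    by case: H; exists a, b.
  have a0 : a != 0 by apply: contraNneq u0 => a0; rewrite uE a0 mul0r.
  have b0 : b != 0 by apply: contraNneq u0 => b0; rewrite uE b0 mulr0.
  have dE : d = (multideg a + multideg b)%MM by rewrite -multidegM // -uE.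
  exists (fun c : bool => if c then a else b); split=> [[]|[]|_] //.
  - by rewrite /PP /= dE; apply/mnm_lepP => i; rewrite mnmDE leq_addr.
  - by rewrite /PP /= dE; apply/mnm_lepP => i; rewrite mnmDE leq_addl.
  - by split=> // -[].
have xc : pcvg U (fun n => 1 *: \prod_(b <- [:: true; false]) x n b) q.
  move=> a; apply: ccvg_near (uc a); apply: filterS UB => n nB.
  by have [_ _ /(_ nB)[-> _]] := xP n; rewrite scale1r big_cons big_seq1.
have [||c [G [be [c0 Gd G0 Gc qE]]]] := @factor_limits _ [:: true; false] (fun=> d) _ x _ _ _ xc.
- by move=> n b; have [] := xP n.
- by move=> n b; have [] := xP n.
have be0 : be != 0 by apply: contraNneq q0 => be0; rewrite qE be0 scale0r.
rewrite big_cons big_seq1 in qE.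
have GU b : G b \isn't a GRing.unit.
  apply/negP; rewrite mpoly_unitE => /eqP s1.
  have dG : multideg (G b) = 0%MM by apply/eqP; rewrite multideg_eq0 s1.
  have dN : multideg (G (~~ b)) = d.
    rewrite /d qE multidegZ // multidegM //.
    by case: b dG {s1} => /= ->; rewrite ?add0m ?addm0.
  have H : \forall n \near U, multideg (c n (~~ b) *: x n (~~ b)) = d.
    rewrite -dN; apply: near_multideg; last exact: Gc.
    by move=> n; rewrite dN; apply: PPZ; have [] := xP n.
  have [n [nB nd]] := filter_ex (filterI UB H).
  have [_ x0 /(_ nB)[uE xU]] := xP n; have [_ ud _] := nB.
  rewrite multidegZ // in nd; case/negP: (xU b); rewrite mpoly_unitE.
  have : multideg (x n b) == 0%MM.
    have : (multideg (x n b) + multideg (x n (~~ b)))%MM = d.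
      by rewrite -ud uE multidegM //; case: (b); rewrite //= addmC.
    rewrite nd => E; apply/eqP/mnmP => i; move/mnmP/(_ i): E.
    by rewrite mnmDE mnm0E => /eqP; rewrite -{2}[d i]add0n eqn_add2r => /eqP.
  by rewrite multideg_eq0 eqn_leq => -> /=; rewrite lt0n msize_poly_eq0 x0.
have := qirr (be *: G true) (G false); rewrite -scalerAl => /(_ qE).
by rewrite -mul_mpolyC unitrM (negPf (GU true)) (negPf (GU false)) andbF => -[].
Qed.

End LimitsOfFactors.

(** * The factorization manifold near one of its points *)

Section Openness.
Variables (R : realType) (l : nat).
Local Notation P := (cpoly R l).

(** Uniform bounds by contradiction, with an ultrafilter at hand. *)
Lemma ultra_bound (X : Type) (F : X -> R) (A Q : X -> Prop) :
  (forall U : set_system nat, UltraFilter U -> (@harmonic R) @ U --> (0 : R) ->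
     forall x : nat -> X, (forall n, A (x n)) -> (forall n, F (x n) < harmonic n) ->
     exists n, Q (x n)) ->
  exists2 rho : R, 0 < rho & forall x, A x -> F x < rho -> Q x.
Proof.
move=> H; apply: contrapT => Hn.
have /choice[x xP] : forall n, exists x, [/\ A x, F x < harmonic n & ~ Q x].
  move=> n; apply: contrapT => Hx; apply: Hn; exists (harmonic n).
    by rewrite /harmonic invr_gt0.
  by move=> x Ax Fx; apply: contrapT => Qx; apply: Hx; exists x.
have [U [FU U0]] := @ultra_harmonic R.
have [n|n|n Qn] := H U FU U0 x; first by case: (xP n).
  by case: (xP n).
by case: (xP n).
Qed.

Lemma pcvg_small (U : set_system nat) (FU : UltraFilter U) (u : nat -> P) p :
  (@harmonic R) @ U --> (0 : R) -> (forall n, pnorm (u n - p) <= harmonic n) -> pcvg U u p.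
Proof.
move=> U0 up; apply: pnorm_pcvg; apply: (squeeze_cvgr _ (cvg_cst 0) U0).
by apply: nearW => n; rewrite pnorm_ge0 up.
Qed.

Lemma irreducible_open q : irreducible q -> exists2 rho : R, 0 < rho &
  forall v : P, PP (multideg q) v -> pnorm (v - q) < rho ->
    irreducible v /\ multideg v = multideg q.
Proof.
move=> qI; apply: (ultra_bound (F := fun v => pnorm (v - q))) => U FU U0 v vd vq.
have vc : pcvg U v q by apply: pcvg_small => // n; exact: ltW.
exact: (filter_ex (irreducible_open_seq qI vd vc)).
Qed.

(** Irreducible polynomials that are not coprime are associate, a relation that
    passes to limits. *)
Lemma coprime_open q1 q2 : irreducible q1 -> irreducible q2 -> ~ assoc q1 q2 ->
  exists2 rho : R, 0 < rho & forall u v : P, irreducible u -> irreducible v ->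
    pnorm (u - q1) < rho -> pnorm (v - q2) < rho -> mcoprime u v.
Proof.
move=> q1I q2I q12.
have [rho rho0 H] : exists2 rho : R, 0 < rho & forall x : P * P,
    irreducible x.1 /\ irreducible x.2 ->
    Num.max (pnorm (x.1 - q1)) (pnorm (x.2 - q2)) < rho -> mcoprime x.1 x.2.
  apply: ultra_bound => U FU U0 x xI xlt; apply: contrapT => /forallNP nc.
  have /choice[c cP] n : exists c : R[i], (x n).1 = c *: (x n).2.
    have [I1 I2] := xI n.
    by have [c _ cE] := irreducible_not_coprime I1 I2 (nc n); exists c.
  have c1 : pcvg U (fun n => (x n).1) q1.
    apply: pcvg_small => // n; apply: le_trans (ltW (xlt n)).
    by rewrite le_max lexx.
  have c2 : pcvg U (fun n => (x n).2) q2.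
    apply: pcvg_small => // n; apply: le_trans (ltW (xlt n)).
    by rewrite le_max lexx orbT.
  have q20 : q2 != 0 by case: q2I.
  have q10 : q1 != 0 by case: q1I.
  have c1' : pcvg U (fun n => c n *: (x n).2) q1.
    by under eq_fun do rewrite -cP; exact: c1.
  have [a _ aE] := pcvg_scalars c2 q20 c1'; apply: q12; exists a => //.
  by apply: contraNneq q10 => a0; rewrite aE a0 scale0r.
exists rho => // u v uI vI ud vd.
by apply: (H (u, v)) => //; rewrite gt_max ud vd.
Qed.

Lemma fin_min_pos (I : finType) (Q : I -> R -> Prop) :
  (forall i r r', r' <= r -> Q i r -> Q i r') -> (forall i, exists2 r, 0 < r & Q i r) ->
  exists2 r, 0 < r & forall i, Q i r.
Proof.
move=> Qmon Qex.
have [r r0 H] : exists2 r, 0 < r & forall i, i \in enum I -> Q i r.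
  elim: (enum I) => [|i s [r r0 H]]; first by exists 1; rewrite ?ltr01.
  have [r' r'0 H'] := Qex i.
  exists (Num.min r r'); first by rewrite lt_min r0.
  move=> j; rewrite in_cons => /orP[/eqP->|js].
    by apply: Qmon H'; rewrite ge_min lexx orbT.
  by apply: Qmon (H j js); rewrite ge_min lexx.
by exists r => // i; apply: H; rewrite mem_enum.
Qed.

End Openness.

Section FactorManifold.
Variables (R : realType) (l : nat).
Local Notation P := (cpoly R l).
Implicit Types (M N : fstructure l).

Lemma fs_prod_indices M (c : R[i]) (g : 'I_(size M) -> P) :
  fs_prod c g = c *: \prod_(j <- fs_indices M) g j.
Proof. by rewrite fs_indices_prod. Qed.

(** The closure of a factorization manifold, within the polynomials of its
    degree, consists of products of the same shape whose factors may be
    reducible or share divisors. *)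
Lemma FM_limit N (U : set_system nat) (FU : UltraFilter U) (g : nat -> P) f :
  is_structure R N -> (forall n, FM N (g n)) -> pcvg U g f -> f != 0 ->
  fs_deg N = multideg f ->
  exists (a : nat -> R[i]) (h : nat -> 'I_(size N) -> P) (c : nat -> 'I_(size N) -> R[i])
    (G : 'I_(size N) -> P) (be : R[i]),
  [/\ (forall n, fs_factors (h n) /\ g n = fs_prod (a n) (h n)),
      (forall n j, c n j != 0), (forall j, pcvg U (fun n => c n j *: h n j) (G j)),
      (forall j, multideg (G j) = fs_base j) & f = fs_prod be G].
Proof.
move=> Nstr gN gc f0 degN.
have /choice[ah ahP] n : exists ah : R[i] * ('I_(size N) -> P),
    fs_factors ah.2 /\ g n = fs_prod ah.1 ah.2.
  by have [_ [a [h [hN gE]]]] := gN n; exists (a, h).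
pose a n := (ah n).1; pose h n := (ah n).2.
have hN n : fs_factors (h n) by case: (ahP n).
have hdeg n j : multideg (h n j) = fs_base j by exact: fs_factors_multideg.
have gc' : pcvg U (fun n => a n *: \prod_(j <- fs_indices N) h n j) f.
  by under eq_fun => n do rewrite -fs_prod_indices -(proj2 (ahP n)).
have [||c [G [be [c0 Gd G0 Gc fE]]]] := @factor_limits _ _ U FU _ _ (@fs_base l N) a h f _ _ gc'.
- by move=> n j; rewrite -(hdeg n j); exact: PP_multideg.
- by move=> n j; case: (fs_factors_irreducible j (hN n)).
rewrite -fs_prod_indices in fE.
have be0 : be != 0 by apply: contraNneq f0 => be0; rewrite fE /fs_prod be0 scale0r.
exists a, h, c, G, be; split=> // j.
apply/mnmP => i; apply/eqP; rewrite eqn_leq; have /mnm_lepP/(_ i) -> := Gd j.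
rewrite leqNgt /=; apply/negP => lt_ji.
have e0 := structure_exp_gt0 Nstr.
have : (multideg f i < fs_deg N i)%N.
  rewrite fE fs_prod_multideg // fs_degE !mnm_sumE (bigD1 j) //= [ltnRHS](bigD1 j) //=.
  rewrite -addSn leq_add //.
    by rewrite !mulmnE ltn_pmul2r.
  apply: leq_sum => k _; rewrite !mulmnE leq_mul2r.
  by have /mnm_lepP/(_ i) -> := Gd k; rewrite orbT.
by rewrite degN ltnn.
Qed.

Lemma pclosure_limit N (f : P) : pclosure (FM N) f ->
  exists (U : set_system nat) (g : nat -> P),
    [/\ UltraFilter U, forall n, FM N (g n) & pcvg U g f].
Proof.
move=> Nf; have [U [FU U0]] := @ultra_harmonic R.
have /choice[g gP] n : exists g, FM N g /\ pnorm (f - g) < harmonic n.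
  by apply: Nf; rewrite /harmonic invr_gt0.
exists U, g; split=> // [n|]; first by case: (gP n).
by apply: pcvg_small => // n; rewrite pnormB; case: (gP n) => _ /ltW.
Qed.

(** Passing to the limit keeps the degrees of the factors and can only lose
    parameters. *)
Lemma closure_codim M N (f : P) : has_structure f M -> is_structure R N ->
  fs_deg N = multideg f -> pclosure (FM N) f ->
  codim N <= codim M /\ (codim N = codim M -> fs_iso N M).
Proof.
move=> fM Nstr degN /pclosure_limit[U [g [FU gN gc]]].
have [M0 [al [q [al0 qM fE]]]] := fM.
have f0 : f != 0.
  by rewrite fE fs_prod_neq0 // => j; case: (fs_factors_irreducible j qM).
have [a [h [c [G [be [_ _ _ Gd fG]]]]]] := FM_limit FU Nstr gN gc f0 degN.
have [le_codim eq_codim] := compare_structures M0 qM f0 fE Nstr fG Gd.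
split=> // /eq_codim[pi [pib piE _]]; by exists pi.
Qed.

(** Local coordinates of the manifold of M near fs_prod al q: the leading scalar,
    as a constant factor with index None, and the factors, whose scale is
    pinned by the coefficient at the leading monomial of q. *)
Section Chart.
Variables (M : fstructure l) (al : R[i]) (q : 'I_(size M) -> P).
Hypothesis M0 : forall j : 'I_(size M), (0 < fs_exp j)%N.
Hypothesis al0 : al != 0.
Hypothesis qM : fs_factors q.
Local Notation T := (option 'I_(size M)).
Local Notation f0 := (fs_prod al q).

Definition chart_indices : seq T := None :: map Some (fs_indices M).
(** The scalar is a factor of degree zero. *)
Definition chart_deg (t : T) : 'X_{1..l} := if t is Some j then fs_base j else 0%MM.
Definition chart_point (c : R[i]) (g : 'I_(size M) -> P) (t : T) : P :=
  if t is Some j then g j else c%:MP.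
Definition chart_mark (t : T) : option 'X_{1..l} :=
  if t is Some j then Some (mlead (q j)) else None.
Local Notation J := chart_indices.
Local Notation u0 := (chart_point al q).

Lemma chart_prod c g : \prod_(t <- J) chart_point c g t = fs_prod c g.
Proof.
by rewrite big_cons big_map /= mul_mpolyC fs_prod_indices.
Qed.

Lemma chart_indices_deg : (\sum_(t <- J) chart_deg t)%MM = fs_deg M.
Proof.
rewrite big_cons big_map add0m fs_degE /fs_indices big_flatten /= big_map enumT.
apply: eq_bigr => j _; rewrite big_nseq.
by elim: (fs_exp j) => //= k ->; rewrite mulmS.
Qed.

Lemma q_irr j : irreducible (q j).
Proof. exact: fs_factors_irreducible. Qed.

Lemma q_neq0 j : q j != 0.
Proof. by case: (q_irr j). Qed.

Lemma f0_neq0 : f0 != 0.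
Proof. by rewrite fs_prod_neq0 //; exact: q_neq0. Qed.

Lemma chart_u0_deg t : PP (chart_deg t) (u0 t).
Proof.
case: t => [j|] /=; last by rewrite /PP /= multidegC; apply/mnm_lepP.
by rewrite -(fs_factors_multideg j qM); exact: PP_multideg.
Qed.

Lemma mem_chart_indices t : t \in J.
Proof. by case: t => [j|]; rewrite in_cons //= map_f // mem_fs_indices. Qed.

Lemma chart_sum_single (w : T -> P) (F : T -> P) t :
  (forall s, s != t -> w s = 0) ->
  \sum_(s <- J) w s * F s = (w t * F t) *+ count_mem t J.
Proof.
move=> w0; elim: chart_indices => [|s r IH]; first by rewrite big_nil.
rewrite big_cons IH /=; case: eqVneq => [->|st]; first by rewrite mulrS.
by rewrite w0 // mul0r add0r.
Qed.

Lemma mulrn_count_eq0 (p : P) t : p *+ count_mem t J = 0 -> p = 0.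
Proof.
have n0 : (0 < count_mem t J)%N by rewrite -has_count has_pred1 mem_chart_indices.
move=> /mpolyP H; apply/mpolyP => a; move: (H a).
by rewrite mcoeffMn !mcoeff0 => /eqP; rewrite mulrn_eq0 eqn0Ngt n0 => /eqP.
Qed.

Lemma chart_not_divides j : ~ divides (q j) (\prod_(t | t != Some j) u0 t).
Proof.
have [_ qU _] := q_irr j; have qP := irreducible_prime (q_irr j).
rewrite -big_filter => /(prime_divides_prod qP qU)[[i|]]; rewrite mem_filter.
  move=> /andP[ij _] /(irreducible_divides_assoc (q_irr j) (q_irr i)).
  by apply: (fs_factors_nassoc qM); apply: contraNneq ij => ->.
by move=> _ /(unit_divides (mpolyC_unit _ al0)) U; rewrite U in qU.
Qed.

(** Modulo q j, only the displacement of the j-th factor survives in the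
    derivative; so q j divides it, and the pinned coefficient makes it zero. *)
Lemma chart_d1_inj (w : T -> P) : (forall t, slice chart_deg chart_mark t (w t)) ->
  prod_d1 u0 w J = 0 -> forall t, w t = 0.
Proof.
move=> wS D0.
pose F t := \prod_(k | k != t) u0 k.
have SF0 : \sum_(t <- J) w t * F t = 0.
  have := prod_d1E u0 w J.
  rewrite D0 mulr0 chart_prod => /esym/eqP.
  by rewrite mulf_eq0 (negPf f0_neq0) /= => /eqP.
have wSome j : w (Some j) = 0.
  have [_ qU _] := q_irr j; have qP := irreducible_prime (q_irr j).
  pose w' t := if t == Some j then w t else 0.
  have w'E : \sum_(t <- J) w' t * F t = (w (Some j) * F (Some j)) *+ count_mem (Some j) J.
    by rewrite (@chart_sum_single w' F (Some j)) /w' ?eqxx // => s /negPf->.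
  have qF t : t != Some j -> divides (q j) (F t).
    move=> tj; rewrite /F (bigD1 (Some j)) 1?eq_sym //=.
    exact/divides_mulr/assoc_divides/assoc_refl.
  have : divides (q j) (\sum_(t <- J) w' t * F t).
    have -> : \sum_(t <- J) w' t * F t = \sum_(t <- J) (w' t - w t) * F t.
      under [RHS]eq_bigr do rewrite mulrBl.
      by rewrite sumrB SF0 subr0.
    apply: divides_sum => t _; rewrite /w'; case: eqVneq => [_|/qF].
      by rewrite subrr mul0r; exact: divides0.
    exact: divides_mull.
  rewrite w'E -scaler_nat => /divides_scale H.
  have {H} /qP[] : divides (q j) (w (Some j) * F (Some j)).
    apply: H; rewrite pnatr_eq0 -lt0n -has_count has_pred1; exact: mem_chart_indices.
  - move=> [h wE]; have [wd wm] := wS (Some j).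
    have [h0|h0] := eqVneq h 0; first by rewrite wE h0 mulr0.
    have : multideg h = 0%MM.
      apply/mnmP => i; rewrite mnm0E; apply/eqP; rewrite -leqn0.
      have /mnm_lepP/(_ i) := wd; rewrite wE multidegM ?q_neq0 // mnmDE.
      by rewrite (fs_factors_multideg j qM) -{2}[chart_deg _ i]addn0 leq_add2l.
    move/eqP; rewrite multideg_eq0 => /msize1_polyC hE.
    move: wm; rewrite wE hE mulrC mul_mpolyC mcoeffZ => /eqP.
    rewrite mulf_eq0 mleadc_eq0 (negPf (q_neq0 j)) orbF => /eqP->.
    by rewrite scale0r.
  - by move/chart_not_divides.
have w0 t : t != None -> w t = 0 by case: t.
case=> [j|]; first exact: wSome.
have := SF0; rewrite (@chart_sum_single w F None) // => /mulrn_count_eq0/eqP.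
rewrite mulf_eq0 => /orP[/eqP//|/eqP F0].
have : F None != 0; last by rewrite F0 eqxx.
by apply/prodf_neq0 => -[j|] //= _; exact: q_neq0.
Qed.

Definition in_chart (u : T -> P) : Prop :=
  forall t, slice chart_deg chart_mark t (u t - u0 t).

Lemma in_chart_u0 : in_chart u0.
Proof.
move=> t; rewrite subrr; split; first by apply/PP_coef => a _; rewrite mcoeff0.
by case: (chart_mark t) => // a; rewrite mcoeff0.
Qed.

Lemma in_chart_deg u t : in_chart u -> PP (chart_deg t) (u t).
Proof.
move=> uC; rewrite -(subrK (u0 t) (u t)).
by apply: PPD (chart_u0_deg t); case: (uC t).
Qed.

Lemma slice_sub t (u v : P) : slice chart_deg chart_mark t u ->
  slice chart_deg chart_mark t v -> slice chart_deg chart_mark t (u - v).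
Proof.
move=> [ud um] [vd vm]; split; first exact: PPB.
by case: (chart_mark t) um vm => // a um vm; rewrite mcoeffB um vm subr0.
Qed.

(** Irreducibility, coprimality and the nonvanishing of the scalar are open. *)
Lemma chart_open : exists2 rho : R, 0 < rho & forall u, in_chart u ->
  (forall t, pnorm (u t - u0 t) < rho) ->
  FM M (\prod_(t <- J) u t) /\
  exists (c : R[i]) (g : 'I_(size M) -> P),
    [/\ c != 0, u =1 chart_point c g & fs_factors g].
Proof.
have [r1 r10 H1] : exists2 r : R, 0 < r & forall j, forall v : P,
    PP (fs_base j) v -> pnorm (v - q j) < r -> irreducible v /\ multideg v = fs_base j.
  apply: fin_min_pos => [j r r' rr' H v vd vr|j].
    by apply: H => //; exact: lt_le_trans rr'.
  have [r r0 H] := irreducible_open (q_irr j).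
  by exists r => // v; rewrite -(fs_factors_multideg j qM); exact: H.
have [r2 r20 H2] : exists2 r : R, 0 < r & forall ij : 'I_(size M) * 'I_(size M),
    ij.1 != ij.2 -> forall u v : P, irreducible u -> irreducible v ->
    pnorm (u - q ij.1) < r -> pnorm (v - q ij.2) < r -> mcoprime u v.
  apply: fin_min_pos => [ij r r' rr' H nij u v uI vI ur vr|[i j] /=].
    by apply: H => //; exact: lt_le_trans rr'.
  have [->|ij] := eqVneq i j; first by exists 1.
  have [r r0 H] := coprime_open (q_irr i) (q_irr j) (fs_factors_nassoc qM ij).
  by exists r => // _; exact: H.
have al_gt0 : 0 < pnorm (al%:MP : P) by rewrite pnorm_gt0 mpolyC_eq0.
exists (Num.min (pnorm (al%:MP : P)) (Num.min r1 r2)); first by rewrite !lt_min al_gt0 r10.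
move=> u uC unear.
have unear1 t : pnorm (u t - u0 t) < pnorm (al%:MP : P).
  by have := unear t; rewrite lt_min => /andP[].
have unear2 t : pnorm (u t - u0 t) < r1.
  by have := unear t; rewrite !lt_min => /and3P[].
have unear3 t : pnorm (u t - u0 t) < r2.
  by have := unear t; rewrite !lt_min => /and3P[].
have [c uN] : exists c : R[i], u None = c%:MP.
  exists (u None)@_0; apply: msize1_polyC; rewrite -multideg_eq0; apply/eqP/mnmP => i.
  have /mnm_lepP/(_ i) := in_chart_deg None uC.
  by rewrite mnm0E leqn0 => /eqP.
have c0 : c != 0.
  apply: contraTneq (unear1 None) => c0; rewrite uN c0 mpolyC0 sub0r pnormN -leNgt.
  exact: lexx.
pose g j := u (Some j).
have gI j := H1 j (g j) (in_chart_deg (Some j) uC) (unear2 (Some j)).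
have gM : fs_factors g.
  split=> [j|i j ij].
    have [gjI gjd] := gI j; split=> //; split=> //; by case: gjI.
  by apply: (H2 (i, j) ij _ _ (proj1 (gI i)) (proj1 (gI j))); exact: unear3 (Some _).
have uE : u =1 chart_point c g by case.
split; last by exists c, g.
rewrite (eq_bigr _ (fun t _ => uE t)) chart_prod.
suff /has_structure_FM[] : has_structure (fs_prod c g) M by [].
by split=> //; exists c, g.
Qed.

(** Along a sequence of polynomials with structure M converging to the base
    point, the normalized factors converge; by comparison of codimensions the
    limits are the q j up to order and scale. *)
Lemma chart_local (rho : R) : 0 < rho -> exists2 delta : R, 0 < delta &
  forall g, FM M g -> pnorm (g - f0) < delta ->
  exists u, [/\ in_chart u, forall t, pnorm (u t - u0 t) < rho
    & g = \prod_(t <- J) u t].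
Proof.
move=> rho0; apply: ultra_bound => U FU U0 g gM glt.
have gc : pcvg U g f0 by apply: pcvg_small => // n; exact: ltW.
have f0M : has_structure f0 M by split=> //; exists al, q.
have Mstr : is_structure R M by exists f0.
have f0deg : fs_deg M = multideg f0.
  by have /has_structure_FM[_ [[_ ->]]] := f0M.
have [a [h [c [G [be [hg c0 Gc Gd f0G]]]]]] := FM_limit FU Mstr gM gc f0_neq0 f0deg.
have [_ /(_ erefl)[pi [pibij piM Gq]]] :=
  compare_structures M0 qM f0_neq0 erefl Mstr f0G Gd.
have [rh piK rhK] := pibij.
have rhM j : tnth (in_tuple M) (rh j) = tnth (in_tuple M) j by rewrite piM rhK.
have hI n j : irreducible (h n j) by apply: fs_factors_irreducible; case: (hg n).
have hd n j : multideg (h n (rh j)) = fs_base j.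
  by rewrite fs_factors_multideg; [rewrite /fs_base rhM|case: (hg n)].
pose lc j : R[i] := mleadc (q j).
have lc0 j : lc j != 0 by rewrite mleadc_eq0 q_neq0.
pose x n j := (h n (rh j))@_(mlead (q j)).
pose v n j := (lc j / x n j) *: h n (rh j).
have cx_cvg j : exists2 k, k != 0 & pcvg U (fun n => c n (rh j) *: h n (rh j)) (k *: q j).
  have [k k0 kE] := Gq (rh j); exists k => //.
  by have := Gc (rh j); rewrite kE rhK.
have cx_coef j : exists2 k, k != 0 /\ pcvg U (fun n => c n (rh j) *: h n (rh j)) (k *: q j)
    & ccvg U (fun n => c n (rh j) * x n j) (k * lc j).
  have [k k0 kc] := cx_cvg j; exists k => //.
  have := kc (mlead (q j)); rewrite mcoeffZ.
  by under eq_fun do rewrite mcoeffZ.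
have x0 : \forall n \near U, forall j, x n j != 0.
  apply: filter_forall => j; have [k [k0 _] kc] := cx_coef j.
  apply: filterS (ccvg_neq0 (mulf_neq0 k0 (lc0 j)) kc) => n.
  by apply: contraNneq => ->; rewrite mulr0.
have vc j : pcvg U (fun n => v n j) (q j).
  have [k [k0 kc] kx] := cx_coef j.
  have klc : k * lc j != 0 by rewrite mulf_neq0.
  have H : pcvg U (fun n => (lc j * (c n (rh j) * x n j)^-1) *: (c n (rh j) *: h n (rh j)))
      ((lc j * (k * lc j)^-1) *: (k *: q j)).
    by apply: pcvgZ => //; apply: ccvgM; [exact: ccvg_cst|exact: ccvgV].
  have -> : q j = (lc j * (k * lc j)^-1) *: (k *: q j).
    rewrite scalerA invfM mulrA [lc j * _]mulrC mulrAC -!mulrA.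
    rewrite [X in X *: _](_ : _ = 1) ?scale1r //.
    by move: k0 (lc0 j) => k0 l0; field; rewrite k0 l0.
  move=> b; apply: ccvg_near (H b); apply: filterS x0 => n xn.
  congr mcoeff; rewrite /v scalerA; congr (_ *: _).
  have := xn j; have := c0 n (rh j) => cn xnj.
  by field; rewrite cn xnj.
pose b n := a n * \prod_j (x n j / lc j) ^+ fs_exp j.
have gE : \forall n \near U, g n = fs_prod (b n) (v n).
  apply: filterS x0 => n xn; rewrite (proj2 (hg n)) /fs_prod /b -scalerA; congr (_ *: _).
  rewrite (reindex rh) /=; last by apply: onW_bij; exists pi.
  rewrite -scaler_prod; apply: eq_bigr => j _.
  rewrite /v -exprZn scalerA.
  rewrite [X in (X *: _) ^+ _](_ : _ = 1); last first.
    by have := xn j; have := lc0 j => l0 xnj; field; rewrite xnj l0.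
  by rewrite scale1r /fs_exp rhM.
have Pc : pcvg U (fun n => \prod_(j <- fs_indices M) v n j) (\prod_(j <- fs_indices M) q j).
  exact: pcvg_prod.
have P0 : \prod_(j <- fs_indices M) q j != 0.
  by rewrite prodf_seq_neq0; apply/allP => j _; exact: q_neq0.
have bPc : pcvg U (fun n => b n *: \prod_(j <- fs_indices M) v n j) f0.
  move=> e; apply: ccvg_near (gc e); apply: filterS gE => n ->.
  by rewrite fs_prod_indices.
have [be' bc bE] := pcvg_scalars Pc P0 bPc.
have be'E : be' = al.
  apply/eqP; rewrite -subr_eq0; apply/eqP.
  have /eqP : (be' - al) *: \prod_(j <- fs_indices M) q j = 0.
    by rewrite scalerBl -bE -fs_prod_indices subrr.
  by rewrite -mul_mpolyC mulf_eq0 mpolyC_eq0 (negPf P0) orbF => /eqP.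
rewrite be'E in bc.
pose u n := chart_point (b n) (v n).
have uc t : pcvg U (fun n => u n t) (u0 t).
  by case: t => [j|] /=; [exact: vc|exact: pcvgC].
have ud n t : PP (chart_deg t) (u n t).
  case: t => [j|] /=; last by rewrite /PP /= multidegC; apply/mnm_lepP.
  by apply: PPZ; rewrite -(hd n j); exact: PP_multideg.
have unear : \forall n \near U, forall t, pnorm (u n t - u0 t) < rho.
  apply: filter_forall => t.
  have N : (fun n => pnorm (u n t - u0 t)) @ U --> (0 : R).
    rewrite -(@pnorm0 R l); apply: (@pnorm_cvg _ _ _ _ (chart_deg t)).
      by move=> n; apply: PPB => //; exact: chart_u0_deg.
    by rewrite -(subrr (u0 t)); apply: pcvgB => //; exact: pcvg_cst.
  exact: (cvgr_lt _ N _ rho0).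
have [n [xn [gn un]]] := filter_ex (filterI x0 (filterI gE unear)).
exists n, (u n); split=> //; last by rewrite chart_prod.
move=> t; split; first by apply: PPB => //; exact: chart_u0_deg.
case: t => [j|] //=; rewrite mcoeffB mcoeffZ -/(x n j) -/(lc j).
by rewrite divfK ?subrr.
Qed.

End Chart.
End FactorManifold.

(** * Distances to the manifolds and the critical gap *)

Section Distances.
Variables (R : realType) (l : nat).
Local Notation P := (cpoly R l).
Implicit Types (f g p : P) (S : set P) (M N : fstructure l).

Lemma pdist_le f g S : S g -> pdist f S <= pnorm (f - g).
Proof.
move=> Sg; apply: ge_inf; last by exists g.
by exists 0 => _ [h _ <-]; exact: pnorm_ge0.
Qed.

Lemma pdist_ge f S (r : R) : S !=set0 -> (forall g, S g -> r <= pnorm (f - g)) ->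
  r <= pdist f S.
Proof.
move=> [g Sg] H; apply: lb_le_inf; first by exists (pnorm (f - g)), g.
by move=> _ [h Sh <-]; exact: H.
Qed.

Lemma pdist_lt f S (r : R) : S !=set0 -> pdist f S < r ->
  exists2 g, S g & pnorm (f - g) < r.
Proof.
move=> [g Sg] /inf_lt[|_ [h Sh <-] hr]; first by exists (pnorm (f - g)), g.
by exists h.
Qed.

Lemma pdist_ge0 f S : S !=set0 -> 0 <= pdist f S.
Proof. by move=> S0; apply: pdist_ge => // g _; exact: pnorm_ge0. Qed.

Lemma pdist_triangle f g S : S !=set0 -> pdist f S <= pnorm (f - g) + pdist g S.
Proof.
move=> S0; rewrite -lerBlDl; apply: pdist_ge => // h Sh; rewrite lerBlDl.
exact: le_trans (pdist_le f Sh) (pnorm_triangle g f h).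
Qed.

Lemma pdist_self f S : S f -> pdist f S = 0.
Proof.
move=> Sf; apply/eqP; rewrite eq_le pdist_ge0; last by exists f.
by have := pdist_le f Sf; rewrite subrr pnorm0 => ->.
Qed.

Lemma pdist_gt0 f S : S !=set0 -> ~ pclosure S f -> 0 < pdist f S.
Proof.
move=> S0 /existsNP[e /not_implyP[e0 He]]; apply: lt_le_trans e0 _.
apply: pdist_ge => // g Sg; rewrite leNgt; apply/negP => ge.
by apply: He; exists g.
Qed.

Lemma FM_nonempty M : is_structure R M -> (@FM R l M) !=set0.
Proof. by case=> f /has_structure_FM[_ fM]; exists f. Qed.

Lemma FM_iso_eq M N : fs_iso N M -> @FM R l N = FM M.
Proof.
move=> NM; apply/seteqP; split=> f; first exact: FM_iso.
exact/FM_iso/fs_iso_sym.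
Qed.

(** The gap is a minimum of positive distances over finitely many structures. *)
Lemma critical_gap_gt0 f : (0 < critical_gap f)%E.
Proof.
have [L LP] := @finite_structures R l (multideg f).
pose A M := [/\ is_structure R M, fs_deg M = multideg f & ~ pclosure (FM M) f].
have [r r0 H] : exists2 r : R, 0 < r & forall M, M \in L -> A M -> r <= pdist f (FM M).
  elim: L {LP} => [|M L [r r0 H]]; first by exists 1.
  have [[Mstr Mdeg Mf]|nA] := pselect (A M); last first.
    by exists r => // N; rewrite in_cons => /orP[/eqP->//|/H].
  exists (Num.min r (pdist f (FM M))).
    by rewrite lt_min r0; apply: pdist_gt0 => //; exact: FM_nonempty.
  move=> N; rewrite in_cons => /orP[/eqP-> _|NL AN]; first by rewrite ge_min lexx orbT.
  by rewrite ge_min H.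
apply: (@lt_le_trans _ _ r%:E); first by rewrite lte_fin.
by apply: le_ereal_inf_tmp => _ [M AM <-]; rewrite lee_fin; apply: H => //; apply: LP; case: AM.
Qed.

Lemma gap_closure f N (d : R) : is_structure R N -> fs_deg N = multideg f ->
  pdist f (FM N) <= d -> (d%:E < critical_gap f)%E -> pclosure (FM N) f.
Proof.
move=> Nstr Ndeg fN gap; apply: contrapT => Nf.
have : (critical_gap f <= (pdist f (FM N))%:E)%E by apply: ereal_inf_lbound; exists N.
by move=> /(lt_le_trans gap); rewrite lte_fin ltNge fN.
Qed.

(** The factor 1/2 leaves room for moving the data by up to half the gap; the
    case of an infinite gap is trivial. *)
Lemma gap_radius f : exists2 r : R, 0 < r & forall x eps : R, x <= r ->
  (eps%:E < (2^-1)%:E * critical_gap f)%E -> ((x + eps)%:E < critical_gap f)%E.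
Proof.
have := critical_gap_gt0 f; case: (critical_gap f) => [t| |] //; last first.
  by exists 1 => // x eps _ _; exact: ltry.
rewrite lte_fin => t0; exists (t / 2); first by rewrite divr_gt0.
by move=> x eps xt; rewrite -EFinM !lte_fin; lra.
Qed.

(** Once the structures within eps of f all have f0 in their closure, the
    comparison of codimensions selects the structure of f0. *)
Lemma numfactE f0 f (eps : R) M (phi : factorization R l) : has_structure f0 M ->
  f != 0 -> multideg f = multideg f0 -> pdist f (FM M) < eps ->
  (forall N, eps_structures f eps N -> pclosure (FM N) f0) ->
  numfact f eps phi <->
  [/\ FM M (fact_prod phi), irreducible_factorization phi,
      is_min (residuals f phi) (pdist f (FM M))
    & is_min [set pnorm (f - g) | g in FM M] (pdist f (FM M))].
Proof.
move=> f0M f_neq0 fdeg fMeps closeN.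
have Mdeg : fs_deg M = multideg f0 by have /has_structure_FM[_ [[_ ->]]] := f0M.
have Mstr : is_structure R M by exists f0.
have Meps : eps_structures f eps M by split; rewrite ?fdeg.
have cmp N : eps_structures f eps N ->
    codim N <= codim M /\ (codim N = codim M -> fs_iso N M).
  move=> Neps; have [Nstr Ndeg _] := Neps.
  by apply: (closure_codim f0M) => //; [rewrite -fdeg|exact: closeN].
have Mmax : is_max [set codim N | N in eps_structures f eps] (codim M).
  split; first by exists M.
  by move=> _ [N Neps <-]; case: (cmp N Neps).
split=> [[_ [N [Neps [_ Nmax] [phiN phiI] resN minN]]]|[phiM phiI resM minM]]; last first.
  by split=> //; exists M.
have [le_codim eq_codim] := cmp N Neps.
have NM : fs_iso N M.
  apply: eq_codim; apply/eqP; rewrite eq_le le_codim /=; apply: Nmax.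
  by exists M.
by rewrite -(FM_iso_eq NM); split.
Qed.

Lemma fdist_le (phi psi : factorization R l) (e : R) : 0 <= e ->
  lmatch (size (factors phi)) (fun p q => psin p q <= e) (factors phi) (factors psi) ->
  fdist phi psi <= e.
Proof.
move=> e0 [_ sz [sg sgP]]; rewrite /fdist (introT eqP (esym sz)).
apply: (le_trans (bigmin_le _ sg _)).
rewrite /match_dist; elim/big_ind: _ => // x y xe ye.
by rewrite ge_max xe.
Qed.

Lemma fequivP (phi psi : factorization R l) :
  fequiv phi psi <-> lmatch (size (factors phi)) (@assoc _ _) (factors phi) (factors psi).
Proof. by split=> [[sz [sg sgP]]|[_ sz [sg sgP]]]; split=> //; exists sg. Qed.

End Distances.

(** * Numerical factorizations as nearest points *)

Section NearestFactorization.
Variables (R : realType) (l : nat) (M : fstructure l).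
Variables (al : R[i]) (q : 'I_(size M) -> cpoly R l).
Hypothesis M0 : forall j : 'I_(size M), (0 < fs_exp j)%N.
Hypothesis al0 : al != 0.
Hypothesis qM : fs_factors q.
Local Notation P := (cpoly R l).
Local Notation f0 := (fs_prod al q).
Local Notation u0 := (chart_point al q).
Local Notation Phi u := (\prod_(t <- chart_indices M) u t).
Local Notation m := (fs_deg M).
Implicit Types (f g : P) (u v : option 'I_(size M) -> P).

(* rho is the radius of a ball of the chart, delta that of a ball around f0 in
   which the manifold comes from the ball of radius rho / 2, and r that of the
   neighborhood of f0 to which the data f belong. *)
Variables (rho lip delta kap r : R).
Hypothesis lip0 : 0 < lip.
Hypothesis kap0 : 0 < kap.
Hypothesis r0 : 0 < r.
Hypothesis chart_FM : forall u, in_chart al q u ->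
  (forall t, pnorm (u t - u0 t) < rho) ->
  FM M (Phi u) /\ exists (c : R[i]) (g : 'I_(size M) -> P),
    [/\ c != 0, u =1 chart_point c g & fs_factors g].
Hypothesis FM_chart : forall g, FM M g -> pnorm (g - f0) < delta ->
  exists u, [/\ in_chart al q u, forall t, pnorm (u t - u0 t) < rho / 2 & g = Phi u].
Hypothesis chart_stable : forall f g u v,
  close_pair (chart_indices M) (@chart_deg l M) u0 (chart_mark q) rho f g u v ->
  segment_min (chart_indices M) f u v -> segment_min (chart_indices M) g v u ->
  forall t, pnorm (u t - v t) <= lip * pnorm (f - g).
Hypothesis chart_norm : forall u, (forall t, pnorm (u t - u0 t) < rho) ->
  forall j, kap <= pnorm (u (Some j)).
Hypothesis rho0 : 0 < rho.
Hypothesis r_rho : r <= rho.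
Hypothesis r_delta : 3 * r <= delta.
Hypothesis r_f0 : 2 * r <= pnorm f0.

Definition near_f0 f := PP m f /\ pnorm (f - f0) < r.

Definition nearest f u :=
  [/\ in_chart al q u, forall t, pnorm (u t - u0 t) < rho
    & forall g, FM M g -> pnorm (f - Phi u) <= pnorm (f - g)].

Let FMf0 : FM M f0.
Proof. by have /has_structure_FM[] : has_structure f0 M by split=> //; exists al, q. Qed.

Lemma Phi_u0 : Phi u0 = f0.
Proof. exact: chart_prod. Qed.

Lemma nearest_pdist f u : nearest f u -> pdist f (FM M) = pnorm (f - Phi u).
Proof.
move=> [uC un umin]; apply/eqP; rewrite eq_le; apply/andP; split.
  by apply: pdist_le; case: (chart_FM uC un).
by apply: pdist_ge; [exists f0|].
Qed.

Lemma pdist_f0_le f : pdist f (FM M) <= pnorm (f - f0).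
Proof. exact: pdist_le. Qed.

Lemma nearest_of_FM f g : near_f0 f -> FM M g -> pnorm (f - g) = pdist f (FM M) ->
  exists2 u, nearest f u & g = Phi u.
Proof.
move=> [_ fr] gM fg.
have [|u [uC un gE]] := FM_chart gM.
  apply: le_lt_trans (pnorm_triangle f _ _) _; rewrite pnormB fg.
  by have := pdist_f0_le f; have := r_delta; have := r0; lra.
exists u => //; split=> // [t|h hM]; first by have := un t; have := rho0; lra.
by rewrite -gE fg; exact: pdist_le.
Qed.

(** Minimizing sequences stay in a compact part of the chart. *)
Lemma nearest_exists f : near_f0 f -> exists u, nearest f u.
Proof.
move=> [fm fr]; set d := pdist f (FM M).
have dr : d < r by apply: le_lt_trans (pdist_f0_le f) fr.
have FM0 : (FM M : set P) !=set0 by exists f0.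
have harm0 n : 0 < @harmonic R n by rewrite /harmonic invr_gt0.
have /choice[u uP] n : exists u, [/\ in_chart al q u,
    forall t, pnorm (u t - u0 t) < rho / 2 & pnorm (f - Phi u) <= d + harmonic n].
  have [|g gM fg] := @pdist_lt _ _ f (FM M) (d + Num.min (harmonic n) r) FM0.
    by rewrite ltrDl lt_min harm0 r0.
  have fg1 : pnorm (f - g) < d + harmonic n.
    by apply: lt_le_trans fg _; rewrite lerD2l ge_min lexx.
  have fg2 : pnorm (f - g) < d + r.
    by apply: lt_le_trans fg _; rewrite lerD2l ge_min lexx orbT.
  have [|u [uC un gE]] := FM_chart gM; last by exists u; split; rewrite -?gE // ltW.
  apply: le_lt_trans (pnorm_triangle f _ _) _; rewrite pnormB.
  by have := r_delta; lra.
have [U [FU U0]] := @ultra_harmonic R.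
have ud n t : PP (chart_deg t) (u n t).
  by apply: (in_chart_deg (q := q) (al := al)) => //; case: (uP n).
have /choice[v vP] t : exists p, PP (chart_deg t) p /\ pcvg U (fun n => u n t) p.
  have [n|n|p ? ?] := @ultralimit _ _ U FU (chart_deg t) (fun n => u n t)
      (rho / 2 + pnorm (u0 t)).
  - exact: ud.
  - rewrite -[u n t](subrK (u0 t)); apply: le_trans (pnormD _ _) _.
    by rewrite lerD2r ltW //; case: (uP n).
  - by exists p.
have vc t : pcvg U (fun n => u n t) (v t) by case: (vP t).
have u0d := chart_u0_deg al qM.
have vC : in_chart al q v.
  move=> t; split; first by apply: PPB => //; case: (vP t).
  have uC n := proj2 (let: And3 uC _ _ := uP n in uC t).
  case: (chart_mark q t) uC => // a uC.
  apply: (ccvg_unique (pcvgB (vc t) (@pcvg_cst _ _ U _ (u0 t)) a)).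
  by under eq_fun do rewrite uC; exact: ccvg_cst.
have vn t : pnorm (v t - u0 t) <= rho / 2.
  apply: (@ler_cvg_to _ U _ R (fun n => pnorm (u n t - u0 t)) (fun=> rho / 2)).
  - apply: (@pnorm_cvg _ _ _ _ (chart_deg t)); first by move=> n; exact: PPB.
    by apply: pcvgB => //; exact: pcvg_cst.
  - exact: cvg_cst.
  - by apply: nearW => n; apply: ltW; case: (uP n).
exists v; split=> // [t|g gM]; first by have := vn t; have := rho0; lra.
apply: le_trans (pdist_le f gM); rewrite -/d.
apply: (@ler_cvg_to _ U _ R (fun n => pnorm (f - Phi (u n))) (fun n => d + harmonic n)).
- apply: (@pnorm_cvg _ _ _ _ m).
    by move=> n; apply: PPB => //; rewrite -chart_indices_deg; exact: PP_prod.
  by apply: pcvgB; [exact: pcvg_cst|exact: pcvg_prod].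
- by rewrite -{2}[d]addr0; apply: cvgD => //; exact: cvg_cst.
- by apply: nearW => n; case: (uP n).
Qed.

Lemma nearest_segment f u v : nearest f u -> in_chart al q v ->
  (forall t, pnorm (v t - u0 t) < rho) -> segment_min (chart_indices M) f u v.
Proof.
move=> [uC un umin] vC vn x /andP[x0 x1]; apply: umin.
have wE t : move_along u (fun t => v t - u t) x t - u0 t
    = (1 - x)%:C%C *: (u t - u0 t) + x%:C%C *: (v t - u0 t).
  rewrite /move_along rmorphB rmorph1 -!mul_mpolyC mpolyCB mpolyC1; ring.
apply: (proj1 (chart_FM _ _)) => t; rewrite wE.
  have [ud um] := uC t; have [vd vm] := vC t.
  split; first by apply: PPD; exact: PPZ.
  case: (chart_mark q t) um vm => // a um vm.
  by rewrite mcoeffD !mcoeffZ um vm !mulr0 addr0.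
apply: le_lt_trans (pnormD _ _) _; rewrite !pnormZr ?subr_ge0 //.
have := un t; have := vn t; move: (pnorm _) (pnorm _) => B A Br Ar.
have [->|x_neq1] := eqVneq x 1; first by lra.
have H1 : 0 <= x * (rho - B) by rewrite mulr_ge0 ?subr_ge0 // ltW.
have H2 : 0 < (1 - x) * (rho - A) by rewrite mulr_gt0 ?subr_gt0 // lt_neqAle x_neq1.
by nra.
Qed.

Lemma nearest_stable f g u v : near_f0 f -> near_f0 g -> nearest f u -> nearest g v ->
  forall t, pnorm (u t - v t) <= lip * pnorm (f - g).
Proof.
move=> [fm fr] [gm gr] fu gv.
have [uC un _] := fu; have [vC vn _] := gv.
apply: chart_stable; [|exact: nearest_segment|exact: nearest_segment].
rewrite /close_pair chart_indices_deg chart_prod; split=> //.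
- by move=> t; exact: (in_chart_deg qM).
- move=> t; have := slice_sub (vC t) (uC t).
  by rewrite opprB addrA subrK.
- by split; apply: lt_le_trans r_rho.
Qed.

Lemma nearest_u0 : nearest f0 u0.
Proof.
split=> [|t|g _]; first exact: in_chart_u0.
  by rewrite subrr pnorm0.
by rewrite Phi_u0 subrr pnorm0 pnorm_ge0.
Qed.

Definition chart_factors u : seq P := [seq u (Some j) | j <- fs_indices M].

Lemma chart_factorsE u : in_chart al q u -> (forall t, pnorm (u t - u0 t) < rho) ->
  (forall p, p \in chart_factors u -> irreducible p) /\
  exists2 c : R[i], c != 0 & Phi u = c *: \prod_(p <- chart_factors u) p.
Proof.
move=> uC un; have [_ [c [g [c0 uE gM]]]] := chart_FM uC un; split.
  by move=> _ /mapP[j _ ->]; rewrite uE; exact: fs_factors_irreducible.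
by exists c => //; rewrite big_cons uE mul_mpolyC !big_map.
Qed.

(** The sine is a relative error, so the absolute bound on the factors is divided
    by the lower bound kap on their norms. *)
Lemma nearest_factors_match f g u v : near_f0 f -> near_f0 g ->
  nearest f u -> nearest g v ->
  lmatch (size (fs_indices M)) (fun p q => [/\ p != 0, q != 0
      & pnorm (p - q) <= lip / kap * pnorm (f - g) * pnorm p])
    (chart_factors u) (chart_factors v).
Proof.
move=> fN gN fu gv; have [uC un _] := fu; have [vC vn _] := gv.
apply: lmatch_id; rewrite ?size_map // => i iM.
rewrite !(nth_map (tnth (in_tuple (fs_indices M)) (Ordinal iM))) //.
move: (nth _ _ _) => k.
have uk := chart_norm un k; have vk := chart_norm vn k.
split; rewrite -?pnorm_gt0; try exact: lt_le_trans kap0 _.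
apply: le_trans (nearest_stable fN gN fu gv (Some k)) _.
have D0 : 0 <= lip * pnorm (f - g) by rewrite mulr_ge0 ?pnorm_ge0 // ltW.
have -> : lip / kap * pnorm (f - g) * pnorm (u (Some k))
    = lip * pnorm (f - g) * pnorm (u (Some k)) / kap by ring.
by rewrite ler_pdivlMr // ler_wpM2l.
Qed.

Lemma nearest_fdist f g u v (phi psi : factorization R l) : near_f0 f -> near_f0 g ->
  nearest f u -> nearest g v ->
  lmatch (size (factors phi)) (@assoc _ _) (factors phi) (chart_factors u) ->
  lmatch (size (factors psi)) (@assoc _ _) (factors psi) (chart_factors v) ->
  fdist phi psi <= lip / kap * pnorm (f - g).
Proof.
move=> fN gN fu gv phiu psiv; apply: fdist_le.
  by rewrite mulr_ge0 ?pnorm_ge0 // divr_ge0 // ltW.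
have nphi : size (fs_indices M) = size (factors phi).
  by case: phiu => _ <- _; rewrite size_map.
have npsi : size (factors psi) = size (factors phi).
  by case: psiv => _ <- _; rewrite size_map.
have uv := nearest_factors_match fN gN fu gv.
rewrite nphi in uv; rewrite npsi in psiv.
have vpsi := lmatch_sym (@assoc_sym _ _) psiv.
pose Q p y := exists x : P, assoc p x /\ [/\ x != 0, y != 0
      & pnorm (x - y) <= lip / kap * pnorm (f - g) * pnorm x].
have pv : lmatch (size (factors phi)) Q (factors phi) (chart_factors v).
  by apply: lmatch_trans phiu uv => p x y px xy; exists x.
apply: lmatch_trans pv vpsi => p y z [x [px [x0 y0 xy]]] yz.
exact: psin_le px (assoc_sym yz) x0 y0 xy.
Qed.

(** This excludes the zero multiple as a best approximation of f. *)
Lemma near_f0_gt f : near_f0 f -> f != 0 /\ pdist f (FM M) < pnorm f.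
Proof.
move=> [_ fr]; have : pnorm f0 <= pnorm (f - f0) + pnorm f.
  by rewrite -[X in pnorm X <= _](subrK f) pnormB; exact: pnormD.
have := pdist_f0_le f => fd ff.
have fgt : pnorm (f - f0) < pnorm f by have := r_f0; lra.
split; last exact: le_lt_trans fgt.
by rewrite -pnorm_gt0; apply: le_lt_trans fgt; exact: pnorm_ge0.
Qed.

(** A factorization attaining the distance to the manifold is the one read off
    from a nearest point of the chart. *)
Lemma nearest_of_factorization f (phi : factorization R l) : near_f0 f ->
  FM M (fact_prod phi) -> irreducible_factorization phi ->
  residuals f phi (pdist f (FM M)) ->
  exists2 u, nearest f u &
    lmatch (size (factors phi)) (@assoc _ _) (factors phi) (chart_factors u).
Proof.
move=> fN phiM phiI [c _ cE].
have [f_neq0 f_gt] := near_f0_gt fN.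
have c0 : c != 0.
  by apply: contraTneq f_gt => c0; rewrite -cE c0 scale0r subr0 ltxx.
have cM : FM M (c *: \prod_(p <- factors phi) p).
  have -> : c *: \prod_(p <- factors phi) p = (c / fcoef phi) *: fact_prod phi.
    by rewrite /fact_prod scalerA divfK //; exact: fcoef_neq0.
  by apply: FM_scale => //; rewrite mulf_neq0 // invr_eq0; exact: fcoef_neq0.
have [u fu uE] := nearest_of_FM fN cM cE.
exists u => //; have [uC un _] := fu.
have [uI [d d0 dE]] := chart_factorsE uC un.
by apply: (unique_factorization c0 d0) => //; rewrite uE.
Qed.

Lemma factorization_of_nearest f u : near_f0 f -> nearest f u ->
  exists phi : factorization R l,
  [/\ FM M (fact_prod phi), irreducible_factorization phi,
      is_min (residuals f phi) (pdist f (FM M)) & factors phi = chart_factors u].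
Proof.
move=> fN fu; have [uC un umin] := fu.
have [uI [c c0 cE]] := chart_factorsE uC un.
have nonconst : all (fun p : P => 1 < msize p)%N (chart_factors u).
  by apply/allP => p /uI; exact: irreducible_msize.
pose phi := Factorization c0 nonconst.
have phiE : fact_prod phi = Phi u by rewrite cE.
have phiM : FM M (fact_prod phi) by rewrite phiE; case: (chart_FM uC un).
exists phi; split=> //; split.
  by rewrite (nearest_pdist fu) cE; exists c.
move=> _ [d _ <-]; have [d0|d0] := eqVneq d 0.
  by rewrite d0 scale0r subr0 ltW //; case: (near_f0_gt fN).
apply: pdist_le.
have -> : d *: \prod_(p <- factors phi) p = (d / c) *: fact_prod phi.
  by rewrite /fact_prod scalerA divfK.
by apply: FM_scale => //; rewrite mulf_neq0 // invr_eq0.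
Qed.

End NearestFactorization.

(** * The numerical factorization theorem *)

Lemma multideg_open (R : realType) (l : nat) (f0 : cpoly R l) :
  exists2 r : R, 0 < r & forall f, PP (multideg f0) f -> pnorm (f - f0) < r ->
    multideg f = multideg f0.
Proof.
apply: (ultra_bound (F := fun f => pnorm (f - f0))) => U FU U0 f fm fr.
have fc : pcvg U f f0 by apply: pcvg_small => // n; exact: ltW.
exact: (filter_ex (near_multideg fm fc)).
Qed.

(** At the polynomial itself, every distance below the gap comes from a
    structure with the polynomial in its closure, and the distance to its own
    manifold is zero. *)
Lemma numfact_exact (R : realType) (l : nat) (f0 : cpoly R l)
    (phi0 : factorization R l) (M : fstructure l) (eps : R) :
  f0 != 0 -> has_structure f0 M -> factorization_of phi0 f0 ->
  irreducible_factorization phi0 ->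
  0 < eps -> (eps%:E < critical_gap f0)%E ->
  numfact f0 eps phi0 /\ forall phi, numfact f0 eps phi -> fequiv phi phi0.
Proof.
move=> f0_neq0 f0M [c c0 phiE] phiI eps0 gap.
have FMf0 : FM M f0 by have /has_structure_FM[] := f0M.
have d0 : pdist f0 (FM M) = 0 by exact: pdist_self.
have close N : eps_structures f0 eps N -> pclosure (FM N) f0.
  by move=> [Nstr Ndeg Neps]; exact: gap_closure (ltW Neps) gap.
have dist0 : pdist f0 (FM M) < eps by rewrite d0.
have nE phi := numfactE phi f0M f0_neq0 erefl dist0 close.
have f0E : f0 = (c^-1 * fcoef phi0) *: \prod_(p <- factors phi0) p.
  by rewrite -scalerA -/(fact_prod phi0) phiE scalerA mulVf ?scale1r.
split.
  apply/nE; rewrite d0; split=> //.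
  - by rewrite phiE; exact: FM_scale.
  - split; last by move=> _ [g _ <-]; exact: pnorm_ge0.
    by exists (c^-1 * fcoef phi0); rewrite // -f0E subrr pnorm0.
  - split; last by move=> _ [g _ <-]; exact: pnorm_ge0.
    by exists f0; rewrite // subrr pnorm0.
move=> phi /nE[_ psiI [[d _ dE] _] _]; apply/fequivP.
have f0d : f0 = d *: \prod_(p <- factors phi) p.
  by apply/eqP; rewrite -subr_eq0 -pnorm_eq0 dE d0.
have dn0 : d != 0 by apply: contraNneq f0_neq0 => d00; rewrite f0d d00 scale0r.
apply: (unique_factorization dn0 (d := c^-1 * fcoef phi0)) => //.
  by rewrite mulf_neq0 ?invr_eq0 //; exact: fcoef_neq0.
by rewrite -f0d -f0E.
Qed.

Lemma is_min_unique (R : realType) (A : set R) x y : is_min A x -> is_min A y -> x = y.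
Proof. by move=> [Ax lx] [Ay ly]; apply/eqP; rewrite eq_le lx // ly. Qed.

Theorem theorem6p2 (R : realType) (l : nat) (m : 'X_{1..l}) (f0 : cpoly R l)
    (phi0 : factorization R l)
    (hf0 : PPexact m f0)
    (hphi0 : factorization_of phi0 f0)
    (hirr : irreducible_factorization phi0) :
  (0 < critical_gap f0)%E /\
  (* (i) *)
  (forall eps : R, 0 < eps -> (eps%:E < critical_gap f0)%E ->
     numfact f0 eps phi0 /\
     forall phi, numfact f0 eps phi -> fequiv phi phi0) /\
  exists (Omega : set (cpoly R l)) (delta : cpoly R l -> R) (eta : R),
    let range (f : cpoly R l) : set R :=
      [set eps | delta f < eps /\ (eps%:E < (2^-1)%:E * critical_gap f0)%E] in
    [/\ nbhd_in m f0 Omega, 0 < eta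
      & forall f, Omega f -> delta f <= pnorm (f - f0)] /\
    (* (ii) *)
    (forall f, Omega f -> forall eps, range f eps -> numfact_unique f eps) /\
    numfact_lipschitz Omega range /\
    (* (iii) *)
    (forall f, Omega f -> forall eps, range f eps ->
       forall phi, numfact f eps phi ->
       forall alpha : R[i],
         let res := pnorm (f - alpha *: \prod_(p <- factors phi) p) in
         is_min (residuals f phi) res -> res <= pnorm (f - f0)) /\
    (* (iv) *)
    (forall f, Omega f -> forall eps, range f eps ->
       forall phi, numfact f eps phi ->
       same_structure (fact_prod phi) (fact_prod phi0) /\
       fdist phi phi0 <= eta * pnorm (f - f0)).
Proof.
have [f0_neq0 f0m] := hf0; have [c c0 phi0E] := hphi0.
have f0prod : f0 = (c^-1 * fcoef phi0) *: \prod_(p <- factors phi0) p.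
  by rewrite -scalerA -/(fact_prod phi0) phi0E scalerA mulVf ?scale1r.
have cf0 : c^-1 * fcoef phi0 != 0.
  by rewrite mulf_neq0 ?invr_eq0 //; exact: fcoef_neq0.
have [M f0M] : exists M, has_structure f0 M.
  by rewrite f0prod; exact: has_structure_prod.
split; first exact: critical_gap_gt0.
split; first by move=> eps eps0 gap; exact: (numfact_exact f0_neq0 f0M hphi0 hirr eps0 gap).
have [Mpos FMf0] : (forall j : 'I_(size M), (0 < fs_exp j)%N) /\ FM M f0.
  exact/has_structure_FM.
have Mm : fs_deg M = m by rewrite -f0m; case: FMf0 => -[_ ->].
have [_ [al [q [al0 qM f0E]]]] := f0M.
pose u0 := chart_point al q.
have [r1 r10 openP] := chart_open Mpos al0 qM.
have [r2 [lip [r20 lip0 stabP]]] :=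
  nearest_stability (chart_d1_inj Mpos al0 qM).
have [kap kap0 kapP] : exists2 k : R, 0 < k & forall j, 2 * k <= pnorm (q j).
  apply: fin_min_pos => [j r r' rr' H|j]; first by apply: le_trans H; lra.
  exists (pnorm (q j) / 2); last by lra.
  by rewrite divr_gt0 // pnorm_gt0; case: (fs_factors_irreducible j qM).
have [rho rho0 [rho1 rho2 rho3]] : exists2 rho : R, 0 < rho &
    [/\ rho <= r1, rho <= r2 & rho <= kap].
  exists (Num.min r1 (Num.min r2 kap)); first by rewrite !lt_min r10 r20.
  by rewrite !ge_min !lexx !orbT.
have [|dl dl0 localP] := chart_local Mpos al0 qM (rho := rho / 2).
  by rewrite divr_gt0.
have [r4 r40 degP] := multideg_open f0.
have [r5 r50 gapP] := gap_radius f0.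
have f0gt : 0 < pnorm f0 by rewrite pnorm_gt0.
have [r r0 [[r_rho r_dl r_f0] r_4 r_5]] : exists2 r : R, 0 < r &
    [/\ [/\ r <= rho, 3 * r <= dl & 2 * r <= pnorm f0], r <= r4 & r <= r5].
  exists (Num.min (Num.min rho (Num.min (dl / 3) (pnorm f0 / 2))) (Num.min r4 r5)).
    by rewrite !lt_min rho0 r40 r50 !divr_gt0.
  set r := Num.min _ _.
  have r_dl : r <= dl / 3 by rewrite /r !ge_min lexx !orbT.
  have r_f0 : r <= pnorm f0 / 2 by rewrite /r !ge_min lexx !orbT.
  split; last 1 first.
  - by rewrite /r !ge_min lexx !orbT.
  - by split; [rewrite /r !ge_min lexx|lra|lra].
  - by rewrite /r !ge_min lexx !orbT.
rewrite f0E in r_f0.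
have chart_FM u : in_chart al q u -> (forall t, pnorm (u t - u0 t) < rho) ->
    FM M (\prod_(t <- chart_indices M) u t) /\ exists (c : R[i]) (g : 'I_(size M) -> cpoly R l),
    [/\ c != 0, u =1 chart_point c g & fs_factors g].
  by move=> uC un; apply: openP => // t; exact: lt_le_trans (un t) rho1.
have chart_stable f g u v :
    close_pair (chart_indices M) (@chart_deg l M) u0 (chart_mark q) rho f g u v ->
    segment_min (chart_indices M) f u v -> segment_min (chart_indices M) g v u ->
    forall t, pnorm (u t - v t) <= lip * pnorm (f - g).
  move=> [fgm um uvS [fr gr] uvr]; apply: stabP; split=> //.
    by split; [exact: lt_le_trans fr rho2|exact: lt_le_trans gr rho2].
  by move=> t; have [ut vt] := uvr t; split; [exact: lt_le_trans ut rho2|exact: lt_le_trans vt rho2].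
have chart_norm u : (forall t, pnorm (u t - u0 t) < rho) ->
    forall j, kap <= pnorm (u (Some j)).
  move=> un j; have := pnormD (u0 (Some j) - u (Some j)) (u (Some j)).
  rewrite subrK pnormB; have := un (Some j); have := kapP j.
  by rewrite /u0 /=; lra.
pose Omega : set (cpoly R l) := near_f0 al q r.
pose delta (f : cpoly R l) : R := pdist f (FM M).
have OmegaP f : Omega f -> [/\ PP m f, pnorm (f - f0) < r & multideg f = multideg f0].
  rewrite /Omega /near_f0 -f0E Mm => -[fm fr]; split=> //.
  by apply: degP (lt_le_trans fr r_4); rewrite f0m.
have delta_le f : delta f <= pnorm (f - f0) by exact: pdist_le.
have Omega_gt f : Omega f -> f != 0 /\ pdist f (FM M) < pnorm f.
  exact: (near_f0_gt Mpos al0 qM r_f0).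
have nE f eps phi : Omega f ->
    delta f < eps /\ (eps%:E < (2^-1)%:E * critical_gap f0)%E ->
    numfact f eps phi <-> [/\ FM M (fact_prod phi), irreducible_factorization phi,
      is_min (residuals f phi) (pdist f (FM M))
    & is_min [set pnorm (f - g) | g in FM M] (pdist f (FM M))].
  move=> fO [feps gap]; have [fm fr fd] := OmegaP f fO.
  have [f_neq0 _] := Omega_gt f fO.
  apply: (numfactE phi f0M f_neq0 fd feps) => N [Nstr Ndeg Neps].
  have xr5 : pnorm (f - f0) <= r5 by exact: ltW (lt_le_trans fr r_5).
  apply: gap_closure (gapP _ _ xr5 gap); rewrite -?fd //.
  have := pdist_triangle f0 f (FM_nonempty Nstr).
  by rewrite pnormB; move: Neps; lra.
have nearE f eps phi : Omega f ->
    delta f < eps /\ (eps%:E < (2^-1)%:E * critical_gap f0)%E -> numfact f eps phi ->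
    exists2 u, nearest al q rho f u
      & lmatch (size (factors phi)) (@assoc _ _) (factors phi) (chart_factors u).
  move=> fO feps /(nE f eps phi fO feps)[phiM phiI [res _] _].
  exact: (nearest_of_factorization Mpos al0 qM r0 chart_FM localP rho0 r_dl r_f0).
have dist_le f g u v phi psi : Omega f -> Omega g -> nearest al q rho f u ->
    nearest al q rho g v ->
    lmatch (size (factors phi)) (@assoc _ _) (factors phi) (chart_factors u) ->
    lmatch (size (factors psi)) (@assoc _ _) (factors psi) (chart_factors v) ->
    fdist phi psi <= lip / kap * pnorm (f - g).
  exact: (nearest_fdist qM lip0 kap0 chart_FM chart_stable chart_norm r_rho).
have f0O : Omega f0.
  by rewrite /Omega /near_f0 -f0E subrr pnorm0 Mm -f0m; split=> //; exact: PP_multideg.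
exists Omega, delta, (lip / kap); split; [split|split; [|split; [|split]]].
- split; first by move=> f /OmegaP[].
  by exists r; split=> // f fm fr; rewrite /Omega /near_f0 -f0E Mm.
- by rewrite divr_gt0.
- by move=> f _; exact: delta_le.
- move=> f fO eps feps.
  have [u fu] := nearest_exists Mpos al0 qM r0 localP rho0 r_dl fO.
  have [phi [phiM phiI resM phiu]] :=
    factorization_of_nearest Mpos al0 qM chart_FM r_f0 fO fu.
  exists phi.
    apply/(nE f eps phi fO feps); split=> //; split; last first.
      by move=> _ [g gM <-]; exact: pdist_le.
    rewrite (nearest_pdist Mpos al0 qM chart_FM fu).
    by exists (\prod_(t <- chart_indices M) u t) => //; have [uC un _] := fu; case: (chart_FM u uC un).
  move=> psi /(nearE f eps psi fO feps)[v fv psiv]; apply/fequivP.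
  have uv : v =1 u.
    move=> t; have := nearest_stable qM chart_FM chart_stable r_rho fO fO fv fu t.
    rewrite subrr pnorm0 mulr0 => vu0; apply/eqP.
    by rewrite -subr_eq0 -pnorm_eq0 eq_le vu0 pnorm_ge0.
  by rewrite phiu /chart_factors -(eq_map (fun j => uv (Some j))).
- move=> f fO; exists 1, (lip / kap); split=> //.
  move=> g h eps eps' phi psi gO hO _ _ geps heps.
  move=> /(nearE g eps phi gO geps)[u gu phiu] /(nearE h eps' psi hO heps)[v hv psiv].
  exact: dist_le gu hv phiu psiv.
- move=> f fO eps feps phi /(nE f eps phi fO feps)[_ _ resM _] alpha res res_min.
  by rewrite (is_min_unique res_min resM); exact: delta_le.
- move=> f fO eps feps phi phiN.
  have [u fu phiu] := nearE f eps phi fO feps phiN.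
  have /(nE f eps phi fO feps)[phiM _ _ _] := phiN; split.
    exists M; split; apply/has_structure_FM; split=> //.
    by rewrite phi0E; exact: FM_scale.
  have f0u : nearest al q rho f0 u0.
    by rewrite f0E; exact: nearest_u0.
  apply: (dist_le f f0 u u0) => //.
  have [uC un _] := f0u; have [u0I [d d0 dE]] := chart_factorsE chart_FM uC un.
  apply: (unique_factorization cf0 d0) => //.
  by rewrite -f0prod -dE f0E; exact: esym (chart_prod _ _).
Qed.
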